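(* Let $(M,\pi)$ be a Poisson manifold and let $X\subset (M,\pi)$ be a coregular submanifold. Then there exists an open neighborhood $V$ of $X$ in $M$ such that the saturation of $X$ inside $(V,\pi|_V)$ is an embedded Poisson submanifold.
   Context: For a Poisson manifold $(M,\pi)$, $\pi^\sharp:T^*M\to TM$ is defined by $\langle\pi^\sharp(\alpha),\beta\rangle=\pi(\alpha,\beta)$. An embedded submanifold $X\subset M$ is called coregular if the bundle map $\mathrm{pr}\circ\pi^\sharp:T^*M|_X\to TM|_X/TX$ (with $\mathrm{pr}:TM|_X\to TM|_X/TX$ the projection) has constant rank. The saturation of $X$ in a Poisson manifold is the union of all symplectic leaves that intersect $X$. The saturation of $X$ inside $(V,\pi|_V)$ is thus the union of all symplectic leaves of the Poisson manifold $(V,\pi|_V)$ that intersect $X$. A submanifold $P\subset(M,\pi)$ is a Poisson submanifold if $\pi^\sharp(T^*M|_P)\subset TP$. *)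

(* Defs.v *)
From HB Require Import structures.
From mathcomp Require Import all_boot all_order all_algebra.
From mathcomp Require Import all_classical all_reals all_analysis.

Set Implicit Arguments.
Unset Strict Implicit.
Unset Printing Implicit Defensive.

Import Order.TTheory GRing.Theory Num.Theory.
Import numFieldNormedType.Exports.

Local Open Scope classical_set_scope.
Local Open Scope ring_scope.

(* Vectors and covectors in local coordinates are row vectors, so that the
   differential of g at p is v |-> v *m jacobian g p, its image is the row
   space of jacobian g p, and (jacobian g p) i j is the i-th partial
   derivative of the j-th component of g. *)

Definition partial (R : realType) (n : nat) (i : 'I_n) (f : 'rV[R]_n -> R) :
  'rV[R]_n -> R := fun x => 'D_(delta_mx 0 i) f x.

(* The functions below are total, with irrelevant values outside U; U is
   always an open set. *)
Fixpoint Ck_on (R : realType) (n k : nat) (U : set 'rV[R]_n)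
    (f : 'rV[R]_n -> R) : Prop :=
  (forall x, U x -> {for x, continuous f}) /\
  (if k is k'.+1 then
     forall i : 'I_n, (forall x, U x -> derivable f x (delta_mx 0 i)) /\
                      Ck_on k' U (partial i f)
   else True).

Definition smooth_on (R : realType) (m n : nat) (U : set 'rV[R]_m)
    (g : 'rV[R]_m -> 'rV[R]_n) : Prop :=
  forall (k : nat) (j : 'I_n), Ck_on k U (fun x => g x 0 j).

Record chart (R : realType) (n : nat) (M : topologicalType) := Chart {
  cdom : set M;
  cmap : M -> 'rV[R]_n;
  cinv : 'rV[R]_n -> M;
  cdom_open : open cdom;
  cimg_open : open (cmap @` cdom);
  cmap_continuous : forall x, cdom x -> {for x, continuous cmap};
  cinv_continuous :
    forall y, (cmap @` cdom) y -> {for y, continuous cinv};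
  cmapK : forall x, cdom x -> cinv (cmap x) = x }.

Definition transition (R : realType) (n : nat) (M : topologicalType)
    (c c' : chart R n M) : 'rV[R]_n -> 'rV[R]_n := cmap c' \o cinv c.

Definition compatible (R : realType) (n : nat) (M : topologicalType)
    (c c' : chart R n M) : Prop :=
  smooth_on (cmap c @` (cdom c `&` cdom c')) (transition c c') /\
  smooth_on (cmap c' @` (cdom c `&` cdom c')) (transition c' c).

Record manifold (R : realType) (n : nat) := Manifold {
  points :> topologicalType;
  atlas : set (chart R n points);
  points_hausdorff : hausdorff_space points;
  points_second_countable : @second_countable points;
  atlas_cover : forall x : points, exists2 c, atlas c & cdom c x;
  atlas_compatible :
    forall c c', atlas c -> atlas c' -> compatible c c';
  atlas_maximal :
    forall c, (forall c', atlas c' -> compatible c c') -> atlas c }.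

Definition chart_at (R : realType) (n : nat) (M : manifold R n)
    (x : M) (c : chart R n M) : Prop := atlas c /\ cdom c x.

Section Maps.
Context (R : realType) (m n : nat) (N : manifold R m) (M : manifold R n).
Implicit Types (f : N -> M) (d : chart R m N) (c : chart R n M).

Definition local_expr f d c : 'rV[R]_m -> 'rV[R]_n :=
  cmap c \o f \o cinv d.

Definition smooth_map f : Prop :=
  continuous f /\
  forall d c, atlas d -> atlas c ->
    smooth_on (cmap d @` (cdom d `&` f @^-1` cdom c)) (local_expr f d c).

Definition differential_mx f d c (y : N) : 'M[R]_(m, n) :=
  jacobian (local_expr f d c) (cmap d y).

Definition immersion f : Prop :=
  smooth_map f /\
  forall y d c, chart_at y d -> chart_at (f y) c ->
    row_free (differential_mx f d c y).

End Maps.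

(* An immersed submanifold of M: a subset (the range of the injective map
   incl) with its own manifold topology and smooth structure, such that the
   inclusion is an immersion. *)
Record submanifold (R : realType) (n : nat) (M : manifold R n) :=
  Submanifold {
    sdim : nat;
    space :> manifold R sdim;
    incl : space -> M;
    incl_inj : injective incl;
    incl_immersion : immersion incl }.

Section Submanifolds.
Context (R : realType) (n : nat) (M : manifold R n).

Definition support_set (S : submanifold M) : set M := range (@incl R n M S).

Definition embedded (S : submanifold M) : Prop :=
  forall U : set S, open U ->
    exists2 W : set M, open W & U = @incl R n M S @^-1` W.

(* The rows span the tangent space of S at y, in the coordinates of c; the
   span does not depend on the chart d of S. *)
Definition tangent_mx (S : submanifold M) (d : chart R (sdim S) S)
    (c : chart R n M) (y : S) : 'M[R]_(sdim S, n) :=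
  differential_mx (@incl R n M S) d c y.

End Submanifolds.

(* A Poisson bivector field, given by its components
     bivec c x i j = pi_x (dx_i, dx_j)
   in each chart c of the atlas at each point x of its domain (the other
   values are irrelevant), transforming as a contravariant 2-tensor.  The
   last field says that the components of the Schouten bracket [pi, pi]
   vanish.  In coordinates, pi^sharp alpha = alpha *m bivec c x, so that the
   row space of bivec c x is the image of pi^sharp at x. *)
Record poisson (R : realType) (n : nat) (M : manifold R n) := Poisson {
  bivec : chart R n M -> M -> 'M[R]_n;
  bivec_skew : forall x c, chart_at x c -> (bivec c x)^T = - bivec c x;
  bivec_smooth : forall c, atlas c -> forall (i : 'I_n),
    smooth_on (cmap c @` cdom c) (fun y => row i (bivec c (cinv c y)));
  bivec_tensor : forall x c c', chart_at x c -> chart_at x c' ->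
    let J := jacobian (transition c c') (cmap c x) in
    bivec c' x = J^T *m bivec c x *m J;
  bivec_jacobi : forall x c, chart_at x c ->
    let P i j := fun y => bivec c (cinv c y) i j in
    let T i j k := \sum_l bivec c x i l * partial l (P j k) (cmap c x) in
    forall i j k, T i j k + T j k i + T k i j = 0 }.

Section PoissonSubmanifolds.
Context (R : realType) (n : nat) (M : manifold R n) (pi : poisson M).

(* cokermx (tangent_mx d c y) is the matrix of the projection from the
   tangent space of M onto its quotient by the tangent space of S. *)
Definition coregular (S : submanifold M) : Prop :=
  exists r : nat, forall (y : S) d c,
    chart_at y d -> chart_at (incl y) c ->
    \rank (bivec pi c (incl y) *m cokermx (tangent_mx d c y)) = r.

Definition poisson_submanifold (S : submanifold M) : Prop :=
  forall (y : S) d c, chart_at y d -> chart_at (incl y) c ->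
    (bivec pi c (incl y) <= tangent_mx d c y)%MS.

(* Connected integral submanifolds, inside the open set V, of the
   characteristic distribution x |-> im (pi^sharp)_x. *)
Definition integral_in (V : set M) (S : submanifold M) : Prop :=
  [/\ connected [set: S], support_set S `<=` V &
      forall (y : S) d c, chart_at y d -> chart_at (incl y) c ->
        (tangent_mx d c y == bivec pi c (incl y))%MS].

(* The symplectic leaves of the Poisson manifold (V, pi|_V), V open in M:
   the maximal connected integral submanifolds. *)
Definition symplectic_leaf (V : set M) (L : submanifold M) : Prop :=
  integral_in V L /\
  forall L' : submanifold M, integral_in V L' ->
    support_set L `<=` support_set L' -> support_set L' = support_set L.

Definition saturation (V X : set M) : set M :=
  [set x | exists L : submanifold M,
     [/\ symplectic_leaf V L, support_set L `&` X !=set0 &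
         support_set L x]].

End PoissonSubmanifolds.

(* Main.v *)
(* Fix a point of X, with the coordinates chosen so that X is a linear slice,
   and let r be the constant rank of pr \o pi^sharp.  There are r covectors a and
   r columns W, vanishing on TX, with a pi W invertible.  Flowing along the
   vector fields Z = (a pi W)^-1 a pi produces a chart in which the rays
   q + t (e F), issued from the slice (q - p) W = 0 which contains X, are
   Hamiltonian curves for a smooth family of covectors.  Transporting pi along
   such a ray with the linearised Hamiltonian flow (the Jacobi identity) shows
   that the slice P spanned by TX and F is a Poisson submanifold.  When TX = 0
   and r is the rank of pi, the same computation gives charts in which the
   slices of rank r are integral manifolds of im pi^sharp; these plaques are
   glued along chains into the symplectic leaves.
     A leaf which meets P stays in it, because the distance to P satisfies a
   Gronwall inequality along the leaf, and every point of P lies on a ray issued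
   from X, hence on the leaf of a point of X.  So P is the saturation of X in a
   small box, and two such P's have the same germ along X.  Countably many of
   them are assembled into a single submanifold over a neighbourhood V which is
   shrunk so that the pieces agree. *)

Require Import Defs.
From HB Require Import structures.
From mathcomp Require Import all_boot all_order all_algebra.
From mathcomp Require Import all_classical all_reals all_analysis.
From mathcomp Require Import ring lra.

Set Implicit Arguments.
Unset Strict Implicit.
Unset Printing Implicit Defensive.

Import Order.TTheory GRing.Theory Num.Theory.
Import numFieldNormedType.Exports.
Import Defs.

Local Open Scope classical_set_scope.
Local Open Scope ring_scope.

(** * Differential calculus on row vectors *)

(** The symplectic foliation is singular: the rank of [pi] may jump along [X], and only the
    transversal rank [r] is constant, so Frobenius does not apply. Rays avoid this, since one smooth
    frame of Hamiltonian directions exists along them whatever the rank. Their covectors [e *m Ah]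
    vary from point to point and need not be closed, so the flow of the rays need not preserve [pi].
    The transport is therefore done with the covector frozen at each time, where the Jacobi identity
    gives an exact linear equation. The discrepancy with the Jacobian of the actual field is a
    combination of rows of [pi], and it disappears on the columns killed by the transported [pi]. A
    second obstacle is that the saturation depends on [V], since a smaller [V] cuts the leaves. Both
    inclusions are therefore kept local: points of a tube are joined to [X] inside arbitrarily small
    open sets, and leaving the tube is excluded by an open-closed argument along leaves of any
    dimension. To make countably many tubes agree near [X] they are numbered, so that each
    neighbourhood has only finitely many conditions to meet. *)

Section MatrixNorm.
Context {R : realType}.

Lemma ler_mxE p q (M : 'M[R]_(p, q)) i j : `|M i j| <= `|M|.
Proof.
rewrite [leRHS]/Num.Def.normr/= mx_normrE.
exact: (@le_bigmax _ _ _ _ _ (i, j)).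
Qed.

Lemma mx_norm_le p q (M : 'M[R]_(p, q)) e :
  0 <= e -> (forall i j, `|M i j| <= e) -> `|M| <= e.
Proof.
move=> e0 Me; rewrite [leLHS]/Num.Def.normr/= mx_normrE.
by apply/bigmax_leP; split=> // -[i j] _; exact: Me.
Qed.

Lemma mx_norm_lt p q (M : 'M[R]_(p, q)) e :
  0 < e -> (forall i j, `|M i j| < e) -> `|M| < e.
Proof.
move=> e0 Me; rewrite [ltLHS]/Num.Def.normr/= mx_normrE.
by apply/bigmax_ltP; split=> // -[i j] _; exact: Me.
Qed.

Lemma norm_mulmx p q r (M : 'M[R]_(p, q)) (N : 'M[R]_(q, r)) :
  `|M *m N| <= q%:R * `|M| * `|N|.
Proof.
apply: mx_norm_le => [|i j]; first by rewrite !mulr_ge0.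
rewrite mxE; apply: le_trans (ler_norm_sum _ _ _) _.
apply: (@le_trans _ _ (\sum_(k < q) `|M| * `|N|)).
  by apply: ler_sum => k _; rewrite normrM ler_pM // ler_mxE.
by rewrite big_const_ord iter_addr_0 -mulrA mulr_natl.
Qed.

Lemma cvg_mxP (T : Type) (F : set_system T) (FF : Filter F) p q
    (f : T -> 'M[R]_(p, q)) (M : 'M[R]_(p, q)) :
  (f @ F --> M) <-> forall i j, (fun x => f x i j) @ F --> M i j.
Proof.
split=> [fM i j|fM].
  apply/cvgrPdist_lt => e e0; move/cvgrPdist_lt: fM => /(_ _ e0).
  apply: filterS => x; apply: le_lt_trans.
  by have := ler_mxE (M - f x) i j; rewrite !mxE.
apply/cvgrPdist_lt => e e0.
have : \forall x \near F, forall i j, `|M i j - f x i j| < e.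
  apply: filter_forall => i; apply: filter_forall => j.
  by move/cvgrPdist_lt: (fM i j) => /(_ _ e0).
apply: filterS => x xe; apply: mx_norm_lt => // i j.
by rewrite !mxE; exact: xe.
Qed.

Lemma continuous_mxP (T : topologicalType) p q (f : T -> 'M[R]_(p, q)) x :
  {for x, continuous f} <->
  forall i j, {for x, continuous (fun y => f y i j)}.
Proof. exact: cvg_mxP. Qed.

Lemma continuous_sum (T : topologicalType) (I : Type) (r : seq I)
    (F : I -> T -> R) x : (forall i, {for x, continuous (F i)}) ->
  {for x, continuous (fun y => \sum_(i <- r) F i y)}.
Proof.
move=> cF; elim: r => [|k s ih].
  rewrite (_ : (fun _ => _) = fun=> 0); first exact: cst_continuous.
  by apply/funext => y; rewrite big_nil.
rewrite (_ : (fun _ => _) = fun y => F k y + \sum_(i <- s) F i y).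
  by apply: continuousD; [exact: cF|exact: ih].
by apply/funext => y; rewrite big_cons.
Qed.

Lemma continuous_mulmx (T : topologicalType) p q r (f : T -> 'M[R]_(p, q))
    (g : T -> 'M[R]_(q, r)) x :
  {for x, continuous f} -> {for x, continuous g} ->
  {for x, continuous (fun y => f y *m g y)}.
Proof.
move=> /continuous_mxP cf /continuous_mxP cg; apply/continuous_mxP => i j.
have h k : {for x, continuous (fun y => f y i k * g y k j)}.
  by apply: cvgM; [exact: cf|exact: cg].
rewrite /prop_for /continuous_at mxE.
under eq_fun do rewrite mxE.
exact: (continuous_sum (F := fun k y => f y i k * g y k j)).
Qed.

Lemma continuous_mxE p q (i : 'I_p) (j : 'I_q) :
  continuous (fun M : 'M[R]_(p, q) => M i j).
Proof. by move=> M; apply: (proj1 (continuous_mxP id M) _ i j) => //. Qed.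

End MatrixNorm.

Section Lines.
Context {R : realType}.

(** The two difference quotients are the same function of [h]. Directional derivatives thereby
    become derivatives of curves, to which the mean value theorem applies. *)
Lemma is_derive_line (V W : normedModType R) (f : V -> W) b v (s : R) d :
  is_derive s 1 (fun t => f (b + t *: v)) d <-> is_derive (b + s *: v) v f d.
Proof.
have E : (fun h : R => h^-1 *: (f (b + (h *: 1 + s) *: v) - f (b + s *: v))) =
  (fun h : R => h^-1 *: (f (h *: v + (b + s *: v)) - f (b + s *: v))).
  apply/funext => h; congr (_ *: (f _ - _)).
  by rewrite [h%:A]mulr1 scalerDl addrCA.
split=> -[h1 h2]; split.
- by move: h1; rewrite /derivable /= E.
- by move: h2; rewrite /derive /= E.
- by move: h1; rewrite /derivable /= E.
- by move: h2; rewrite /derive /= E.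
Qed.

Lemma is_derive_cvg (f : R -> R) (x d : R) : is_derive x 1 f d -> {for x, continuous f}.
Proof. by move=> [h _]; apply: differentiable_continuous; apply/derivable1_diffP. Qed.

(** The mean value theorem for [b - f] and [b + f]. The comparison function [b] need not be linear:
    the Gronwall and Picard estimates take exponentials. *)
Lemma mvt_bound (f df b db : R -> R) (t : R) : 0 <= t ->
  (forall s : R, 0 < s < t -> is_derive s 1 f (df s)) ->
  (forall s : R, 0 < s < t -> is_derive s 1 b (db s)) ->
  (forall s : R, 0 < s < t -> `|df s| <= db s) ->
  {within `[0, t], continuous f} -> {within `[0, t], continuous b} ->
  `|f t - f 0| <= b t - b 0.
Proof.
move=> t0 fd bd fb cf cb.
have aux (g dg : R -> R) : (forall s : R, 0 < s < t -> is_derive s 1 g (dg s)) ->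
   (forall s : R, 0 < s < t -> dg s <= db s) ->
   {within `[0, t], continuous g} -> g t - g 0 <= b t - b 0.
  move=> gd gb cg; move: t0; rewrite le_eqVlt => /predU1P[<-|t0].
    by rewrite !subrr.
  have [||c ci e] := @MVT _ (b \- g) (db \- dg) _ _ t0.
  - move=> x; rewrite in_itv /= => xi; have := gd _ xi; have := bd _ xi.
    by move=> h1 h2; exact: is_deriveB.
  - by move=> x; apply: continuousB; [exact: cb|exact: cg].
  - rewrite -subr_ge0 opprB addrC -addrA [_ + (b t - b 0)]addrC addrA.
    suff : 0 <= (b t - g t) - (b 0 - g 0) by lra.
    move: e => /= ->; move: ci; rewrite in_itv /= => ci; rewrite subr0.
    apply: mulr_ge0; last exact: ltW.
    by rewrite subr_ge0 gb.
rewrite ler_norml; apply/andP; split.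
  rewrite lerNl opprB.
  have := aux (fun x => - f x) (fun x => - df x).
  move=> H; rewrite -(opprK (f 0)) addrC; apply: H.
  - by move=> s /fd h; exact: is_deriveN.
  - by move=> s /fb; rewrite ler_norml => /andP[h _]; rewrite lerNl.
  - by move=> x; apply: continuousN; exact: cf.
by apply: (aux f df) => // s /fb; rewrite ler_norml => /andP[].
Qed.

Lemma within_derive (f df : R -> R) (A : set R) :
  (forall s : R, A s -> is_derive s 1 f (df s)) -> {within A, continuous f}.
Proof.
move=> fd; apply: continuous_in_subspaceT => x /[1!inE] xA.
by apply: is_derive_cvg (fd _ xA).
Qed.

Lemma mvt_seg (f df : R -> R) (t C : R) :
  (forall s : R, `|s| <= `|t| -> is_derive s 1 f (df s)) ->
  (forall s : R, `|s| <= `|t| -> `|df s| <= C) -> `|f t - f 0| <= C * `|t|.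
Proof.
wlog t0 : t f df / 0 <= t => [wl|].
  have [t0|/ltW t0] := leP 0 t; first exact: wl.
  move=> fd fb; have := wl (- t) (f \o -%R) (fun s => - df (- s)).
  rewrite normrN oppr_ge0 /= opprK oppr0; apply => // s st; last first.
    by rewrite normrN; apply: fb; rewrite normrN.
  rewrite -mulN1r.
  have h := fd (- s); rewrite normrN in h; have {}h := h st.
  have := is_derive1_comp h (is_deriveNid s 1).
  by rewrite mulrC.
move=> fd fb; rewrite [X in _ <= _ * X]ger0_norm //.
have sI s : 0 < s < t -> `|s| <= `|t|.
  by move=> /andP[s0 st]; rewrite !ger0_norm // ltW.
have sI' (s : R) : `[0, t]%classic s -> `|s| <= `|t|.
  by rewrite /= in_itv /= => /andP[s0 st]; rewrite !ger0_norm.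
have := @mvt_bound f df (fun s => C * s) (fun=> C) t t0.
rewrite mulr0 subr0; apply.
- by move=> s /sI /fd.
- move=> s _; have := is_deriveZ (f:=id) (x:=s) (v:=1) C.
  move=> /(_ _ (is_derive_id _ _)) h.
  by apply: is_derive_eq; rewrite [_ *: _]mulr1.
- by move=> s /sI /fb.
- by apply: within_derive => s /sI'; exact: fd.
- apply: continuous_subspaceT => x; exact: mulrl_continuous.
Qed.

Lemma is_derive_diff_comp (V : normedModType R) n (g : V -> 'rV[R]_n)
    (f : 'rV[R]_n -> R) x v d :
  is_derive x v g d -> differentiable f (g x) ->
  is_derive x v (f \o g) ('d f (g x) d).
Proof.
move=> gd fd; rewrite -[x]addr0 -(scale0r v) -is_derive_line.
have : is_derive (0 : R) 1 (fun t : R => g (x + t *: v)) d.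
  by apply/is_derive_line; rewrite scale0r addr0.
move=> [/derivable1_diffP hd hv].
have fd' : differentiable f (g (x + 0 *: v)) by rewrite scale0r addr0.
have cd : differentiable (f \o (fun t : R => g (x + t *: v))) 0.
  exact: differentiable_comp.
apply: DeriveDef; first by apply/derivable1_diffP.
rewrite deriveE // (diff_comp hd fd') /=.
by rewrite -hv deriveE // scale0r addr0.
Qed.

Lemma diff_partial n (f : 'rV[R]_n -> R) a d : differentiable f a ->
  'd f a d = \sum_l d 0 l * partial l f a.
Proof.
move=> fd; rewrite {1}[d]row_sum_delta linear_sum; apply: eq_bigr => l _.
by rewrite linearZ /= /partial deriveE.
Qed.

Lemma is_derive_comp_partial (V : normedModType R) n (g : V -> 'rV[R]_n)
    (f : 'rV[R]_n -> R) x v d :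
  is_derive x v g d -> differentiable f (g x) ->
  is_derive x v (f \o g) (\sum_l d 0 l * partial l f (g x)).
Proof. by move=> gd fd; rewrite -diff_partial //; exact: is_derive_diff_comp. Qed.

Lemma is_derive_mxP (V : normedModType R) p q (f : V -> 'M[R]_(p, q)) x v d :
  is_derive x v f d <-> forall i j, is_derive x v (fun y => f y i j) (d i j).
Proof.
split=> [[h1 <-] i j|h].
  apply: DeriveDef; first by apply: (proj1 (derivable_mxP _ _ _) h1).
  by rewrite derive_mx // mxE.
have hd : derivable f x v by apply/derivable_mxP => i j; have [] := h i j.
apply: DeriveDef => //; rewrite derive_mx //; apply/matrixP => i j; rewrite mxE.
by have [] := h i j.
Qed.

End Lines.

Section Ck.
Context {R : realType} {n : nat}.
Implicit Types (U V : set 'rV[R]_n) (f g : 'rV[R]_n -> R).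

Lemma Ck_on_continuous k U f x : Ck_on k U f -> U x -> {for x, continuous f}.
Proof. by case: k => [|k] [cf _]; exact: cf. Qed.

Lemma Ck_onW k U f : Ck_on k.+1 U f -> Ck_on k U f.
Proof.
elim: k f => [|k ih] f [cf df]; split=> // i.
by have [dfi Cfi] := df i; split=> //; exact: ih.
Qed.

Lemma Ck_on_le m k U f : (m <= k)%N -> Ck_on k U f -> Ck_on m U f.
Proof.
by move=> /subnK <-; elim: (k - m)%N => // d ih; rewrite addSn => /Ck_onW /ih.
Qed.

(** Every clause of [Ck_on] is a condition at the points of the set on a function defined
    everywhere, so one set [V] per point is enough, and [V] need not be a neighbourhood. *)
Lemma Ck_on_local k U f :
  (forall x, U x -> exists2 V, V x & Ck_on k V f) -> Ck_on k U f.
Proof.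
elim: k f => [|k ih] f h; split.
- by move=> x /h [V Vx] [cf _]; exact: cf.
- by [].
- by move=> x /h [V Vx] [cf _]; exact: cf.
move=> i; split.
  by move=> x /h [V Vx] [_ df]; exact: (df i).1.
by apply: ih => x /h [V Vx] [_ df]; exists V => //; exact: (df i).2.
Qed.

Lemma Ck_on_sub k U V f : U `<=` V -> Ck_on k V f -> Ck_on k U f.
Proof. by move=> UV Vf; apply: Ck_on_local => x /UV; exists V. Qed.

Lemma near_continuous (T T' : topologicalType) (f g : T -> T') x :
  (\forall y \near x, f y = g y) ->
  {for x, continuous f} -> {for x, continuous g}.
Proof.
move=> ne; rewrite /prop_for /continuous_at -(nbhs_singleton ne) => cf.
exact: cvg_trans (near_eq_cvg ne) cf.
Qed.

Lemma open_near U x : open U -> U x -> \forall y \near x, U y.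
Proof. by move=> oU Ux; exact: open_nbhs_nbhs. Qed.

Lemma Ck_on_ext k U f g : open U -> (forall x, U x -> f x = g x) ->
  Ck_on k U f -> Ck_on k U g.
Proof.
move=> oU; elim: k f g => [|k ih] f g fg [cf df].
  split=> // x Ux; have ne : \forall y \near x, f y = g y.
    by apply: filterS (open_near oU Ux) => y; exact: fg.
  exact: near_continuous ne (cf x Ux).
have ne x : U x -> \forall y \near x, f y = g y.
  by move=> Ux; apply: filterS (open_near oU Ux) => y; exact: fg.
split=> [x Ux|i].
  exact: near_continuous (ne x Ux) (cf x Ux).
have [dfi Cfi] := df i; split.
  by move=> x Ux; apply: near_eq_derivable (dfi x Ux); exact: ne.
apply: ih Cfi => x Ux; apply: near_eq_derive; exact: ne.
Qed.

Lemma Ck_on_cst k U (c : R) : Ck_on k U (fun=> c).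
Proof.
elim: k c => [|k ih] c; split=> //; try by move=> x _; exact: cst_continuous.
move=> i; split=> [x _|]; first exact: derivable_cst.
rewrite (_ : partial i _ = fun=> 0) //.
by apply/funext => x; rewrite /partial derive_cst.
Qed.

Lemma is_derive_coord (x v : 'rV[R]_n) j :
  is_derive x v (fun y => y 0 j) (v 0 j).
Proof. by apply: (proj1 (is_derive_mxP id x v v)). Qed.

Lemma Ck_on_coord k U j : Ck_on k U (fun y => y 0 j).
Proof.
case: k => [|k]; split=> //; try by move=> x _; exact: continuous_mxE.
move=> i; split=> [x _|].
  by have [] := is_derive_coord x (delta_mx 0 i) j.
rewrite (_ : partial i _ = fun=> (delta_mx 0 i : 'rV[R]_n) 0 j).
  exact: Ck_on_cst.
by apply/funext => x; have [] := is_derive_coord x (delta_mx 0 i) j.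
Qed.

Lemma Ck_onD k U f g : open U ->
  Ck_on k U f -> Ck_on k U g -> Ck_on k U (fun x => f x + g x).
Proof.
move=> oU; elim: k f g => [|k ih] f g [cf df] [cg dg].
  by split=> // x Ux; apply: continuousD; [exact: cf|exact: cg].
split=> [x Ux|i]; first by apply: continuousD; [exact: cf|exact: cg].
have [dfi Cfi] := df i; have [dgi Cgi] := dg i.
split=> [x Ux|]; first by apply: derivableD; [exact: dfi|exact: dgi].
apply: Ck_on_ext (ih _ _ Cfi Cgi) => // x Ux.
by rewrite /partial; apply/esym; apply: deriveD; [exact: dfi|exact: dgi].
Qed.

Lemma Ck_onM k U f g : open U ->
  Ck_on k U f -> Ck_on k U g -> Ck_on k U (fun x => f x * g x).
Proof.
move=> oU; elim: k f g => [|k ih] f g Cf Cg.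
  split=> // x Ux.
  by apply: continuousM; [exact: (Ck_on_continuous Cf)|exact: (Ck_on_continuous Cg)].
split=> [x Ux|i].
  by apply: continuousM; [exact: (Ck_on_continuous Cf)|exact: (Ck_on_continuous Cg)].
have [dfi Cfi] := Cf.2 i; have [dgi Cgi] := Cg.2 i.
split=> [x Ux|]; first by apply: derivableM; [exact: dfi|exact: dgi].
apply: (@Ck_on_ext _ _ (fun x => f x * partial i g x + g x * partial i f x)) => //.
  by move=> x Ux; apply/esym; apply: deriveM; [exact: dfi|exact: dgi].
by apply: Ck_onD => //; apply: ih => //; exact: Ck_onW.
Qed.

Lemma Ck_onV k U f : open U -> (forall x, U x -> f x != 0) ->
  Ck_on k U f -> Ck_on k U (fun x => (f x)^-1).
Proof.
move=> oU f0; elim: k => [|k ih] Cf.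
  by split=> // x Ux; apply: continuousV; [exact: f0|exact: (Ck_on_continuous Cf)].
split=> [x Ux|i].
  by apply: continuousV; [exact: f0|exact: (Ck_on_continuous Cf)].
have [dfi Cfi] := Cf.2 i.
split=> [x Ux|]; first by apply: derivableV; [exact: f0|exact: dfi].
apply: (@Ck_on_ext _ _ (fun x => (-1 * ((f x)^-1 * (f x)^-1)) * partial i f x)) => //.
  move=> x Ux; rewrite [RHS](deriveV (f0 x Ux) (dfi x Ux)).
  by rewrite /partial -exprVn mulN1r expr2.
have Ci := ih (Ck_onW Cf).
by do 2!apply: Ck_onM => //; [exact: Ck_on_cst|exact: Ck_onM].
Qed.

Lemma Ck_on_sum (I : Type) (r : seq I) k U (F : I -> 'rV[R]_n -> R) : open U ->
  (forall i, Ck_on k U (F i)) -> Ck_on k U (fun x => \sum_(i <- r) F i x).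
Proof.
move=> oU CF; elim: r => [|i r ih].
  by under eq_fun do rewrite big_nil; exact: Ck_on_cst.
by under eq_fun do rewrite big_cons; exact: Ck_onD.
Qed.

Lemma Ck_on_prod (I : Type) (r : seq I) k U (F : I -> 'rV[R]_n -> R) : open U ->
  (forall i, Ck_on k U (F i)) -> Ck_on k U (fun x => \prod_(i <- r) F i x).
Proof.
move=> oU CF; elim: r => [|i r ih].
  by under eq_fun do rewrite big_nil; exact: Ck_on_cst.
by under eq_fun do rewrite big_cons; exact: Ck_onM.
Qed.

(* Telescoping over the coordinates of the increment. *)
Lemma C1_differentiable U f x : open U -> Ck_on 1 U f -> U x ->
  differentiable f x.
Proof.
move=> oU [cf df] Ux.
pose L (h : 'rV[R]_n) := \sum_i h 0 i * partial i f x.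
have linL : linear L.
  move=> a u v; rewrite /L scaler_sumr -big_split /=; apply: eq_bigr => i _.
  by rewrite !mxE mulrDl [_ *: _]mulrA.
pose LM := GRing.isLinear.Build R 'rV[R]_n R^o _ L linL.
pose L' : {linear 'rV[R]_n -> R^o} := HB.pack L LM.
have cL : continuous L'.
  move=> y; rewrite /L' /= /L.
  suff : {for y, continuous L} by [].
  refine (continuous_sum (T := 'rV[R]_n) (F := fun k z => z 0 k * partial k f x) _) => k.
  by apply: continuousM; [exact: continuous_mxE|exact: cst_continuous].
suff fE : (f : 'rV[R]_n -> R^o) \o shift x =
      cst (f x : R^o) + (L' : 'rV[R]_n -> R^o) +o_ (0 : 'rV[R]_n) id.
  have dE := @diff_unique R _ _ f L' x cL fE.
  by apply/diff_locallyP; rewrite dE; split.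
apply/eqaddoP => e e0 /=.
(* [n.+1] instead of [n] keeps the quotient positive when [n = 0]. *)
have e'0 : 0 < e / n.+1%:R by rewrite divr_gt0.
have : \forall y \near x, U y /\ forall i, `|partial i f y - partial i f x| <= e / n.+1%:R.
  apply: filterI; first exact: open_near.
  refine (@filter_forall _ _ _ _ (nbhs_filter x) _) => i.
  have [_ [+ _]] := df i => /(_ x Ux) /cvgrPdist_le /(_ _ e'0).
  by apply: filterS => y; rewrite distrC.
move=> /nbhs_ballP [r /= r0 rP].
apply/nbhs_ballP; exists r => //= h; rewrite -ball_normE /= sub0r normrN => hr.
rewrite !fctE /=.
pose tr (j : nat) : 'rV[R]_n := \row_i (if (i < j)%N then h 0 i else 0).
have step (j : 'I_n) : `|f (x + tr j.+1) - f (x + tr j) - h 0 j * partial j f x|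
    <= e / n.+1%:R * `|h|.
  have trS : tr j.+1 = tr j + h 0 j *: delta_mx 0 j.
    apply/rowP => i; rewrite !mxE ltnS eqxx /=.
    have [->|ij] := eqVneq i j; first by rewrite ltnn leqnn add0r mulr1.
    by rewrite mulr0 addr0 leq_eqVlt (_ : (i == j :> nat) = false) //; exact/negbTE.
  pose g (t : R) := f (x + tr j + t *: delta_mx 0 j) - t * partial j f x.
  have inr (t : R) : `|t| <= `|h 0 j| ->
      U (x + tr j + t *: delta_mx 0 j) /\
      `|partial j f (x + tr j + t *: delta_mx 0 j) - partial j f x| <= e / n.+1%:R.
    move=> th; have [|U1 U2] := rP (x + tr j + t *: delta_mx 0 j); last by split.
    rewrite -ball_normE /= -addrA opprD addrA subrr sub0r normrN.
    apply: le_lt_trans hr; apply: mx_norm_le => // a i; rewrite !mxE ord1 eqxx /=.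
    have [->|ij] := eqVneq i j.
      by rewrite ltnn add0r mulr1; apply: le_trans th _; exact: ler_mxE.
    rewrite mulr0 addr0; case: ifP => _; rewrite ?normr0 //; exact: ler_mxE.
  have -> : f (x + tr j.+1) - f (x + tr j) - h 0 j * partial j f x =
      g (h 0 j) - g 0.
    by rewrite /g scale0r addr0 mul0r subr0 trS (addrA x) [RHS]addrAC.
  apply: le_trans (@mvt_seg R g (fun t =>
     partial j f (x + tr j + t *: delta_mx 0 j) - partial j f x)
     (h 0 j) (e / n.+1%:R) _ _) _.
  - move=> s /inr [Us _]; apply: is_deriveB.
      apply/is_derive_line; apply: DeriveDef => //.
      by have [+ _] := df j => /(_ _ Us).
    have := is_deriveZ (f := (id : R -> R)) (x:=s) (v:=1) (partial j f x).
    move=> /(_ _ (is_derive_id _ _)); rewrite [_ *: 1]mulr1.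
    by congr is_derive; apply/funext => t; rewrite mulrC.
  - by move=> s /inr [].
  - by rewrite ler_wpM2l ?(ltW e'0) // ler_mxE.
have tele : f (h + x) - f x - L h =
    \sum_(j < n) (f (x + tr j.+1) - f (x + tr j) - h 0 j * partial j f x).
  rewrite sumrB /L; congr (_ - _).
  rewrite -(big_mkord xpredT (fun j => f (x + tr j.+1) - f (x + tr j))).
  rewrite telescope_sumr //.
  have -> : tr 0 = 0 by apply/rowP => i; rewrite !mxE ltn0.
  have -> : tr n = h by apply/rowP => i; rewrite mxE ltn_ord.
  by rewrite addr0 [h + x]addrC.
rewrite opprD addrA tele; apply: le_trans (ler_norm_sum _ _ _) _.
apply: le_trans (ler_sum _ (fun j _ => step j)) _.
rewrite big_const_ord iter_addr_0 -[leLHS]mulr_natl mulrA ler_wpM2r //.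
by rewrite mulrCA ger_pMr // ler_pdivrMr // mul1r ler_nat.
Qed.

End Ck.

Section Cmx.
Context {R : realType} {n : nat}.
Implicit Types (U : set 'rV[R]_n).

Definition Cmx p q k U (Z : 'rV[R]_n -> 'M[R]_(p, q)) : Prop :=
  forall i j, Ck_on k U (fun x => Z x i j).

Lemma smooth_onE m U (g : 'rV[R]_n -> 'rV[R]_m) :
  smooth_on U g <-> forall k, Cmx k U g.
Proof.
by split=> [sg k i j|sg k j]; [rewrite (ord1 i); exact: sg|exact: sg].
Qed.

Section Ops.
Context (k : nat) (U : set 'rV[R]_n) (oU : open U).

Lemma Cmx_continuous p q (Z : 'rV[R]_n -> 'M[R]_(p, q)) x :
  Cmx k U Z -> U x -> {for x, continuous Z}.
Proof.
by move=> CZ Ux; apply/continuous_mxP => i j; exact: Ck_on_continuous (CZ i j) Ux.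
Qed.

Lemma Cmx_cst p q (M : 'M[R]_(p, q)) : Cmx k U (fun=> M).
Proof. by move=> i j; exact: Ck_on_cst. Qed.

Lemma Cmx_id : Cmx k U id.
Proof. by move=> i j; rewrite (ord1 i); exact: Ck_on_coord. Qed.

Lemma Cmx_ext p q (Z Y : 'rV[R]_n -> 'M[R]_(p, q)) :
  (forall x, U x -> Z x = Y x) -> Cmx k U Z -> Cmx k U Y.
Proof.
by move=> ZY CZ i j; apply: Ck_on_ext (CZ i j) => // x Ux; rewrite ZY.
Qed.

Lemma CmxD p q (Z Y : 'rV[R]_n -> 'M[R]_(p, q)) :
  Cmx k U Z -> Cmx k U Y -> Cmx k U (fun x => Z x + Y x).
Proof.
move=> CZ CY i j; under eq_fun do rewrite mxE; exact: Ck_onD.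
Qed.

Lemma CmxZ p q (f : 'rV[R]_n -> R) (Y : 'rV[R]_n -> 'M[R]_(p, q)) :
  Ck_on k U f -> Cmx k U Y -> Cmx k U (fun x => f x *: Y x).
Proof.
move=> CZ CY i j; under eq_fun do rewrite mxE; exact: Ck_onM.
Qed.

Lemma CmxN p q (Y : 'rV[R]_n -> 'M[R]_(p, q)) :
  Cmx k U Y -> Cmx k U (fun x => - Y x).
Proof.
move=> CY; under eq_fun do rewrite -scaleN1r.
by apply: CmxZ => //; exact: Ck_on_cst.
Qed.

Lemma CmxB p q (Z Y : 'rV[R]_n -> 'M[R]_(p, q)) :
  Cmx k U Z -> Cmx k U Y -> Cmx k U (fun x => Z x - Y x).
Proof. by move=> CZ CY; apply: CmxD => //; exact: CmxN. Qed.

Lemma Cmx_tr p q (Y : 'rV[R]_n -> 'M[R]_(p, q)) :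
  Cmx k U Y -> Cmx k U (fun x => (Y x)^T).
Proof. by move=> CY i j; under eq_fun do rewrite mxE; exact: CY. Qed.

Lemma CmxM p q r (Z : 'rV[R]_n -> 'M[R]_(p, q)) (Y : 'rV[R]_n -> 'M[R]_(q, r)) :
  Cmx k U Z -> Cmx k U Y -> Cmx k U (fun x => Z x *m Y x).
Proof.
move=> CZ CY i j; under eq_fun do rewrite mxE.
by apply: Ck_on_sum => // l; exact: Ck_onM.
Qed.

Lemma Ck_on_det p (Z : 'rV[R]_n -> 'M[R]_p) :
  Cmx k U Z -> Ck_on k U (fun x => \det (Z x)).
Proof.
move=> CZ; rewrite /determinant; apply: Ck_on_sum => // s.
apply: Ck_onM => //; first exact: Ck_on_cst.
exact: Ck_on_prod.
Qed.

Lemma Cmx_inv p (Z : 'rV[R]_n -> 'M[R]_p) :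
  (forall x, U x -> Z x \in unitmx) ->
  Cmx k U Z -> Cmx k U (fun x => invmx (Z x)).
Proof.
move=> Zu CZ.
(* Cramer's rule: the inverse is made of polynomials in the entries and one reciprocal. *)
apply: (@Cmx_ext _ _ (fun x => (\det (Z x))^-1 *: \adj (Z x))).
  by move=> x /Zu u; rewrite /invmx u.
apply: CmxZ; first apply: Ck_onV => //.
- by move=> x /Zu; rewrite unitmxE unitfE.
- exact: Ck_on_det.
move=> i j; under eq_fun do rewrite mxE.
apply: Ck_onM => //; first exact: Ck_on_cst.
apply: Ck_on_det => a b; under eq_fun do rewrite !mxE; exact: CZ.
Qed.

End Ops.

Lemma Cmx_sub p q k U V (Z : 'rV[R]_n -> 'M[R]_(p, q)) :
  U `<=` V -> Cmx k V Z -> Cmx k U Z.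
Proof. by move=> UV CZ i j; exact: Ck_on_sub (CZ i j). Qed.

Lemma Cmx_le m p q k U (Z : 'rV[R]_n -> 'M[R]_(p, q)) :
  (m <= k)%N -> Cmx k U Z -> Cmx m U Z.
Proof. by move=> UV CZ i j; exact: Ck_on_le (CZ i j). Qed.

Lemma Cmx_local p q k U (Z : 'rV[R]_n -> 'M[R]_(p, q)) :
  (forall x, U x -> exists2 V, V x & Cmx k V Z) -> Cmx k U Z.
Proof.
by move=> h i j; apply: Ck_on_local => x /h [V Vx CV]; exists V.
Qed.

Lemma C1_differentiable_rV m U (g : 'rV[R]_n -> 'rV[R]_m) x :
  open U -> Cmx 1 U g -> U x -> differentiable g x.
Proof.
move=> oU Cg Ux.
rewrite (_ : g = \sum_(j < m) (fun y => g y 0 j *: delta_mx 0 j)); last first.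
  by apply/funext => y; rewrite fct_sumE -row_sum_delta.
apply: differentiable_sum => j; apply: differentiableZl.
exact: C1_differentiable (Cg 0 j) Ux.
Qed.

Lemma jacobianE m (g : 'rV[R]_n -> 'rV[R]_m) x i j : differentiable g x ->
  jacobian g x i j = partial i (fun y => g y 0 j) x.
Proof.
move=> dg; rewrite /partial.
have := deriveEjacobian (delta_mx 0 i) dg.
rewrite -rowE derive_mx; last exact: diff_derivable.
by move=> /matrixP /(_ 0 j); rewrite !mxE.
Qed.

Lemma is_derive_jacobian m U (g : 'rV[R]_n -> 'rV[R]_m) x v : open U ->
  Cmx 1 U g -> U x -> is_derive x v g (v *m jacobian g x).
Proof.
move=> oU Cg Ux; have dg := C1_differentiable_rV oU Cg Ux.
by rewrite -deriveEjacobian //; apply/derivableP; exact: diff_derivable.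
Qed.

Lemma is_derive_comp_jacobian (V : normedModType R) m U
    (f : 'rV[R]_n -> 'rV[R]_m) (g : V -> 'rV[R]_n) x v d : open U ->
  Cmx 1 U f -> U (g x) -> is_derive x v g d ->
  is_derive x v (f \o g) (d *m jacobian f (g x)).
Proof.
move=> oU Cf Ux gd; apply/is_derive_mxP => i j; rewrite (ord1 i) mxE.
have df := C1_differentiable_rV oU Cf Ux.
have := is_derive_comp_partial gd (C1_differentiable oU (Cf 0 j) Ux).
rewrite (_ : \sum_l _ = \sum_j0 d 0 j0 * jacobian f (g x) j0 j) //.
by apply: eq_bigr => l _; rewrite jacobianE.
Qed.

Lemma Cmx_jacobian m k U (g : 'rV[R]_n -> 'rV[R]_m) : open U ->
  Cmx k.+1 U g -> Cmx k U (jacobian g).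
Proof.
move=> oU Cg i j; apply: Ck_on_ext ((Cg 0 j).2 i).2 => // x Ux.
rewrite jacobianE //; apply: C1_differentiable_rV Ux => //.
exact: Cmx_le Cg.
Qed.

End Cmx.

Lemma unitmx_open (R : realType) n k (U : set 'rV[R]_n) (Z : 'rV[R]_n -> 'M[R]_k) :
  open U -> Cmx 0 U Z -> open [set x | U x /\ Z x \in unitmx].
Proof.
move=> oU CZ; rewrite openE => y [Uy Zy].
apply: filterS2 (open_near oU Uy) (_ : \forall x \near y, \det (Z x) != 0) => [x Ux dx|].
  by split=> //; rewrite unitmxE unitfE.
have cd := Ck_on_continuous (Ck_on_det oU CZ) Uy.
apply: (cd [set s | s != 0]); apply: open_nbhs_nbhs; split; first exact: open_neq.
by rewrite /= -unitfE -unitmxE.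
Qed.

Section Composition.
Context {R : realType} {m n : nat}.

Lemma Ck_on_comp k (W : set 'rV[R]_n) (U : set 'rV[R]_m) (f : 'rV[R]_n -> R)
    (g : 'rV[R]_m -> 'rV[R]_n) : open U -> open W ->
  (forall x, U x -> W (g x)) -> Ck_on k W f -> Cmx k U g ->
  Ck_on k U (f \o g).
Proof.
move=> oU oW UW; elim: k f => [|k ih] f Cf Cg.
  split=> // x Ux; apply: continuous_comp; first exact: Cmx_continuous Cg Ux.
  by apply: (Ck_on_continuous Cf); exact: UW.
have C1f : Ck_on 1 W f by exact: Ck_on_le Cf.
have fgd x i : U x -> is_derive x (delta_mx 0 i) (f \o g)
    (\sum_l partial i (fun y => g y 0 l) x * partial l f (g x)).
  move=> Ux; have Cg1 : Cmx 1 U g by exact: Cmx_le Cg.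
  have := is_derive_comp_partial (is_derive_jacobian (delta_mx 0 i) oU Cg1 Ux)
    (C1_differentiable oW C1f (UW _ Ux)).
  rewrite (_ : \sum_l _ =
    \sum_l partial i (fun y => g y 0 l) x * partial l f (g x)) //.
  apply: eq_bigr => l _; rewrite -rowE mxE jacobianE //.
  exact: C1_differentiable_rV Cg1 Ux.
split=> [x Ux|i].
  apply: continuous_comp; first exact: Cmx_continuous Cg Ux.
  by apply: (Ck_on_continuous Cf); exact: UW.
split=> [x /(fgd _ i) []//|].
apply: (@Ck_on_ext _ _ _ _
  (fun x => \sum_l partial i (fun y => g y 0 l) x * partial l f (g x))) => //.
  by move=> x /(fgd _ i) [].
apply: Ck_on_sum => // l; apply: Ck_onM => //; first exact: ((Cg 0 l).2 i).2.
apply: ih; first exact: (Cf.2 l).2.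
exact: Cmx_le Cg.
Qed.

Lemma Cmx_comp p q k (W : set 'rV[R]_n) (U : set 'rV[R]_m)
    (f : 'rV[R]_n -> 'M[R]_(p, q)) (g : 'rV[R]_m -> 'rV[R]_n) :
  open U -> open W -> (forall x, U x -> W (g x)) -> Cmx k W f -> Cmx k U g ->
  Cmx k U (f \o g).
Proof.
by move=> oU oW UW Cf Cg i j; exact: (Ck_on_comp oU oW UW (Cf i j) Cg).
Qed.

Lemma jacobian_comp p (W : set 'rV[R]_n) (U : set 'rV[R]_m)
    (f : 'rV[R]_n -> 'rV[R]_p) (g : 'rV[R]_m -> 'rV[R]_n) x :
  open U -> open W -> U x -> W (g x) -> Cmx 1 W f -> Cmx 1 U g ->
  jacobian (f \o g) x = jacobian g x *m jacobian f (g x).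
Proof.
move=> oU oW Ux Wx Cf Cg.
have dg := C1_differentiable_rV oU Cg Ux.
have df := C1_differentiable_rV oW Cf Wx.
have dfg : differentiable (f \o g) x by exact: differentiable_comp.
apply/row_matrixP => i; rewrite !rowE mulmxA.
rewrite -(deriveEjacobian _ dfg).
by have [] := is_derive_comp_jacobian oW Cf Wx (is_derive_jacobian (delta_mx 0 i) oU Cg Ux).
Qed.

Lemma jacobian_near (f g : 'rV[R]_m -> 'rV[R]_n) x :
  (\forall y \near x, f y = g y) -> differentiable f x ->
  differentiable g x -> jacobian f x = jacobian g x.
Proof.
move=> fg df dg; apply/matrixP => i j.
apply: (etrans (jacobianE i j df) (etrans _ (esym (jacobianE i j dg)))).
by apply: near_eq_derive; apply: filterS fg => y ->.
Qed.

End Composition.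

(** * Ordinary differential equations *)

Section ODE.
Context {R : realType}.

Lemma antiderivative (f : R -> R) : continuous f ->
  exists F : R -> R, [/\ continuous F, F 0 = 0 &
    forall t : R, 0 < t -> is_derive t 1 F (f t)].
Proof.
move=> cf.
pose mu := @lebesgue_measure R.
(* The integral starts at -1 so that 0 is an interior point, where [G] is known to be
   differentiable. Freezing the argument at 0 for negative [t] then makes [F] continuous on the
   whole line. *)
pose G (x : R) : R := (\int[mu]_(t in `[(-1)%R, x]) f t)%R.
have Gd (x : R) : -1 < x -> is_derive x 1 G (f x).
  move=> x1.
  have [||] := @continuous_FTC1_closed R f (-1) x (x + 1) _ _ x1 (cf x).
  - by rewrite ltrDl.
  - apply: continuous_compact_integrable; first exact: segment_compact.
    exact: continuous_subspaceT.
  move=> d1 d2; apply: DeriveDef; first exact: d1.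
  by rewrite -derive1E; exact: d2.
pose F (t : R) := G (Num.max t 0) - G 0.
have cF (t : R) : {for t, continuous F}.
  rewrite /F; apply: continuousB; last exact: cst_continuous.
  apply: (@continuous_comp _ _ _ (fun t : R => Num.max t 0) G).
    by apply: continuous_max; [exact: cvg_id|exact: cst_continuous].
  apply: is_derive_cvg (Gd _ _).
  by rewrite lt_max (ltrN10 R) orbT.
exists F; split=> //; first by rewrite /F maxxx subrr.
move=> t t0.
apply: (@near_eq_is_derive _ _ _ (fun s => G s - G 0)).
  have : \forall s \near t, s \in `]0, (t + 1)[.
    by apply: near_in_itvoo; rewrite in_itv /= t0 ltrDl ltr01.
  by apply: filterS => s; rewrite in_itv /= => /andP[s0 _]; rewrite /F max_l // ltW.
rewrite -[f t]subr0; apply: is_deriveB; apply: Gd.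
by apply: lt_trans t0; rewrite ltrN10.
Qed.

Lemma antiderivative_rV N (f : R -> 'rV[R]_N) : continuous f ->
  exists F : R -> 'rV[R]_N, [/\ continuous F, F 0 = 0 &
    forall t : R, 0 < t -> is_derive t 1 F (f t)].
Proof.
move=> cf.
have H j : exists F : R -> R, [/\ continuous F, F 0 = 0 &
    forall t : R, 0 < t -> is_derive t 1 F (f t 0 j)].
  apply: antiderivative => t.
  by have := cf t; move/continuous_mxP; apply.
pose F t := \row_j (sval (cid (H j)) t).
exists F; split.
- move=> t; apply/continuous_mxP => i j.
  have [/(_ t) c _ _] := svalP (cid (H j)).
  by rewrite (_ : (fun y => F y i j) = sval (cid (H j))) //; apply/funext => y; rewrite mxE.
- by apply/rowP => j; rewrite !mxE; have [_ + _] := svalP (cid (H j)).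
- move=> t t0; apply/is_derive_mxP => i j; rewrite (ord1 i).
  have [_ _ /(_ t t0)] := svalP (cid (H j)).
  by congr is_derive; apply/funext => y; rewrite mxE.
Qed.

(** The derivative is required on the open interval only, which avoids one-sided derivatives at the
    end points; continuity on the whole line ties the end values to it. Values outside [[0, 1]] are
    irrelevant. *)
Definition solves N (g : R -> 'rV[R]_N -> 'rV[R]_N) x0 (x : R -> 'rV[R]_N) :=
  [/\ continuous x, x 0 = x0 &
      forall t : R, 0 < t < 1 -> is_derive t 1 x (g t (x t))].

Lemma is_derive_expM (a t : R) :
  is_derive t 1 (fun s => expR (a * s)) (a * expR (a * t)).
Proof.
have h : is_derive t 1 (fun s : R => a * s) a.
  have := is_deriveZ (f := (id : R -> R)) (x := t) (v := 1) a.
  by move=> /(_ _ (is_derive_id _ _)); rewrite [_ *: 1]mulr1.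
have := is_derive1_comp (is_derive_expR (a * t)) h.
by rewrite mulrC.
Qed.

(** The norm is not differentiated. At the maximum [m] of [u] weighted by [expR (- (2 * L) * t)],
    integrating the bound on [du] returns only half of [m], which is absorbed on the left. *)
Lemma gronwall p q (u du : R -> 'M[R]_(p, q)) (L e : R) : 0 < L -> 0 <= e ->
  continuous u -> (forall t : R, 0 < t < 1 -> is_derive t 1 u (du t)) ->
  (forall t : R, 0 < t < 1 -> `|du t| <= L * `|u t| + e) ->
  forall t, 0 <= t <= 1 -> `|u t| <= 2 * (`|u 0| + e) * expR (2 * L).
Proof.
move=> L0 e0 cu ud ub.
pose w t := `|u t| * expR (- (2 * L) * t).
have cexp a : continuous (fun t : R => expR (a * t)).
  by move=> t; exact: is_derive_cvg (is_derive_expM a t).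
have cw (t : R) : {for t, continuous w}.
  apply: continuousM; last exact: cexp.
  by apply: continuous_comp; [exact: cu|exact: norm_continuous].
have [|t0 t0i wmax] := @EVT_max R w 0 1 ler01; first exact: continuous_subspaceT.
have [t00 t01] : 0 <= t0 /\ t0 <= 1 by move: t0i; rewrite in_itv /= => /andP[].
have Eg a : 0 < expR a by exact: expR_gt0.
set m := w t0.
have m0 : 0 <= m by rewrite mulr_ge0 // ltW.
have wE t : `|u t| = w t * expR (2 * L * t).
  by rewrite /w -mulrA -expRD mulNr addNr expR0 mulr1.
have ule t : 0 <= t <= 1 -> `|u t| <= m * expR (2 * L * t).
  by move=> ti; rewrite wE ler_wpM2r ?(ltW (Eg _)) //; apply: wmax; rewrite in_itv.
have key : `|u t0 - u 0| <= (m / 2 * expR (2 * L * t0) + e * t0) - m / 2.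
  have bd (s : R) : is_derive s 1 (fun s : R => m / 2 * expR (2 * L * s) + e * s)
      (L * (m * expR (2 * L * s)) + e).
    have -> : L * (m * expR (2 * L * s)) + e =
      m / 2 *: (2 * L * expR (2 * L * s)) + e *: 1.
      by rewrite [_ *: 1]mulr1 [_ *: _]mulrA; congr (_ + _); field.
    by apply: is_deriveD; apply: is_deriveZ; exact: is_derive_expM.
  have b00 : (m / 2 * expR (2 * L * t0) + e * t0) - (m / 2 * expR (2 * L * 0) + e * 0) =
     (m / 2 * expR (2 * L * t0) + e * t0) - m / 2.
    by rewrite !mulr0 expR0 mulr1 addr0.
  have comp i j : `|u t0 i j - u 0 i j| <=
     (m / 2 * expR (2 * L * t0) + e * t0) - m / 2.
    rewrite -b00.
    apply: (@mvt_bound R (fun s => u s i j) (fun s => du s i j)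
      (fun s => m / 2 * expR (2 * L * s) + e * s)
      (fun s => L * (m * expR (2 * L * s)) + e)) => //.
    - move=> s /andP[s0 s1]; apply: (proj1 (is_derive_mxP _ _ _ _)); apply: ud.
      by rewrite s0 (lt_le_trans s1).
    - move=> s /andP[s0 s1]; have s01 : 0 < s < 1 by rewrite s0 (lt_le_trans s1).
      apply: le_trans (ler_mxE _ _ _) _; apply: le_trans (ub _ s01) _.
      rewrite lerD2r ler_wpM2l ?(ltW L0) //; apply: ule.
      by move/andP: s01 => [/ltW -> /ltW ->].
    - apply: continuous_subspaceT => s.
      by have := cu s; move/continuous_mxP; apply.
    - by apply: continuous_subspaceT => s; exact: is_derive_cvg (bd s).
  apply: mx_norm_le => [|i j]; last by rewrite !mxE.
  have : 1 <= expR (2 * L * t0) by rewrite -expR0 ler_expR !mulr_ge0 // ltW.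
  rewrite addrAC -[X in _ - X]mulr1 -mulrBr => E1.
  by rewrite addr_ge0 // mulr_ge0 // ?subr_ge0 // divr_ge0.
have mle : m <= 2 * (`|u 0| + e).
  have E1 : 1 <= expR (2 * L * t0) by rewrite -expR0 ler_expR !mulr_ge0 // ltW.
  have : `|u t0| <= `|u 0| + ((m / 2 * expR (2 * L * t0) + e * t0) - m / 2).
    by rewrite -{1}(subrK (u 0) (u t0)) addrC; apply: le_trans (ler_normD _ _) _; rewrite lerD2l.
  rewrite [in leLHS]wE -/m.
  have et : e * t0 <= e by rewrite ler_piMr.
  have : m * 1 <= m * expR (2 * L * t0) by rewrite ler_wpM2l.
  nra.
move=> t ti; apply: le_trans (ule _ ti) _.
apply: ler_pM; [exact: m0|exact: expR_ge0|exact: mle|].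
rewrite ler_expR ler_piMr // ?mulr_ge0 // ?(ltW L0) //.
by case/andP: ti.
Qed.

(** The Lipschitz bound is required along the two curves only and the fields may differ, so that a
    solution of a field defined on a ball can be compared with one of its clamped extension. *)
Lemma solves_unique N (g h : R -> 'rV[R]_N -> 'rV[R]_N) x0 x y (L : R) :
  solves g x0 x -> solves h x0 y ->
  (forall t : R, 0 < t < 1 -> `|g t (x t) - h t (y t)| <= L * `|x t - y t|) ->
  forall t, 0 <= t <= 1 -> x t = y t.
Proof.
move=> [cx x0E dx] [cy y0E dy] H t ti.
have L0 : 0 < Num.max L 1 by rewrite lt_max ltr01 orbT.
have := @gronwall 1 N (fun s => x s - y s) (fun s => g s (x s) - h s (y s))
  (Num.max L 1) 0 L0 (lexx _) _ _ _ t ti.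
rewrite x0E y0E subrr normr0 addr0 mulr0 mul0r => H1.
apply/eqP; rewrite -subr_eq0 -normr_le0; apply: H1.
- by move=> s; apply: continuousB; [exact: cx|exact: cy].
- by move=> s si; apply: is_deriveB; [exact: dx|exact: dy].
- move=> s si; rewrite addr0; apply: le_trans (H _ si) _.
  by rewrite ler_wpM2r // le_max lexx.
Qed.

Lemma exp2_small (K e : R) : 0 <= K -> 0 < e ->
  exists n0, forall n, (n0 <= n)%N -> K / 2 ^+ n < e.
Proof.
move=> K0 e0; exists (Num.bound (K / e)) => n n0n.
have h : K / e < n%:R.
  apply: lt_le_trans (archi_boundP _) _; first by rewrite divr_ge0 // ltW.
  by rewrite ler_nat.
rewrite ltr_pdivrMr ?exprn_gt0 //.
rewrite ltr_pdivrMr // in h; apply: lt_trans h _.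
rewrite mulrC ltr_pM2l // -natrX ltr_nat; exact: ltn_expl.
Qed.

Lemma cauchy_limit N (y : nat -> 'rV[R]_N) (K : R) : 0 <= K ->
  (forall n m, (n <= m)%N -> `|y m - y n| <= K / 2 ^+ n) ->
  exists l, forall n, `|l - y n| <= K / 2 ^+ n.
Proof.
move=> K0 yK.
have cy : cvg (y @ \oo).
  apply/cauchy_cvgP/cauchyP => e e0.
  have [n0 n0P] := exp2_small K0 e0.
  exists (y n0); exists n0 => // m /= n0m.
  rewrite -ball_normE /= distrC; apply: le_lt_trans (n0P n0 (leqnn _)).
  exact: yK.
exists (lim (y @ \oo)) => n.
have c2 : `|y m - y n| @[m --> \oo] --> `|lim (y @ \oo) - y n|.
  by apply: cvg_norm; apply: cvgB => //; exact: cvg_cst.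
rewrite -(cvg_lim (@norm_hausdorff _ _) c2).
apply: limr_le; first by apply/cvg_ex; exists (`|lim (y @ \oo) - y n|).
by near=> m; apply: yK; near: m; exact: nbhs_infty_ge.
Unshelve. all: by end_near. Qed.

(** Precomposition with this retraction extends a curve on [[0, 1]] continuously to the line, on
    which the lemmas about differential equations ask for continuity. *)
Definition clamp01 (t : R) : R := Num.max 0 (Num.min t 1).

Lemma clamp01_itv t : 0 <= clamp01 t <= 1.
Proof. by rewrite /clamp01 le_max lexx /= ge_max ler01 /= ge_min lexx orbT. Qed.

Lemma clamp01_id t : 0 <= t <= 1 -> clamp01 t = t.
Proof. by move=> /andP[t0 t1]; rewrite /clamp01 (min_idPl t1) (max_idPr t0). Qed.

Lemma continuous_clamp01 : continuous clamp01.
Proof.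
move=> t; suff : {for t, continuous clamp01} by [].
rewrite /clamp01; apply: continuous_max; first exact: cst_continuous.
by apply: continuous_min; [exact: cvg_id|exact: cst_continuous].
Qed.

Lemma near_itv01 (t : R) : 0 < t < 1 -> \forall s \near t, 0 < s < 1.
Proof.
move=> ti; have : \forall s \near t, s \in `]0, 1[.
  by apply: near_in_itvoo; rewrite in_itv.
by apply: filterS => s; rewrite in_itv.
Qed.

(** The weight [expR (2 * L * t)] makes the Picard map contract by the factor 1/2 on the whole of
    [[0, 1]], whatever the size of [L]. Continuity of [g] is only needed along continuous curves. *)
Lemma picard N (g : R -> 'rV[R]_N -> 'rV[R]_N) (L : R) x0 :
  (forall x : R -> 'rV[R]_N, continuous x -> continuous (fun t => g t (x t))) ->
  (forall t x y, `|g t x - g t y| <= L * `|x - y|) ->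
  exists x, solves g x0 x.
Proof.
move=> cg gL.
wlog L0 : L gL / 0 < L.
  move=> wl; apply: (wl (Num.max L 1)); last by rewrite lt_max ltr01 orbT.
  move=> t x y; apply: le_trans (gL t x y) _.
  by rewrite ler_wpM2r // le_max lexx.
have HI (x : R -> 'rV[R]_N) : continuous x -> exists z : R -> 'rV[R]_N,
   [/\ continuous z, z 0 = x0 & forall t : R, 0 < t -> is_derive t 1 z (g t (x t))].
  move=> cx; have [F [cF F0 dF]] := antiderivative_rV (cg x cx).
  exists (fun t => F t + x0); split.
  - by move=> t; apply: continuousD; [exact: cF|exact: cst_continuous].
  - by rewrite F0 add0r.
  - move=> t t0; rewrite -[g t (x t)]addr0.
    by apply: is_deriveD; exact: dF.
pose T := {x : R -> 'rV[R]_N | continuous x}.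
have /choice [I IP] : forall x : T, exists z : T,
    [/\ continuous (sval z), sval z 0 = x0 &
      forall t : R, 0 < t -> is_derive t 1 (sval z) (g t (sval x t))].
  move=> [x cx]; have [z [cz z0 dz]] := HI x cx.
  by exists (exist _ z cz).
have c0 : continuous (fun _ : R => x0) by exact: cst_continuous.
pose x_ n : T := iter n I (exist _ (fun=> x0) c0).
pose X n := sval (x_ n).
have cX n : continuous (X n) := svalP (x_ n).
have X0 n : X n 0 = x0 by case: n => [//|n]; have [] := IP (x_ n).
have dX n (t : R) : 0 < t -> is_derive t 1 (X n.+1) (g t (X n t)).
  by have [_ _] := IP (x_ n); exact.
have [C C_ge0 C0P] : exists2 C : R, 0 <= C &
    forall t, 0 <= t <= 1 -> `|X 1%N t - X 0%N t| <= C.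
  have cw (t : R) : {for t, continuous (fun t => `|X 1%N t - X 0%N t|)}.
    apply: (@continuous_comp _ _ _ (fun t => X 1%N t - X 0%N t)); last exact: norm_continuous.
    by apply: continuousB; exact: cX.
  have [t0 t0i wmax] := @EVT_max R _ 0 1 ler01 (continuous_subspaceT cw).
  by exists (`|X 1%N t0 - X 0%N t0|).
have Eg (a : R) : 0 < expR a by exact: expR_gt0.
have dist n : forall t, 0 <= t <= 1 ->
    `|X n.+1 t - X n t| <= C / 2 ^+ n * expR (2 * L * t).
  elim: n => [|n ih] t ti.
    rewrite expr0 divr1; apply: le_trans (C0P _ ti) _.
    rewrite ler_peMr // -expR0 ler_expR !mulr_ge0 // ?(ltW L0) //.
    by case/andP: ti.
  have [t0 t1] : 0 <= t /\ t <= 1 by apply/andP.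
  pose b (s : R) := C / 2 ^+ n.+1 * expR (2 * L * s).
  have bd (s : R) : is_derive s 1 b (L * (C / 2 ^+ n * expR (2 * L * s))).
    have -> : L * (C / 2 ^+ n * expR (2 * L * s)) =
      C / 2 ^+ n.+1 *: (2 * L * expR (2 * L * s)).
      rewrite [_ *: _]mulrA exprS.
      have : (2 : R) ^+ n != 0 by rewrite expf_neq0.
      by move=> h; field.
    by apply: is_deriveZ; exact: is_derive_expM.
  have comp j : `|X n.+2 t 0 j - X n.+1 t 0 j| <= b t - b 0.
    have := @mvt_bound R (fun s => X n.+2 s 0 j - X n.+1 s 0 j)
      (fun s => g s (X n.+1 s) 0 j - g s (X n s) 0 j) b
      (fun s => L * (C / 2 ^+ n * expR (2 * L * s))) t t0.
    rewrite !X0 subrr subr0; apply => //.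
    - move=> s /andP[s0 s1]; apply: is_deriveB;
        by apply: (proj1 (is_derive_mxP _ _ _ _)); apply: dX.
    - move=> s /andP[s0 s1].
      have si : 0 <= s <= 1 by rewrite (ltW s0) (le_trans (ltW s1)).
      have := ler_mxE (g s (X n.+1 s) - g s (X n s)) 0 j; rewrite !mxE => h.
      apply: le_trans h _; apply: le_trans (gL _ _ _) _.
      by rewrite ler_wpM2l ?(ltW L0) //; exact: ih.
    - apply: continuous_subspaceT => s; apply: continuousB.
        by have := cX n.+2 s; move/continuous_mxP; apply.
      by have := cX n.+1 s; move/continuous_mxP; apply.
    - by apply: continuous_subspaceT => s; exact: is_derive_cvg (bd s).
  have b0 : 0 <= b 0 by rewrite !mulr_ge0 ?invr_ge0 ?exprn_ge0 // ltW.
  apply: le_trans (_ : _ <= b t - b 0) _; last by rewrite gerBl.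
  apply: mx_norm_le => [|i j]; last by rewrite (ord1 i) !mxE.
  rewrite subr_ge0 ler_wpM2l ?divr_ge0 ?exprn_ge0 //.
  by rewrite ler_expR mulr0 !mulr_ge0 // ltW.
pose K := 2 * C * expR (2 * L).
have K0 : 0 <= K by rewrite !mulr_ge0 // ltW.
have distK n t : 0 <= t <= 1 -> `|X n.+1 t - X n t| <= K / 2 ^+ n / 2.
  move=> ti; apply: le_trans (dist n t ti) _.
  have -> : K / 2 ^+ n / 2 = C / 2 ^+ n * expR (2 * L).
    have : (2 : R) ^+ n != 0 by rewrite expf_neq0.
    by rewrite /K => h; field.
  rewrite ler_wpM2l ?divr_ge0 ?exprn_ge0 // ler_expR.
  by case/andP: ti => t0 t1; rewrite ler_piMr // mulr_ge0 // ltW.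
have cau t n m : (n <= m)%N ->
    `|X m (clamp01 t) - X n (clamp01 t)| <= K / 2 ^+ n.
  move=> nm; apply: le_trans (_ : _ <= K / 2 ^+ n - K / 2 ^+ m) _; last first.
    by rewrite gerBl divr_ge0 // exprn_ge0.
  rewrite -(subnK nm); elim: (m - n)%N => [|d ih]; first by rewrite !subrr normr0.
  rewrite addSn -(subrKA (X (d + n)%N (clamp01 t))).
  apply: le_trans (ler_normD _ _) _.
  have := distK (d + n)%N _ (clamp01_itv t); move: ih.
  have -> : K / 2 ^+ (d + n).+1 = K / 2 ^+ (d + n) / 2.
    by rewrite exprS invfM mulrA mulrAC.
  lra.
have /choice [y yP] : forall t, exists l, forall n, `|l - X n (clamp01 t)| <= K / 2 ^+ n.
  by move=> t; apply: cauchy_limit => // n m nm; exact: cau.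
have cy : continuous y.
  move=> t; apply/cvgrPdist_lt => e e0.
  have [n nP] := exp2_small K0 (divr_gt0 e0 (ltr0n R 3)).
  have {}nP := nP n (leqnn _).
  have : {for t, continuous (X n \o clamp01)}.
    by apply: continuous_comp; [exact: continuous_clamp01|exact: cX].
  move=> /cvgrPdist_lt /(_ _ (divr_gt0 e0 (ltr0n R 3))); apply: filterS => s /= hs.
  have h1 := yP t n; have h2 := yP s n.
  have -> : y t - y s = (y t - X n (clamp01 t)) +
     (X n (clamp01 t) - X n (clamp01 s)) - (y s - X n (clamp01 s)).
    by apply/rowP => j; rewrite !mxE; ring.
  apply: le_lt_trans (ler_normB _ _) _.
  have := ler_normD (y t - X n (clamp01 t)) (X n (clamp01 t) - X n (clamp01 s)).
  lra.
(* The limit [y] is only known to be continuous. One more Picard step [z] is differentiable, and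
   both are uniform limits of [X] on [[0, 1]], so they agree there. *)
have [z [cz z0 dz]] := HI y cy.
have zX n t : 0 <= t <= 1 -> `|z t - X n.+1 t| <= L * K / 2 ^+ n.
  move=> ti; have [t0 t1] : 0 <= t /\ t <= 1 by apply/andP.
  have LK : 0 <= L * K / 2 ^+ n by rewrite !mulr_ge0 ?invr_ge0 ?exprn_ge0 // ltW.
  apply: mx_norm_le => // i j; rewrite (ord1 i).
  have := @mvt_bound R (fun s => z s 0 j - X n.+1 s 0 j)
      (fun s => g s (y s) 0 j - g s (X n s) 0 j) (fun s => L * K / 2 ^+ n * s)
      (fun s => L * K / 2 ^+ n) t t0.
  rewrite z0 X0 subrr subr0 mulr0 subr0 !mxE => H; apply: le_trans (H _ _ _ _ _) _.
  - move=> s /andP[s0 s1]; apply: is_deriveB; apply: (proj1 (is_derive_mxP _ _ _ _)).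
      exact: dz.
    exact: dX.
  - move=> s _; have := is_deriveZ (f := (id : R -> R)) (x := s) (v := 1) (L * K / 2 ^+ n).
    by move=> /(_ _ (is_derive_id _ _)); rewrite [_ *: 1]mulr1.
  - move=> s /andP[s0 s1].
    have si : 0 <= s <= 1 by rewrite (ltW s0) (le_trans (ltW s1)).
    have := ler_mxE (g s (y s) - g s (X n s)) 0 j; rewrite !mxE => h.
    apply: le_trans h _; apply: le_trans (gL _ _ _) _.
    rewrite -mulrA ler_wpM2l ?(ltW L0) //.
    by have := yP s n; rewrite clamp01_id.
  - apply: continuous_subspaceT => s; apply: continuousB.
      by have := cz s; move/continuous_mxP; apply.
    by have := cX n.+1 s; move/continuous_mxP; apply.
  - by apply: continuous_subspaceT => s; exact: mulrl_continuous.
  - by rewrite ler_piMr.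
have zy t : 0 <= t <= 1 -> z t = y t.
  move=> ti; apply/eqP; rewrite -subr_eq0 -normr_le0 leNgt; apply/negP => e0.
  have LK0 : 0 <= L * K + K by rewrite addr_ge0 // mulr_ge0 // ltW.
  have [n nP] := exp2_small LK0 e0; have := nP n (leqnn _).
  apply/negP; rewrite -leNgt mulrDl.
  have h1 := zX n t ti; have h2 := yP t n.+1; rewrite clamp01_id // in h2.
  rewrite -(subrKA (X n.+1 t)); apply: le_trans (ler_normD _ _) _.
  rewrite [`|X n.+1 t - y t|]distrC lerD //; apply: le_trans h2 _.
  rewrite exprS invfM mulrCA ler_piMl //; first by rewrite divr_ge0 // exprn_ge0.
  by rewrite invf_le1 // ler1n.
exists z; split=> // t ti.
have ti' : 0 <= t <= 1 by case/andP: ti => /ltW -> /ltW ->.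
by rewrite zy //; apply: dz; case/andP: ti.
Qed.

End ODE.

Section Blocks.
Context {R : realType} {n : nat}.
Variables (k : nat) (U : set 'rV[R]_n) (oU : open U).

Lemma Cmx_row p q r (Y : 'rV[R]_n -> 'M[R]_(p, q)) (Z : 'rV[R]_n -> 'M[R]_(p, r)) :
  Cmx k U Y -> Cmx k U Z -> Cmx k U (fun x => row_mx (Y x) (Z x)).
Proof.
move=> CY CZ i j; rewrite -(splitK j); case: (fintype.split j) => l /=.
  by under eq_fun do rewrite row_mxEl.
by under eq_fun do rewrite row_mxEr.
Qed.

Lemma Cmx_lsub p q r (Y : 'rV[R]_n -> 'M[R]_(p, q + r)) :
  Cmx k U Y -> Cmx k U (fun x => lsubmx (Y x)).
Proof. by move=> CY i j; under eq_fun do rewrite mxE. Qed.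

Lemma Cmx_rsub p q r (Y : 'rV[R]_n -> 'M[R]_(p, q + r)) :
  Cmx k U Y -> Cmx k U (fun x => rsubmx (Y x)).
Proof. by move=> CY i j; under eq_fun do rewrite mxE. Qed.

End Blocks.

Lemma norm_row_mx (R : realType) q r (x : 'rV[R]_q) (y : 'rV[R]_r) c :
  0 <= c -> `|x| <= c -> `|y| <= c -> `|row_mx x y| <= c.
Proof.
move=> c0 xc yc; apply: mx_norm_le => // i j; rewrite -(splitK j).
case: (fintype.split j) => l /=; rewrite ?row_mxEl ?row_mxEr.
  by apply: le_trans xc; exact: ler_mxE.
by apply: le_trans yc; exact: ler_mxE.
Qed.

Lemma norm_lsubmx (R : realType) p q r (z : 'M[R]_(p, q + r)) : `|lsubmx z| <= `|z|.
Proof. by apply: mx_norm_le => // i j; rewrite mxE; exact: ler_mxE. Qed.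

Lemma norm_rsubmx (R : realType) p q r (z : 'M[R]_(p, q + r)) : `|rsubmx z| <= `|z|.
Proof. by apply: mx_norm_le => // i j; rewrite mxE; exact: ler_mxE. Qed.

Section DeriveMx.
Context {R : realType}.

Lemma is_derive_mulmx (V : normedModType R) p q r (f : V -> 'M[R]_(p, q))
    (g : V -> 'M[R]_(q, r)) x v df dg :
  is_derive x v f df -> is_derive x v g dg ->
  is_derive x v (fun y => f y *m g y) (df *m g x + f x *m dg).
Proof.
move=> /is_derive_mxP hf /is_derive_mxP hg; apply/is_derive_mxP => i j.
rewrite (_ : (fun y => _) = \sum_(k < q) (fun y => f y i k * g y k j)); last first.
  by apply/funext => y; rewrite fct_sumE mxE.
rewrite 3!mxE -big_split /=; apply: is_derive_sum => k.
have := is_deriveM (hf i k) (hg k j).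
by rewrite addrC; congr (is_derive _ _ _ (_ + _)); rewrite mulrC.
Qed.

Lemma is_derive_mulmxr p q r (A : 'M[R]_(q, r)) (x v : 'M[R]_(p, q)) :
  is_derive x v (fun z => z *m A) (v *m A).
Proof.
have := is_derive_mulmx (is_derive_id x v) (is_derive_cst A x v).
by rewrite mulmx0 addr0.
Qed.

Lemma jacobian_eq m n (g : 'rV[R]_n -> 'rV[R]_m) x A : differentiable g x ->
  (forall v, is_derive x v g (v *m A)) -> jacobian g x = A.
Proof.
move=> dg h; apply/row_matrixP => i.
have : (delta_mx 0 i : 'rV[R]_n) *m jacobian g x = delta_mx 0 i *m A.
  by rewrite -deriveEjacobian //; have [] := h (delta_mx 0 i).
by rewrite -!rowE.
Qed.

End DeriveMx.

Section Segments.
Context {R : realType} {n : nat}.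
Implicit Types (U K : set 'rV[R]_n).

Definition convexs K := forall x y (s : R), K x -> K y -> 0 <= s <= 1 ->
  K (x + s *: (y - x)).

Lemma seg_bound m U (F : 'rV[R]_n -> 'rV[R]_m) x y B : open U -> Cmx 1 U F ->
  (forall s : R, 0 <= s <= 1 -> U (x + s *: (y - x))) ->
  (forall s : R, 0 <= s <= 1 -> `|jacobian F (x + s *: (y - x))| <= B) ->
  `|F y - F x| <= n%:R * B * `|y - x|.
Proof.
move=> oU CF Us JB.
have B0 : 0 <= B by apply: le_trans (normr_ge0 _) (JB 0 _); rewrite lexx ler01.
apply: mx_norm_le => [|i j]; first by rewrite !mulr_ge0.
rewrite (ord1 i) !mxE.
pose f (s : R) := F (x + s *: (y - x)) 0 j.
pose df (s : R) := ((y - x) *m jacobian F (x + s *: (y - x))) 0 j.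
have fd (s : R) : 0 <= s <= 1 -> is_derive s 1 f (df s).
  move=> si; apply: (proj1 (is_derive_mxP _ _ _ _)).
  by apply/is_derive_line; exact: is_derive_jacobian oU CF (Us s si).
have := @mvt_bound R f df (fun s => n%:R * B * `|y - x| * s)
   (fun=> n%:R * B * `|y - x|) 1 ler01.
rewrite /f scale1r scale0r addr0 mulr1 mulr0 subr0 (addrC x) subrK; apply.
- by move=> s /andP[s0 s1]; apply: fd; rewrite !ltW.
- move=> s _; have := is_deriveZ (f := (id : R -> R)) (x := s) (v := 1) (n%:R * B * `|y - x|).
  by move=> /(_ _ (is_derive_id _ _)); rewrite [_ *: 1]mulr1.
- move=> s /andP[s0 s1]; apply: le_trans (ler_mxE _ _ _) _.
  apply: le_trans (norm_mulmx _ _) _.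
  rewrite -!mulrA ler_wpM2l // mulrC ler_wpM2r // JB //.
  by rewrite !ltW.
- apply: within_derive => s /= si; apply: fd; move: si; by rewrite in_itv.
- by apply: continuous_subspaceT => s; exact: mulrl_continuous.
Qed.

Lemma compact_bound p q U K (Z : 'rV[R]_n -> 'M[R]_(p, q)) : open U ->
  closed K -> bounded_set K -> K `<=` U -> Cmx 0 U Z ->
  exists2 B, 0 <= B & forall x, K x -> `|Z x| <= B.
Proof.
move=> oU cK bK KU CZ.
have [[x0 Kx0]|nK] := pselect (K !=set0); last first.
  by exists 0 => // x Kx; exfalso; apply: nK; exists x.
have [|||c cK' cmax] := @EVT_max_rV R n (fun x => `|Z x|) K.
- by exists x0.
- exact: bounded_closed_compact.
- apply: continuous_in_subspaceT => x /[1!inE] Kx.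
  apply: (@continuous_comp _ _ _ Z); last exact: norm_continuous.
  exact: Cmx_continuous CZ (KU _ Kx).
by exists `|Z c| => // x Kx; apply: cmax; rewrite inE.
Qed.

Lemma C1_lipschitz m U K (F : 'rV[R]_n -> 'rV[R]_m) : open U -> Cmx 1 U F ->
  closed K -> bounded_set K -> convexs K -> K `<=` U ->
  exists2 L, 0 <= L & forall x y, K x -> K y -> `|F y - F x| <= L * `|y - x|.
Proof.
move=> oU CF cK bK vK KU.
have [B B0 JB] := compact_bound oU cK bK KU (Cmx_jacobian oU CF).
exists (n%:R * B) => [|x y Kx Ky]; first by rewrite mulr_ge0.
apply: seg_bound oU CF _ _ => s si; first by apply: KU; exact: vK.
by apply: JB; exact: vK.
Qed.

End Segments.

Section C2.
Context {R : realType} {n m : nat}.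
Implicit Types (U K : set 'rV[R]_n).

Lemma C2_taylor U K (F : 'rV[R]_n -> 'rV[R]_m) : open U -> Cmx 2 U F ->
  closed K -> bounded_set K -> convexs K -> K `<=` U ->
  exists2 C, 0 <= C & forall x y, K x -> K y ->
    `|F y - F x - (y - x) *m jacobian F x| <= C * `|y - x| ^+ 2.
Proof.
move=> oU CF cK bK vK KU.
have CJ : Cmx 1 U (jacobian F) by exact: Cmx_jacobian.
have [L L0 LJ] : exists2 L, 0 <= L & forall x y, K x -> K y ->
    `|jacobian F y - jacobian F x| <= L * `|y - x|.
  have h i : exists2 L, 0 <= L & forall x y, K x -> K y ->
     `|row i (jacobian F y) - row i (jacobian F x)| <= L * `|y - x|.
    apply: (C1_lipschitz oU _ cK bK vK KU (F := fun x => row i (jacobian F x))).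
    by move=> a b; under eq_fun do rewrite mxE.
  have /choice [L LP] : forall i : 'I_n, exists L, 0 <= L /\ forall x y, K x -> K y ->
     `|row i (jacobian F y) - row i (jacobian F x)| <= L * `|y - x|.
    by move=> i; have [L L0 hL] := h i; exists L.
  exists (\sum_i L i); first by apply: sumr_ge0 => i _; exact: (LP i).1.
  move=> x y Kx Ky; apply: mx_norm_le => [|i j].
    by rewrite mulr_ge0 // sumr_ge0 // => i _; exact: (LP i).1.
  have := (LP i).2 x y Kx Ky; have := ler_mxE (row i (jacobian F y) - row i (jacobian F x)) 0 j.
  rewrite !mxE => h1 h2; apply: le_trans h1 _; apply: le_trans h2 _.
  rewrite ler_wpM2r // (bigD1 i) //= lerDl.
  by apply: sumr_ge0 => l _; exact: (LP l).1.
exists (n%:R * L) => [|x y Kx Ky]; first by rewrite mulr_ge0.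
(* Removing the linear part at [x] leaves a map whose Jacobian at [z] is at most [L] times the
   distance to [x]; the mean value inequality then gives the second power. *)
pose G z := F z - z *m jacobian F x.
have CG : Cmx 1 U G.
  apply: CmxB => //; first exact: Cmx_le CF.
  by apply: CmxM; [exact: oU|exact: Cmx_id|exact: Cmx_cst].
have JG z : U z -> jacobian G z = jacobian F z - jacobian F x.
  move=> Uz; have CF1 : Cmx 1 U F by exact: Cmx_le CF.
  apply: jacobian_eq; first exact: C1_differentiable_rV oU CG Uz.
  move=> v; rewrite mulmxBr; apply: is_deriveB; last exact: is_derive_mulmxr.
  exact: is_derive_jacobian oU CF1 Uz.
have -> : F y - F x - (y - x) *m jacobian F x = G y - G x.
  by rewrite /G mulmxBl !opprB !addrA; apply/rowP => j; rewrite !mxE; ring.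
have Ks (s : R) : 0 <= s <= 1 -> K (x + s *: (y - x)) by exact: vK.
rewrite expr2 !mulrA -(mulrA _ L).
apply: seg_bound oU CG _ _ => s si; first by apply: KU; exact: Ks.
rewrite JG; last by apply: KU; exact: Ks.
apply: le_trans (LJ _ _ Kx (Ks _ si)) _.
rewrite ler_wpM2l // addrAC subrr add0r normrZ.
by case/andP: si => s0 s1; rewrite ger0_norm // ler_piMl.
Qed.

End C2.

(** * Smooth dependence of flows on the initial point *)

Section SmoothFlow.
Context {R : realType}.

(* A uniform compact convex set containing all nearby trajectories provides
   the Lipschitz and Taylor constants of the smooth dependence proof. *)
Definition confined n (U : set 'rV[R]_n) (phi : 'rV[R]_n -> R -> 'rV[R]_n)
    (x : 'rV[R]_n) :=
  exists K : set 'rV[R]_n, [/\ closed K, bounded_set K, convexs K, K `<=` U &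
    \forall y \near x, forall t : R, 0 <= t <= 1 -> K (phi y t)].

Definition flow_on n (U : set 'rV[R]_n) (F : 'rV[R]_n -> 'rV[R]_n)
    (W : set 'rV[R]_n) (phi : 'rV[R]_n -> R -> 'rV[R]_n) :=
  [/\ open U, open W, forall x, W x -> solves (fun=> F) x (phi x) &
      forall x, W x -> confined U phi x].

Lemma flow_lipschitz n (U : set 'rV[R]_n) F W phi x : flow_on U F W phi ->
  Cmx 1 U F -> W x ->
  exists2 C, 0 <= C & \forall y \near x, forall t : R, 0 <= t <= 1 ->
    `|phi y t - phi x t| <= C * `|y - x|.
Proof.
move=> [oU oW sol conf] CF Wx.
have [K [cK bK vK KU nK]] := conf x Wx.
have [L L0 LF] := C1_lipschitz oU CF cK bK vK KU.
pose L' := Num.max L 1; have L'0 : 0 < L' by rewrite lt_max ltr01 orbT.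
exists (2 * expR (2 * L')); first by rewrite mulr_ge0 // expR_ge0.
have Kx := nbhs_singleton nK.
have nW : \forall y \near x, W y by exact: open_near.
apply: filterS2 nK nW => y Ky Wy t ti.
have [cy y0 dy] := sol y Wy; have [cx x0 dx] := sol x Wx.
have := @gronwall R 1 n (fun s => phi y s - phi x s)
  (fun s => F (phi y s) - F (phi x s)) L' 0 L'0 (lexx _) _ _ _ t ti.
rewrite y0 x0 addr0 mulrAC; apply.
- by move=> s; apply: continuousB; [exact: cy|exact: cx].
- by move=> s si; apply: is_deriveB; [exact: dy|exact: dx].
- move=> s /andP[s0 s1]; have si : 0 <= s <= 1 by rewrite !ltW.
  rewrite addr0; apply: le_trans (LF _ _ (Kx s si) (Ky s si)) _.
  by rewrite ler_wpM2r // le_max lexx.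
Qed.

Lemma continuous_dist (T : topologicalType) (V : normedModType R) (f : T -> V)
    (x : T) :
  (forall e : R, 0 < e -> \forall y \near x, `|f x - f y| < e) ->
  {for x, continuous f}.
Proof. by move=> h; apply/cvgrPdist_lt. Qed.

Lemma near_dist (V : normedModType R) (x : V) (e : R) : 0 < e ->
  \forall y \near x, `|x - y| < e.
Proof.
by move=> e0; have := nbhsx_ballx x e e0; rewrite -ball_normE.
Qed.

Lemma flow_continuous n (U : set 'rV[R]_n) F W phi x (t : R) :
  flow_on U F W phi -> Cmx 1 U F -> W x -> 0 <= t <= 1 ->
  {for x, continuous (fun y => phi y t)}.
Proof.
move=> fl CF Wx ti; have [C C0 nC] := flow_lipschitz fl CF Wx.
apply: continuous_dist => e e0.
have n2 : \forall y \near x, `|x - y| < e / (C + 1).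
  by apply: near_dist; rewrite divr_gt0 // ltr_wpDl.
apply: filterS2 nC n2 => y h1 h2.
rewrite distrC; apply: le_lt_trans (h1 t ti) _.
rewrite distrC ltr_pdivlMr ?ltr_wpDl // in h2; apply: le_lt_trans h2.
by rewrite mulrC ler_wpM2l // lerDl.
Qed.

Lemma linear_ode n (J : R -> 'M[R]_n) (B : R) v : continuous J -> 0 <= B ->
  (forall t, `|J t| <= B) -> exists y, solves (fun t y => y *m J t) v y.
Proof.
move=> cJ B0 JB; apply: (@picard _ _ _ (n%:R * B)).
  by move=> x cx t; apply: continuous_mulmx; [exact: cx|exact: cJ].
move=> t x y; rewrite -mulmxBl; apply: le_trans (norm_mulmx _ _) _.
by rewrite mulrAC ler_wpM2r // ler_wpM2l.
Qed.

(* The derivative of the flow in the initial condition is a component of the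
   flow of the variational vector field [(x, v) |-> (F x, v *m DF x)], which
   loses one degree of differentiability; hence the induction on [k]. *)
Theorem flow_Ck k n (U : set 'rV[R]_n) F W phi : flow_on U F W phi ->
  Cmx k.+1 U F -> forall t : R, 0 <= t <= 1 -> Cmx k W (fun x => phi x t).
Proof.
elim: k n U F W phi => [|k ih] n U F W phi fl CF t ti.
  move=> i j; split=> // x Wx.
  have := flow_continuous fl CF Wx ti.
  by move/continuous_mxP; apply.
have [oU oW sol conf] := fl.
have CF1 : Cmx 1 U F by exact: Cmx_le CF.
have CF2 : Cmx 2 U F by exact: Cmx_le CF.
have CJ : Cmx k.+1 U (jacobian F) by exact: Cmx_jacobian.
have CJ0 : Cmx 0 U (jacobian F) by exact: Cmx_le CJ.
have inU x (s : R) : W x -> 0 <= s <= 1 -> U (phi x s).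
  by move=> /conf [K [_ _ _ KU /nbhs_singleton Kx]] si; apply: KU; exact: Kx.
have cphi x : W x -> continuous (phi x \o clamp01).
  by move=> /sol [cx _ _] s; apply: continuous_comp; [exact: continuous_clamp01|exact: cx].
have /choice [Y YP] : forall xv : 'rV[R]_n * 'rV[R]_n, exists y, W xv.1 ->
   solves (fun t y => y *m jacobian F (phi xv.1 (clamp01 t))) xv.2 y.
  move=> [x v] /=; have [Wx|nW] := pselect (W x); last by exists (fun=> 0).
  have [K [cK bK vK KU /nbhs_singleton Kx]] := conf x Wx.
  have [B B0 JB] := compact_bound oU cK bK KU CJ0.
  have [||y yP] := @linear_ode n (fun t => jacobian F (phi x (clamp01 t))) B v _ B0.
  - move=> s; apply: (@continuous_comp _ _ _ (phi x \o clamp01) (jacobian F)).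
      exact: cphi.
    by apply: Cmx_continuous CJ0 _; apply: inU => //; exact: clamp01_itv.
  - by move=> s; apply: JB; apply: Kx; exact: clamp01_itv.
  - by exists y.
pose F2 (z : 'rV[R]_(n + n)) := row_mx (F (lsubmx z)) (rsubmx z *m jacobian F (lsubmx z)).
pose U2 : set 'rV[R]_(n + n) := [set z | U (lsubmx z)].
pose W2 : set 'rV[R]_(n + n) := [set z | W (lsubmx z)].
pose phi2 (z : 'rV[R]_(n + n)) (s : R) :=
  row_mx (phi (lsubmx z) s) (Y (lsubmx z, rsubmx z) s).
have opre (V : set 'rV[R]_n) : open V -> open [set z : 'rV[R]_(n + n) | V (lsubmx z)].
  by move=> oV; apply: open_comp oV => z _; exact: continuous_lsubmx.
have fl2 : flow_on U2 F2 W2 phi2.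
  split; [exact: opre|exact: opre| |].
  - move=> z Wz; have [c1 i1 d1] := sol _ Wz.
    have [c2 i2 d2] := YP (lsubmx z, rsubmx z) Wz; split.
    + move=> s; apply/continuous_mxP => i j.
      rewrite -(splitK j); case: (fintype.split j) => l /=.
        rewrite (_ : (fun y => _) = fun y => phi (lsubmx z) y i l).
          by have := c1 s; move/continuous_mxP; apply.
        by apply/funext => y; rewrite row_mxEl.
      rewrite (_ : (fun y => _) = fun y => Y (lsubmx z, rsubmx z) y i l).
        by have := c2 s; move/continuous_mxP; apply.
      by apply/funext => y; rewrite row_mxEr.
    + by rewrite /phi2 i1 i2 hsubmxK.
    + move=> s si; have si' : 0 <= s <= 1 by case/andP: si => /ltW -> /ltW ->.
      apply/is_derive_mxP => i j.
      rewrite /F2 /phi2 row_mxKl row_mxKr.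
      rewrite -(splitK j); case: (fintype.split j) => l /=.
        rewrite row_mxEl (_ : (fun y => _) = fun y => phi (lsubmx z) y i l).
          by apply: (proj1 (is_derive_mxP _ _ _ _)); exact: d1.
        by apply/funext => y; rewrite row_mxEl.
      rewrite row_mxEr (_ : (fun y => _) = fun y => Y (lsubmx z, rsubmx z) y i l).
        have := d2 s si; rewrite [(_, _).1]/= clamp01_id // => /is_derive_mxP.
        exact.
      by apply/funext => y; rewrite row_mxEr.
  - move=> z Wz; have [K [cK bK vK KU nK]] := conf _ Wz.
    have [B B0 JB] := compact_bound oU cK bK KU CJ0.
    pose L := n%:R * B + 1.
    have L0 : 0 < L by rewrite ltr_wpDl // mulr_ge0.
    (* The Gronwall bound for the variational component, uniform over the initial points at distance
       less than 1 from [z]. *)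
    pose r := 2 * (`|z| + 1) * expR (2 * L).
    have r0 : 0 <= r by rewrite !mulr_ge0 ?expR_ge0 // addr_ge0.
    exists [set w : 'rV[R]_(n + n) | K (lsubmx w) /\ `|rsubmx w| <= r]; split.
    + apply: closedI.
        by apply: closed_comp cK => w _; exact: continuous_lsubmx.
      apply: (@closed_comp _ _ (fun w : 'rV[R]_(n + n) => `|rsubmx w|) [set s | s <= r]).
        move=> w _; apply: continuous_comp; last exact: norm_continuous.
        exact: continuous_rsubmx.
      exact: closed_le.
    + have [M [Mr MK]] := bK.
      exists (Num.max (M + 1) r); split; first exact: num_real.
      move=> C Cm w /= [Kw rw]; rewrite -[w]hsubmxK.
      have [C1 C2] : M + 1 < C /\ r < C by move: Cm; rewrite gt_max => /andP.
      apply: norm_row_mx; first exact: le_trans (ltW C2).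
        by apply: le_trans (MK (M + 1) _ _ Kw) (ltW C1); rewrite ltrDl.
      exact: le_trans rw (ltW C2).
    + move=> w1 w2 s [K1 r1] [K2 r2] si; split.
        by rewrite linearD linearZ linearB /=; exact: vK.
      rewrite linearD linearZ linearB /=.
      have -> : rsubmx w1 + s *: (rsubmx w2 - rsubmx w1) =
         (1 - s) *: rsubmx w1 + s *: rsubmx w2.
        by apply/rowP => j; rewrite !mxE; ring.
      apply: le_trans (ler_normD _ _) _; rewrite !normrZ.
      case/andP: si => s0 s1; rewrite ger0_norm ?subr_ge0 // [`|s|]ger0_norm //.
      have : (1 - s) * `|rsubmx w1| <= (1 - s) * r by rewrite ler_wpM2l // subr_ge0.
      have : s * `|rsubmx w2| <= s * r by rewrite ler_wpM2l.
      lra.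
    + by move=> w [Kw _]; exact: KU.
    + have n1 : \forall w \near z, forall t : R, 0 <= t <= 1 -> K (phi (lsubmx w) t).
        exact: (@continuous_lsubmx R 1 n n z _ nK).
      have n2 : \forall w \near z, W2 w by apply: open_near => //; exact: opre.
      have n3 : \forall w \near z, `|z - w| < 1 by exact: near_dist.
      apply: filterS3 n1 n2 n3 => w h1 Ww w1 s si; split.
        by rewrite row_mxKl; exact: h1.
      rewrite row_mxKr; have [c2 i2 d2] := YP (lsubmx w, rsubmx w) Ww.
      have := @gronwall R 1 n _ _ L 0 L0 (lexx _) c2 d2 _ s si.
      rewrite i2 addr0 => H; apply: le_trans (H _) _.
        move=> a /andP[a0 a1]; have ai : 0 <= a <= 1 by rewrite !ltW.
        rewrite addr0; apply: le_trans (norm_mulmx _ _) _.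
        rewrite mulrAC ler_wpM2r // /L.
        apply: (@le_trans _ _ (n%:R * B)); last by rewrite lerDl.
        by rewrite ler_wpM2l //= clamp01_id // JB //; apply: h1.
      rewrite /r ler_wpM2r ?expR_ge0 // ler_wpM2l //.
      apply: le_trans (norm_rsubmx _) _.
      have -> : w = z - (z - w) by rewrite opprB addrC subrK.
      by apply: le_trans (ler_normB _ _) _; rewrite lerD2l ltW.
have CF2' : Cmx k.+1 U2 F2.
  have Cl : Cmx k.+1 U2 (fun z : 'rV[R]_(n + n) => lsubmx z).
    by apply: Cmx_lsub; exact: Cmx_id.
  have oU2 : open U2 by exact: opre.
  apply: Cmx_row.
    by apply: (Cmx_comp oU2 oU _ _ Cl) => //; exact: Cmx_le CF.
  refine (@CmxM _ _ _ _ oU2 _ _ _ (fun z : 'rV[R]_(n + n) => rsubmx z)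
    (jacobian F \o lsubmx) _ _); first by apply: Cmx_rsub; exact: Cmx_id.
  exact: (Cmx_comp oU2 oU _ CJ Cl).
have Cphi2 := ih _ _ _ _ _ fl2 CF2' t ti.
have der x (v : 'rV[R]_n) : W x -> is_derive x v (fun y => phi y t) (Y (x, v) t).
  move=> Wx; have [K [cK bK vK KU nK]] := conf _ Wx.
  have [C C0 TC] := C2_taylor oU CF2 cK bK vK KU.
  have [B B0 JB] := compact_bound oU cK bK KU CJ0.
  have [D D0 nD] := flow_lipschitz fl CF1 Wx.
  pose L := n%:R * B + 1.
  have L0 : 0 < L by rewrite ltr_wpDl // mulr_ge0.
  pose E := 2 * (C * D ^+ 2 * `|v| ^+ 2) * expR (2 * L).
  have E0 : 0 <= E by rewrite !mulr_ge0 ?expR_ge0 // exprn_ge0.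
  have nW : \forall y \near x, W y by exact: open_near.
  have Kx := nbhs_singleton nK.
  have [c0 i0 d0] := sol _ Wx; have [c2 i2 d2] := YP (x, v) Wx.
  (* The remainder solves the variational equation up to the Taylor error of [F], which is quadratic
     in [h] by [flow_lipschitz]; Gronwall keeps it quadratic. *)
  have near_h : \forall h \near (0 : R),
      `|phi (h *: v + x) t - phi x t - h *: Y (x, v) t| <= E * h ^+ 2.
    have ch : {for (0 : R), continuous (fun h : R => h *: v + x)}.
      apply: continuousD; last exact: cst_continuous.
      by apply: continuousZr_tmp; exact: cvg_id.
    have x0 : (0 : R) *: v + x = x by rewrite scale0r add0r.
    have pull (Q : set 'rV[R]_n) : nbhs x Q -> \forall h \near (0 : R), Q (h *: v + x).
      by move=> nQ; apply: ch; rewrite /= x0.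
    apply: filterS3 (pull _ nK) (pull _ nD) (pull _ nW) => h Kh Dh Wh.
    have [ch' ih' dh'] := sol _ Wh.
    have := @gronwall R 1 n (fun s => phi (h *: v + x) s - phi x s - h *: Y (x, v) s)
      (fun s => F (phi (h *: v + x) s) - F (phi x s) -
         h *: (Y (x, v) s *m jacobian F (phi x (clamp01 s))))
      L (C * (D * (`|h| * `|v|)) ^+ 2) L0 _ _ _ _ t ti.
    rewrite ih' i0 i2 addrK subrr normr0 add0r => H.
    apply: le_trans (H _ _ _ _) _.
    - by rewrite mulr_ge0 // exprn_ge0 // !mulr_ge0.
    - have cc (s : R) : {for s, continuous (fun s : R =>
          phi (h *: v + x) s - phi x s - h *: Y (x, v) s)}.
        apply: (@continuousB _ _ _ (fun s => phi (h *: v + x) s - phi x s)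
          (fun s => h *: Y (x, v) s)).
          by apply: continuousB; [exact: ch'|exact: c0].
        by apply: continuousZl_tmp; exact: c2.
      exact: cc.
    - move=> s si; apply: is_deriveB; first by apply: is_deriveB; [exact: dh'|exact: d0].
      by apply: is_deriveZ; exact: d2.
    - move=> s /andP[s0 s1]; have si : 0 <= s <= 1 by rewrite !ltW.
      rewrite clamp01_id //.
      set p := phi (h *: v + x) s; set q := phi x s; set y := Y (x, v) s.
      have -> : F p - F q - h *: (y *m jacobian F q) =
         (p - q - h *: y) *m jacobian F q + (F p - F q - (p - q) *m jacobian F q).
        by rewrite [(p - q - _) *m _]mulmxBl -scalemxAl; apply/rowP => j; rewrite !mxE; ring.
      apply: le_trans (ler_normD _ _) _; apply: lerD.
        apply: le_trans (norm_mulmx _ _) _; rewrite mulrAC ler_wpM2r // /L.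
        apply: (@le_trans _ _ (n%:R * B)); last by rewrite lerDl.
        by rewrite ler_wpM2l //= JB //; apply: Kx.
      apply: le_trans (TC _ _ (Kx s si) (Kh s si)) _.
      rewrite ler_wpM2l // lerXn2r ?nnegrE //; first by rewrite !mulr_ge0.
      by apply: le_trans (Dh s si) _; rewrite addrK normrZ.
    - rewrite le_eqVlt /E !exprMn real_normK ?num_real //.
      by apply/orP; left; apply/eqP; ring.
  have cv : h^-1 *: (phi (h *: v + x) t - phi x t) @[h --> 0^'] --> Y (x, v) t.
    apply/cvgrPdist_lt => e e0.
    have n1 : \forall h \near 0^', `|phi (h *: v + x) t - phi x t - h *: Y (x, v) t| <= E * h ^+ 2.
      exact: nbhs_dnbhs.
    have n2 : \forall h \near (0 : R)^', h != 0 by exact: nbhs_dnbhs_neq.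
    have n3 : \forall h \near (0 : R)^', `|h| < e / (E + 1).
      apply: dnbhs0_lt.
      by rewrite divr_gt0 // ltr_wpDl.
    apply: filterS3 n1 n2 n3 => h h1 h0 h3.
    rewrite ltr_pdivlMr ?ltr_wpDl // in h3; apply: le_lt_trans h3.
    have -> : Y (x, v) t - h^-1 *: (phi (h *: v + x) t - phi x t) =
      - (h^-1 *: (phi (h *: v + x) t - phi x t - h *: Y (x, v) t)).
      by rewrite [in RHS]scalerBr scalerA mulVf // scale1r opprB.
    rewrite normrN normrZ normfV ler_pdivrMl ?normr_gt0 //.
    apply: le_trans h1 _; rewrite -(real_normK (num_real h)) mulrA mulrC -expr2.
    by rewrite ler_wpM2l ?sqr_ge0 // lerDl.
  apply: DeriveDef; first by apply/cvg_ex; exists (Y (x, v) t).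
  exact: cvg_lim cv.
move=> i j; split=> [x Wx|l].
  by have := flow_continuous fl CF1 Wx ti; move/continuous_mxP; apply.
split=> [x Wx|].
  by have [] := proj1 (is_derive_mxP _ _ _ _) (der x (delta_mx 0 l) Wx) i j.
apply: (@Ck_on_ext _ _ _ _ ((fun z => rsubmx (phi2 z t) i j) \o
   (fun x => row_mx x (delta_mx 0 l)))) => //.
  move=> x Wx /=; rewrite row_mxKr row_mxKl row_mxKr.
  by have [_ h] := proj1 (is_derive_mxP _ _ _ _) (der x (delta_mx 0 l) Wx) i j; exact: esym h.
have oW2 : open W2 by exact: opre.
apply: (Ck_on_comp oW oW2).
- by move=> x Wx; rewrite /W2 /= row_mxKl.
- exact: (Cmx_rsub Cphi2).
- by apply: Cmx_row; [exact: Cmx_id|exact: Cmx_cst].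
Qed.

End SmoothFlow.

(** * Balls of the sup norm *)

Section Balls.
Context {R : realType} {n : nat}.
Implicit Types (p x : 'rV[R]_n).

Definition oball p (r : R) : set 'rV[R]_n := [set x | `|x - p| < r].
Definition cball p (r : R) : set 'rV[R]_n := [set x | `|x - p| <= r].

Lemma continuous_distl p : continuous (fun x : 'rV[R]_n => `|x - p|).
Proof.
move=> x; apply: (@continuous_comp _ _ _ (fun x : 'rV[R]_n => x - p)).
  by apply: continuousB; [exact: cvg_id|exact: cst_continuous].
exact: norm_continuous.
Qed.

Lemma oball_open p r : open (oball p r).
Proof.
apply: (@open_comp _ _ (fun x : 'rV[R]_n => `|x - p|) [set s | s < r]).
  by move=> x _; exact: continuous_distl.
exact: open_lt.
Qed.

Lemma cball_closed p r : closed (cball p r).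
Proof.
apply: (@closed_comp _ _ (fun x : 'rV[R]_n => `|x - p|) [set s | s <= r]).
  by move=> x _; exact: continuous_distl.
exact: closed_le.
Qed.

Lemma cball_bounded p r : bounded_set (cball p r).
Proof.
exists (`|p| + r); split; first exact: num_real.
move=> M rM x /= xr; rewrite -(subrK p x); apply: le_trans (ler_normD _ _) _.
by apply: ltW; apply: le_lt_trans rM; rewrite addrC lerD2l.
Qed.

Lemma norm_convex_comb x p y (s : R) : 0 <= s <= 1 ->
  `|x + s *: (y - x) - p| <= (1 - s) * `|x - p| + s * `|y - p|.
Proof.
move=> /andP[s0 s1].
have -> : x + s *: (y - x) - p = (1 - s) *: (x - p) + s *: (y - p).
  by apply/rowP => j; rewrite !mxE; ring.
apply: le_trans (ler_normD _ _) _.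
by rewrite !normrZ ger0_norm ?subr_ge0 // [`|s|]ger0_norm.
Qed.

Lemma cball_convex p r : convexs (cball p r).
Proof.
move=> x y s xr yr si; apply: le_trans (norm_convex_comb _ _ _ si) _.
case/andP: si => s0 s1; move: xr yr; rewrite /cball /= => xr yr.
have : (1 - s) * `|x - p| <= (1 - s) * r by rewrite ler_wpM2l // subr_ge0.
have : s * `|y - p| <= s * r by rewrite ler_wpM2l.
lra.
Qed.

Lemma oball_convex p r : convexs (oball p r).
Proof.
move=> x y s xr yr si; apply: le_lt_trans (norm_convex_comb _ _ _ si) _.
case/andP: si => s0 s1; move: xr yr; rewrite /oball /= => xr yr.
have [->|sn] := eqVneq s 0; first by rewrite subr0 mul1r mul0r addr0.
have : (1 - s) * `|x - p| <= (1 - s) * r by rewrite ler_wpM2l ?subr_ge0 // ltW.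
have : s * `|y - p| < s * r by rewrite ltr_pM2l // lt_def sn.
lra.
Qed.

Lemma nbhs_oball p (A : set 'rV[R]_n) : nbhs p A -> exists2 r : R, 0 < r & oball p r `<=` A.
Proof.
move=> /nbhs_ballP [r /= r0 rA]; exists r => // x xr; apply: rA.
by rewrite -ball_normE /= distrC.
Qed.

Lemma nbhs_cball p (A : set 'rV[R]_n) : nbhs p A -> exists2 r : R, 0 < r & cball p r `<=` A.
Proof.
move=> /nbhs_oball [r r0 rA]; exists (r / 2); first by rewrite divr_gt0.
move=> x xr; apply: rA; apply: le_lt_trans xr _.
by rewrite ltr_pdivrMr // ltr_pMr // ltr1n.
Qed.

Lemma oball_center p r : 0 < r -> oball p r p.
Proof. by rewrite /oball /= subrr normr0. Qed.

Lemma nbhs_oballW p r : 0 < r -> nbhs p (oball p r).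
Proof. by move=> r0; apply: open_nbhs_nbhs; split; [exact: oball_open|exact: oball_center]. Qed.

Lemma oball_cball p r : oball p r `<=` cball p r.
Proof. by move=> x; rewrite /oball /cball /=; exact: ltW. Qed.

(** The coordinatewise retraction onto a ball of the sup norm. It does not increase distances, so
    composing with it extends a Lipschitz field from the ball to the whole space, as [picard]
    demands. *)
Definition clampb p (r : R) x : 'rV[R]_n :=
  \row_j Num.max (p 0 j - r) (Num.min (x 0 j) (p 0 j + r)).

Lemma clampb_cball p r x : 0 <= r -> cball p r (clampb p r x).
Proof.
move=> r0; apply: mx_norm_le => // i j; rewrite (ord1 i) !mxE ler_distl.
rewrite le_max lexx /= ge_max; apply/andP; split; first lra.
by rewrite ge_min lexx orbT.
Qed.

Lemma clampb_id p r x : cball p r x -> clampb p r x = x.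
Proof.
move=> xr; apply/rowP => j; rewrite mxE.
have := le_trans (ler_mxE (x - p) 0 j) xr; rewrite !mxE ler_distl => /andP[h1 h2].
by rewrite (min_idPl h2) (max_idPr h1).
Qed.

Lemma clampb_lipschitz p r x y : 0 <= r -> `|clampb p r x - clampb p r y| <= `|x - y|.
Proof.
move=> r0; apply: mx_norm_le => // i j; rewrite (ord1 i) !mxE.
have := ler_mxE (x - y) 0 j; rewrite !mxE.
move: (x 0 j) (y 0 j) (p 0 j) `|x - y| => a b c d h; apply: le_trans h.
rewrite /Order.max /Order.min; do ?case: ifPn; rewrite -?leNgt => *;
  rewrite ler_norml; apply/andP; split;
  (have := ler_norm (a - b); have := ler_norm (b - a); rewrite [`|b - a|]distrC; lra).
Qed.

End Balls.

(** * Flows and the inverse function theorem *)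

Section LocalFlow.
Context {R : realType}.

Lemma row_mxB r n (a b : 'rV[R]_r) (c d : 'rV[R]_n) :
  row_mx a c - row_mx b d = row_mx (a - b) (c - d).
Proof. by rewrite opp_row_mx add_row_mx. Qed.

Lemma norm_row_mx_lt r n (x : 'rV[R]_r) (y : 'rV[R]_n) c :
  0 < c -> `|x| < c -> `|y| < c -> `|row_mx x y| < c.
Proof.
move=> c0 xc yc; apply: mx_norm_lt => // i j; rewrite -(splitK j).
case: (fintype.split j) => l /=; rewrite ?row_mxEl ?row_mxEr.
  by apply: le_lt_trans xc; exact: ler_mxE.
by apply: le_lt_trans yc; exact: ler_mxE.
Qed.

Lemma oball_row r n (p : 'rV[R]_n) (z : 'rV[R]_(r + n)) (d : R) :
  oball (row_mx 0 p) d z -> `|lsubmx z| < d /\ oball p d (rsubmx z).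
Proof.
rewrite /oball /= -{1}[z]hsubmxK row_mxB subr0 => h; split.
  by apply: le_lt_trans h; rewrite -{1}(row_mxKl (lsubmx z) (rsubmx z - p)) norm_lsubmx.
by apply: le_lt_trans h; rewrite -{1}(row_mxKr (lsubmx z) (rsubmx z - p)) norm_rsubmx.
Qed.

Lemma solves_scale n (F : 'rV[R]_n -> 'rV[R]_n) x y (s : R) : 0 <= s <= 1 ->
  solves (fun=> F) x y -> solves (fun=> (fun z => s *: F z)) x (fun t => y (s * t)).
Proof.
move=> /andP[s0 s1] [cy y0 dy]; split.
- move=> t; apply: (@continuous_comp _ _ _ (fun t : R => s * t) y); last exact: cy.
  exact: mulrl_continuous.
- by rewrite mulr0.
- move=> t /andP[t0 t1]; have [->|sn] := eqVneq s 0.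
    rewrite scale0r; under eq_fun do rewrite mul0r.
    exact: is_derive_cst.
  have sp : 0 < s by rewrite lt_def sn.
  have sti : 0 < s * t < 1 by rewrite mulr_gt0 //=; apply: le_lt_trans t1; rewrite ler_piMl // ltW.
  have h : is_derive t 1 (fun t : R => s * t) s.
    have := is_deriveZ (f := (id : R -> R)) (x := t) (v := 1) s.
    by move=> /(_ _ (is_derive_id _ _)); rewrite [_ *: 1]mulr1.
  apply/is_derive_mxP => i j; rewrite (ord1 i) mxE.
  have := proj1 (is_derive_mxP _ _ _ _) (dy _ sti) 0 j => dyj.
  have := is_derive1_comp dyj h.
  by rewrite mulrC.
Qed.

Lemma solves_rev n (F : 'rV[R]_n -> 'rV[R]_n) x y :
  solves (fun=> F) x y -> solves (fun=> (fun z => - F z)) (y 1) (fun t => y (1 - t)).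
Proof.
move=> [cy y0 dy]; split.
- move=> t; apply: (@continuous_comp _ _ _ (fun t : R => 1 - t) y); last exact: cy.
  by apply: continuousB; [exact: cst_continuous|exact: cvg_id].
- by rewrite subr0.
- move=> t /andP[t0 t1].
  have sti : 0 < 1 - t < 1 by rewrite subr_gt0 t1 /= gtrBl.
  have h : is_derive t 1 (fun t : R => 1 - t) (-1).
    have := is_deriveB (is_derive_cst (1 : R) t 1) (is_derive_id t 1).
    by rewrite sub0r.
  apply/is_derive_mxP => i j; rewrite (ord1 i) mxE.
  have := proj1 (is_derive_mxP _ _ _ _) (dy _ sti) 0 j => dyj.
  have := @is_derive1_comp R (fun s => y s 0 j) (fun t => 1 - t) t _ _ dyj h.
  by rewrite mulrC mulN1r.
Qed.

(* [G e x] is the time-one flow of [e *m Z] from [x], so that all the linear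
   combinations of the rows of [Z] are integrated at once. *)
Theorem local_flow r n (U : set 'rV[R]_n) (Z : 'rV[R]_n -> 'M[R]_(r, n)) p (rho : R) :
  open U -> 0 < rho -> cball p rho `<=` U -> (forall k, Cmx k U Z) ->
  exists d (G : 'rV[R]_r -> 'rV[R]_n -> 'rV[R]_n),
  [/\ 0 < d <= rho,
    forall k, Cmx k (oball (row_mx 0 p) d) (fun z => G (lsubmx z) (rsubmx z)),
    forall e x, `|e| < d -> oball p d x -> exists y,
      solves (fun=> (fun x => e *m Z x)) x y /\
      forall t : R, 0 <= t <= 1 -> G (t *: e) x = y t /\ oball p rho (y t) &
    forall e x y, `|e| < d -> oball p d x ->
      solves (fun=> (fun x => e *m Z x)) x y ->
      (forall t : R, 0 <= t <= 1 -> cball p rho (y t)) -> y 1 = G e x].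
Proof.
move=> oU r0 KU CZ.
pose z0 : 'rV[R]_(r + n) := row_mx 0 p.
(* The parameter [e] becomes a coordinate of zero velocity, so that smoothness in [(e, x)] is smooth
   dependence on the initial point. *)
pose F (z : 'rV[R]_(r + n)) : 'rV[R]_(r + n) := row_mx 0 (lsubmx z *m Z (rsubmx z)).
pose U' : set 'rV[R]_(r + n) := [set z | U (rsubmx z)].
have oU' : open U' by apply: open_comp oU => z _; exact: continuous_rsubmx.
have KU' : cball z0 rho `<=` U'.
  move=> z; rewrite /cball /= -{1}[z]hsubmxK row_mxB => h; apply: KU; apply: le_trans h.
  by rewrite -{1}(row_mxKr (lsubmx z - 0) (rsubmx z - p)) norm_rsubmx.
have CF k : Cmx k U' F.
  apply: Cmx_row; first exact: Cmx_cst.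
  apply: CmxM => //; first by apply: Cmx_lsub; exact: Cmx_id.
  apply: (Cmx_comp oU' oU _ (CZ k)) => //.
  by apply: Cmx_rsub; exact: Cmx_id.
have [L L0 LF] := C1_lipschitz oU' (CF 1%N) (@cball_closed _ _ z0 rho)
  (@cball_bounded _ _ z0 rho) (@cball_convex _ _ z0 rho) KU'.
have [B B0 ZB] := compact_bound oU (@cball_closed _ _ p rho)
  (@cball_bounded _ _ p rho) KU (CZ 0%N).
have inK (e : 'rV[R]_r) x : `|e| <= rho -> cball p rho x -> cball z0 rho (row_mx e x).
  move=> er xr; rewrite /cball /= row_mxB subr0; apply: norm_row_mx => //; exact: ltW.
have LZ (e : 'rV[R]_r) x y : `|e| <= rho -> cball p rho x -> cball p rho y ->
    `|e *m Z x - e *m Z y| <= L * `|x - y|.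
  move=> er xr yr; have := LF _ _ (inK e y er yr) (inK e x er xr).
  rewrite /F !row_mxKl !row_mxKr !row_mxB !subrr => h.
  have h1 := norm_rsubmx (row_mx (0 : 'rV[R]_r) (e *m Z x - e *m Z y)).
  rewrite row_mxKr in h1; apply: le_trans h1 _; apply: le_trans h _.
  by rewrite ler_wpM2l //; apply: norm_row_mx => //; rewrite normr0.
have /choice [y yP] : forall ex : 'rV[R]_r * 'rV[R]_n, exists y,
   `|ex.1| <= rho -> solves (fun=> (fun x => ex.1 *m Z (clampb p rho x))) ex.2 y.
  move=> [e x] /=; have [er|ner] := boolP (`|e| <= rho); last by exists (fun=> 0).
  have [||y yP] := @picard R n (fun=> (fun x => e *m Z (clampb p rho x))) L x.
  - move=> u cu t; apply: continuous_mulmx; first exact: cst_continuous.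
    have cl : {for t, continuous (clampb p rho \o u)}.
      apply: continuous_comp; first exact: cu.
      apply: continuous_dist => a a0; apply: filterS (near_dist _ a0) => w.
      by apply: le_lt_trans; apply: clampb_lipschitz; exact: ltW.
    apply: (@continuous_comp _ _ _ (clampb p rho \o u) Z); first exact: cl.
    by apply: Cmx_continuous (CZ 0%N) _; apply: KU; apply: clampb_cball; exact: ltW.
  - move=> _ u v; apply: le_trans (LZ _ _ _ er _ _) _; try by apply: clampb_cball; exact: ltW.
    by rewrite ler_wpM2l //; apply: clampb_lipschitz; exact: ltW.
  by exists y.
(* In time one a solution moves by at most [r%:R * d * B], so it stays within
   [d * (1 + r%:R * B) < rho] of [p]. The clamp is then the identity along it. *)
pose d := Num.min rho (rho / (2 * (1 + r%:R * B))).
have c0 : 0 < 1 + r%:R * B by rewrite ltr_pwDl // mulr_ge0.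
have d0 : 0 < d by rewrite lt_min r0 divr_gt0 // mulr_gt0.
have drho : d <= rho by rewrite ge_min lexx.
have dsm : d * (1 + r%:R * B) < rho.
  have h : d <= rho / (2 * (1 + r%:R * B)) by rewrite ge_min lexx orbT.
  apply: le_lt_trans (_ : _ <= rho / 2) _; last by rewrite ltr_pdivrMr // ltr_pMr // ltr1n.
  rewrite -ler_pdivlMr //; apply: le_trans h _.
  by rewrite invfM mulrA.
have yin (e : 'rV[R]_r) x (t : R) : `|e| < d -> oball p d x -> 0 <= t <= 1 -> oball p rho (y (e, x) t).
  move=> ed xd /andP[t0 t1].
  have er : `|e| <= rho by apply: ltW (lt_le_trans ed drho).
  have [cy y0 dy] := yP (e, x) er; rewrite /= in y0 dy.
  have comp j : `|y (e, x) t 0 j - y (e, x) 0 0 j| <= r%:R * `|e| * B.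
    have := @mvt_bound R (fun s => y (e, x) s 0 j)
      (fun s => (e *m Z (clampb p rho (y (e, x) s))) 0 j)
      (fun s => r%:R * `|e| * B * s) (fun=> r%:R * `|e| * B) t t0.
    rewrite mulr0 subr0 => H; apply: le_trans (H _ _ _ _ _) _.
    - move=> s /andP[s0 s1]; apply: (proj1 (is_derive_mxP _ _ _ _)); apply: dy.
      by rewrite s0 (lt_le_trans s1).
    - move=> s _; have := is_deriveZ (f := (id : R -> R)) (x := s) (v := 1) (r%:R * `|e| * B).
      by move=> /(_ _ (is_derive_id _ _)); rewrite [_ *: 1]mulr1.
    - move=> s _; apply: le_trans (ler_mxE _ _ _) _; apply: le_trans (norm_mulmx _ _) _.
      rewrite ler_wpM2l ?mulr_ge0 //; apply: ZB; apply: clampb_cball; exact: ltW.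
    - apply: continuous_subspaceT => s.
      by have := cy s; move/continuous_mxP; apply.
    - by apply: continuous_subspaceT => s; exact: mulrl_continuous.
    - by rewrite ler_piMr // !mulr_ge0.
  have h1 : `|y (e, x) t - x| <= r%:R * `|e| * B.
    rewrite -{2}y0; apply: mx_norm_le => [|i j]; first by rewrite !mulr_ge0.
    by rewrite (ord1 i) !mxE.
  rewrite /oball /= -(subrKA x); apply: le_lt_trans (ler_normD _ _) _.
  apply: lt_trans dsm; rewrite mulrDr mulr1 addrC.
  apply: ltr_leD => //; apply: le_trans h1 _.
  by rewrite mulrAC mulrC ler_wpM2r ?mulr_ge0 // ltW.
have ysol (e : 'rV[R]_r) x : `|e| < d -> oball p d x ->
    solves (fun=> (fun x => e *m Z x)) x (y (e, x)).
  move=> ed xd; have er : `|e| <= rho by apply: ltW (lt_le_trans ed drho).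
  have [cy y0 dy] := yP (e, x) er; split=> // t ti.
  have := dy t ti; rewrite /= clampb_id //; apply: oball_cball; apply: yin => //.
  by case/andP: ti => /ltW -> /ltW ->.
pose G e x := y (e, x) 1.
have uniq (e : 'rV[R]_r) x w : `|e| < d -> oball p d x -> solves (fun=> (fun x => e *m Z x)) x w ->
    (forall t : R, 0 <= t <= 1 -> cball p rho (w t)) -> w 1 = G e x.
  move=> ed xd ws wr; have er : `|e| <= rho by apply: ltW (lt_le_trans ed drho).
  apply: (@solves_unique R n _ _ x w (y (e, x)) L ws (ysol _ _ ed xd)) => [t ti|].
    have ti' : 0 <= t <= 1 by case/andP: ti => /ltW -> /ltW ->.
    by apply: LZ => //; [exact: wr|apply: oball_cball; exact: yin].
  by rewrite ler01 lexx.
exists d, G; split.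
- by rewrite d0 drho.
- move=> k.
  pose phi (z : 'rV[R]_(r + n)) (t : R) := row_mx (lsubmx z) (y (lsubmx z, rsubmx z) t).
  have fl : flow_on U' F (oball z0 d) phi.
    split=> //; first exact: oball_open.
      move=> z /oball_row [z1 z2]; have [cy y0 dy] := ysol _ _ z1 z2; split.
      + move=> s; apply/continuous_mxP => i j.
        rewrite -(splitK j); case: (fintype.split j) => l /=.
          rewrite (_ : (fun _ => _) = fun=> lsubmx z i l); first exact: cst_continuous.
          by apply/funext => a; rewrite row_mxEl.
        rewrite (_ : (fun _ => _) = fun a => y (lsubmx z, rsubmx z) a i l).
          by have := cy s; move/continuous_mxP; apply.
        by apply/funext => a; rewrite row_mxEr.
      + by rewrite /phi y0 hsubmxK.
      + move=> s si; apply/is_derive_mxP => i j.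
        rewrite /F /phi row_mxKl row_mxKr.
        rewrite -(splitK j); case: (fintype.split j) => l /=.
          rewrite (_ : (fun _ => _) = fun=> lsubmx z i l).
            by rewrite row_mxEl [X in is_derive _ _ _ X]mxE; exact: is_derive_cst.
          by apply/funext => a; rewrite row_mxEl.
        rewrite row_mxEr (_ : (fun _ => _) = fun a => y (lsubmx z, rsubmx z) a i l).
          by have := dy s si => /is_derive_mxP; exact.
        by apply/funext => a; rewrite row_mxEr.
    move=> z zd; exists (cball z0 rho); split.
    + exact: cball_closed.
    + exact: cball_bounded.
    + exact: cball_convex.
    + exact: KU'.
    + have : \forall w \near z, oball z0 d w by apply: open_near => //; exact: oball_open.
      apply: filterS => w /oball_row [w1 w2] t ti.
      apply: inK; first by apply: ltW (lt_le_trans w1 drho).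
      by apply: oball_cball; exact: yin.
  have := flow_Ck (k := k) fl (CF k.+1) (t := 1); rewrite ler01 lexx => /(_ isT) h.
  apply: Cmx_ext (Cmx_rsub h); first exact: oball_open.
  by move=> z zd; rewrite row_mxKr.
- move=> e x ed xd; exists (y (e, x)); split; first exact: ysol.
  move=> t ti; split; last exact: yin.
  (* Time [t] along [e] is time one along [t *: e]; uniqueness identifies the two solutions. *)
  have := solves_scale ti (ysol _ _ ed xd) => sc.
  have -> : y (e, x) t = (fun s => y (e, x) (t * s)) 1 by rewrite mulr1.
  apply/esym; apply: (uniq (t *: e) x (fun s => y (e, x) (t * s))) => //.
  + apply: le_lt_trans ed; rewrite normrZ; case/andP: ti => t0 t1.
    by rewrite ger0_norm // ler_piMl.
  + have -> : (fun x0 => (t *: e) *m Z x0) = (fun x0 => t *: (e *m Z x0)) by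
      apply/funext => w; rewrite scalemxAl.
    exact: sc.
  + move=> s /andP[s0 s1]; apply: oball_cball; apply: yin => //.
    by case/andP: ti => t0 t1; rewrite mulr_ge0 // mulr_ile1.
- exact: uniq.
Qed.

Definition diffeo n (O O' : set 'rV[R]_n) (f g : 'rV[R]_n -> 'rV[R]_n) :=
  [/\ open O, open O', forall x, O x -> O' (f x) /\ g (f x) = x,
      forall y, O' y -> O (g y) /\ f (g y) = y &
      forall k, Cmx k O f /\ Cmx k O' g].

(** After normalising by the inverse Jacobian at [p], [f] differs from the identity by a map [h] of
    small Jacobian. If [f x = f y], then [x - y] is an increment of [h], hence at most half of
    itself. *)
Lemma inj_near n (U : set 'rV[R]_n) (f : 'rV[R]_n -> 'rV[R]_n) p : open U -> U p ->
  Cmx 1 U f -> jacobian f p \in unitmx ->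
  exists2 rho, 0 < rho & cball p rho `<=` U /\
    forall x y, cball p rho x -> cball p rho y -> f x = f y -> x = y.
Proof.
move=> oU Up Cf Ju.
pose h x := f x *m invmx (jacobian f p) - x.
have Ch : Cmx 1 U h.
  apply: CmxB => //; last exact: Cmx_id.
  by apply: (CmxM oU Cf); exact: Cmx_cst.
have Jh x : U x -> jacobian h x = jacobian f x *m invmx (jacobian f p) - 1%:M.
  move=> Ux; apply: jacobian_eq; first exact: C1_differentiable_rV oU Ch Ux.
  move=> v; rewrite mulmxBr mulmx1 mulmxA; apply: is_deriveB.
  have := is_derive_mulmx (is_derive_jacobian v oU Cf Ux) (is_derive_cst (invmx (jacobian f p)) x v).
  by rewrite mulmx0 addr0.
(* [seg_bound] costs a factor [n]; this [c] makes [n%:R * c] at most 1/2. *)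
pose c : R := (2 * n.+1%:R)^-1.
have c0 : 0 < c by rewrite invr_gt0 mulr_gt0.
have nJ : nbhs p [set x | U x /\ `|jacobian h x| < c].
  have cJ : {for p, continuous (fun x => `|jacobian h x|)}.
    apply: (@continuous_comp _ _ _ (jacobian h)); last exact: norm_continuous.
    exact: Cmx_continuous (Cmx_jacobian oU Ch) Up.
  apply: filterI; first exact: open_near.
  apply: (cJ [set s | s < c]); apply: open_nbhs_nbhs; split; first exact: open_lt.
  by rewrite /= Jh // mulmxV // subrr normr0.
have [rho rho0 Kr] := nbhs_cball nJ; exists rho => //; split; first by move=> x /Kr [].
move=> x y xr yr fxy.
have := @seg_bound R n n U h x y c oU Ch.
have -> : h y - h x = x - y 
  by rewrite /h fxy; move: (f y *m _) => w; apply/rowP => j; rewrite !mxE; ring.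
move=> H; have /H{}H : forall s : R, 0 <= s <= 1 -> U (x + s *: (y - x)).
  by move=> s si; have [] := Kr _ (cball_convex xr yr si).
have {}H : `|x - y| <= n%:R * c * `|y - x|.
  by apply: H => s si; have [_ /ltW] := Kr _ (cball_convex xr yr si).
apply/eqP; rewrite -subr_eq0 -normr_le0.
have c2 : n%:R * c <= 1 / 2.
  rewrite /c invfM mulrCA mul1r ler_piMr // ?invr_ge0 //.
  by rewrite ler_pdivrMr // mul1r ler_nat.
have : n%:R * c * `|y - x| <= 1 / 2 * `|y - x| by rewrite ler_wpM2r.
by move: H; rewrite [`|y - x|]distrC; lra.
Qed.

(* The inverse is obtained by flowing along [invmx (jacobian f)]: [f] maps
   these flow lines to straight lines. *)
Theorem inverse_function n (U : set 'rV[R]_n) (f : 'rV[R]_n -> 'rV[R]_n) p :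
  open U -> U p -> (forall k, Cmx k U f) -> jacobian f p \in unitmx ->
  exists O O' g, [/\ O p, O `<=` U & diffeo O O' f g].
Proof.
move=> oU Up Cf Ju.
pose U1 : set 'rV[R]_n := [set x | U x /\ jacobian f x \in unitmx].
have CJ k : Cmx k U (jacobian f) by exact: Cmx_jacobian.
have oU1 : open U1 by exact: unitmx_open oU (CJ 0%N).
have U1U : U1 `<=` U by move=> x [].
have U1p : U1 p by split.
have [rho rho0 [KU inj]] := inj_near oU1 U1p (Cmx_sub U1U (Cf 1%N)) Ju.
pose Z x := invmx (jacobian f x).
have CZ k : Cmx k U1 Z.
  refine (@Cmx_inv _ _ k U1 oU1 n (jacobian f) _ (Cmx_sub U1U (CJ k))).
  by move=> x [].
have [d [G [/andP[d0 drho] CG GP _]]] := local_flow oU1 rho0 KU CZ.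
have fG e : `|e| < d -> oball p rho (G e p) /\ f (G e p) = f p + e.
  move=> ed; have [y [[cy y0 dy] yP]] := GP e p ed (oball_center p d0).
  have [] := yP 1; rewrite ?ler01 ?lexx // scale1r => -> y1; split=> //.
  have Uy (t : R) : 0 <= t <= 1 -> U1 (y t).
    by move=> ti; apply: KU; apply: oball_cball; exact: (yP t ti).2.
  apply/eqP; rewrite -subr_eq0; apply/eqP/rowP => j; rewrite !mxE.
  have ti01 (t : R) : 0 < t < 1 -> 0 <= t <= 1 by case/andP => /ltW -> /ltW ->.
  pose w (t : R) := f (y t) 0 j - t * e 0 j.
  have wd (t : R) : 0 < t < 1 -> is_derive t 1 w 0.
    move=> ti; rewrite -(subrr (e 0 j)); apply: is_deriveB; last first.
      have := is_deriveZ (f := (id : R -> R)) (x := t) (v := 1) (e 0 j).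
      move=> /(_ _ (is_derive_id _ _)); rewrite [_ *: 1]mulr1.
      by congr is_derive; apply/funext => s; rewrite /= mulrC.
    have Ut := Uy t (ti01 t ti).
    have := is_derive_comp_jacobian oU (Cf 1%N) (U1U _ Ut) (dy t ti).
    rewrite -mulmxA mulVmx ?mulmx1; last by case: Ut.
    by move=> /is_derive_mxP; exact.
  have := @mvt_bound R w (fun=> 0) (fun=> 0) (fun=> 0) 1 ler01.
  rewrite subrr => H.
  have : w 1 - w 0 == 0.
    rewrite -normr_le0; apply: H => //.
    - by move=> s _; rewrite normr0.
    - apply: continuous_in_subspaceT => s; rewrite inE /= in_itv /= => si.
      suff : {for (s : R), continuous w} by [].
      rewrite /w; apply: continuousB; last first.
        by apply: continuousM; [exact: cvg_id|exact: cst_continuous].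
      have : {for s, continuous (f \o y)}.
        apply: continuous_comp; first exact: cy.
        by apply: Cmx_continuous (Cf 0%N) _; apply: U1U; exact: Uy.
      by move/continuous_mxP; apply.
    - by apply: continuous_subspaceT => s; exact: cst_continuous.
  rewrite /w y0 mul0r mul1r subr0 => /eqP; lra.
pose g y := G (y - f p) p.
pose O : set 'rV[R]_n := oball p rho `&` [set x | U x /\ oball (f p) d (f x)].
exists O, (oball (f p) d), g; split.
- by split; [exact: oball_center|split=> //; exact: oball_center].
- by move=> x [_ []].
have ge y : oball (f p) d y -> oball p rho (g y) /\ f (g y) = y.
  move=> yd; have [h1 h2] := fG (y - f p) yd; split=> //.
  by rewrite /g h2 addrC subrK.
split.
- rewrite openE => x [xr [Ux fx]]; apply: filterI; first by apply: open_near => //; exact: oball_open.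
  apply: filterI; first exact: open_near.
  by apply: (Cmx_continuous (Cf 0%N) Ux); apply: open_near => //; exact: oball_open.
- exact: oball_open.
- move=> x [xr [Ux fx]]; split=> //; have [h1 h2] := ge _ fx.
  by apply: inj => //; apply: oball_cball.
- move=> y yd; have [h1 h2] := ge _ yd; split=> //; split=> //; split; last by rewrite /= h2.
  by apply: U1U; apply: KU; exact: oball_cball.
- move=> k; split; first by apply: Cmx_sub (Cf k) => x [_ []].
  have oW := @oball_open R (n + n) (row_mx 0 p) d.
  have oO' := @oball_open R n (f p) d.
  apply: (@Cmx_ext _ _ _ _ oO' _ _
     ((fun z => G (lsubmx z) (rsubmx z)) \o (fun y => row_mx (y - f p) p))).
    by move=> y _; rewrite /= row_mxKl row_mxKr.
  apply: (Cmx_comp oO' oW _ (CG k)).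
    move=> y yd; rewrite /oball /= row_mxB subr0 subrr.
    by apply: norm_row_mx_lt => //; rewrite normr0.
  apply: Cmx_row; last exact: Cmx_cst.
  by apply: CmxB; [exact: oball_open|exact: Cmx_id|exact: Cmx_cst].
Qed.

End LocalFlow.

(** * Charts adapted to a frame of vector fields *)

Section RadialBox.
Context {R : realType}.

Lemma constant_velocity n (y : R -> 'rV[R]_n) c : continuous y ->
  (forall t : R, 0 < t < 1 -> is_derive t 1 y c) -> y 1 = y 0 + c.
Proof.
move=> cy dy; rewrite -[in RHS](scale1r c).
apply: (@solves_unique R n (fun _ _ => c) (fun _ _ => c) (y 0) y (fun t => y 0 + t *: c) 0).
- by split.
- split.
  + move=> t; suff : {for t, continuous (fun t : R => y 0 + t *: c)} by [].
    apply: continuousD; first exact: cst_continuous.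
    by apply: continuousZr_tmp; exact: cvg_id.
  + by rewrite scale0r addr0.
  + by move=> t _; apply: (proj2 (is_derive_line id _ _ _ _)).
- by move=> t _; rewrite subrr normr0 mul0r.
- by rewrite ler01 lexx.
Qed.

(* [y - ((y - p) *m W) *m F] is the projection of [y] along [F] onto the slice
   [y *m W = p *m W]. *)
Definition box r n (p : 'rV[R]_n) (W : 'M[R]_(n, r)) (F : 'M[R]_(r, n)) (d : R) :
  set 'rV[R]_n :=
  [set y | oball p d (y - ((y - p) *m W) *m F) /\ `|(y - p) *m W| < d].

Section BoxFacts.
Context {r n : nat}.
Implicit Types (p y : 'rV[R]_n) (W : 'M[R]_(n, r)) (F : 'M[R]_(r, n)).

Lemma continuous_subW p W : continuous (fun y => (y - p) *m W).
Proof.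
move=> y; suff : {for y, continuous (fun y => (y - p) *m W)} by [].
apply: continuous_mulmx; last exact: cst_continuous.
by apply: continuousB; [exact: cvg_id|exact: cst_continuous].
Qed.

Lemma continuous_proj p W F : continuous (fun y => y - ((y - p) *m W) *m F).
Proof.
move=> y; suff : {for y, continuous (fun y => y - ((y - p) *m W) *m F)} by [].
apply: continuousB; first exact: cvg_id.
apply: continuous_mulmx; last exact: cst_continuous.
exact: continuous_subW.
Qed.

Lemma open_subW p W (d : R) : open [set y | `|(y - p) *m W| < d].
Proof.
apply: (@open_comp _ _ (fun y => `|(y - p) *m W|) [set s | s < d]); last exact: open_lt.
move=> y _; apply: (@continuous_comp _ _ _ (fun y => (y - p) *m W)); last exact: norm_continuous.
exact: continuous_subW.
Qed.

Lemma box_open p W F d : open (box p W F d).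
Proof.
apply: openI; last exact: open_subW.
by apply: open_comp (@oball_open _ _ p d) => y _; exact: continuous_proj.
Qed.

Lemma box_center p W F d : 0 < d -> box p W F d p.
Proof.
by move=> d0; split; rewrite subrr !mul0mx ?subr0 ?normr0 //; exact: oball_center.
Qed.

(** Both conditions bound an affine function of [y]. Convexity is what later makes the plaques of a
    leaf connected. *)
Lemma box_convex p W F d : convexs (box p W F d).
Proof.
move=> x y s [x1 x2] [y1 y2] si; split.
  have -> : x + s *: (y - x) - (x + s *: (y - x) - p) *m W *m F =
    (x - (x - p) *m W *m F) + s *: ((y - (y - p) *m W *m F) - (x - (x - p) *m W *m F)).
    rewrite -!mulmxA; move: (W *m F) => A.
    rewrite !mulmxBl !mulmxDl -!scalemxAl !mulmxBl.
    move: (x *m A) (y *m A) (p *m A) => a b c.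
    by apply/rowP => j; rewrite !mxE; ring.
  exact: oball_convex.
have -> : (x + s *: (y - x) - p) *m W = (x - p) *m W + s *: ((y - p) *m W - (x - p) *m W).
  rewrite !mulmxBl !mulmxDl -!scalemxAl !mulmxBl.
  move: (x *m W) (y *m W) (p *m W) => a b c.
  by apply/rowP => j; rewrite !mxE; ring.
have := @oball_convex R r 0 d _ _ s _ _ si.
by rewrite /oball /= => H; rewrite -[X in `|X|]subr0; apply: H; rewrite subr0.
Qed.

Lemma box_line p W F d y (s : R) : F *m W = 1%:M -> box p W F d y -> `|s| <= 1 ->
  box p W F d (y - ((y - p) *m W) *m F + s *: (((y - p) *m W) *m F)).
Proof.
move=> FW [y1 y2] s1.
have E : (y - (y - p) *m W *m F + s *: ((y - p) *m W *m F) - p) *m W = s *: ((y - p) *m W).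
  rewrite mulmxBl mulmxDl mulmxBl -scalemxAl -!(mulmxA _ F W) FW mulmx1.
  rewrite mulmxBl; move: (y *m W) (p *m W) => a b.
  by apply/rowP => j; rewrite !mxE; ring.
split; last first.
  by rewrite E normrZ; apply: le_lt_trans y2; rewrite ler_piMl.
by rewrite E -scalemxAl addrK.
Qed.

Lemma box_proj p W F d y : F *m W = 1%:M -> box p W F d y ->
  box p W F d (y - ((y - p) *m W) *m F) /\ (y - ((y - p) *m W) *m F) *m W = p *m W.
Proof.
move=> FW By; split.
  by have := box_line (s := 0) FW By; rewrite normr0 scale0r addr0; apply.
rewrite mulmxBl -(mulmxA _ F W) FW mulmx1 mulmxBl.
by rewrite opprB addrC subrK.
Qed.

Lemma nbhs_box p W F (A : set 'rV[R]_n) : nbhs p A ->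
  exists2 d : R, 0 < d & box p W F d `<=` A.
Proof.
move=> /nbhs_oball [e e0 eA].
pose c : R := 1 + r%:R * `|F|.
have c0 : 0 < c by rewrite ltr_pwDl // mulr_ge0.
exists (e / c); first by rewrite divr_gt0.
move=> y [y1 y2]; apply: eA; rewrite /oball /=.
have -> : y - p = (y - ((y - p) *m W) *m F - p) + ((y - p) *m W) *m F.
  by rewrite addrAC subrK.
apply: le_lt_trans (ler_normD _ _) _.
have -> : e = e / c + r%:R * (e / c) * `|F|.
  by rewrite /c mulrAC -[X in _ = X + _]mul1r -mulrDl mulrC divfK // lt0r_neq0.
apply: ltr_leD; first exact: y1.
apply: le_trans (norm_mulmx _ _) _.
by rewrite ler_wpM2r // ler_wpM2l // ltW.
Qed.

End BoxFacts.

(* [phi y] flows from the projection of [y] along [((y - p) *m W) *m Z]; thus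
   [phi] maps the rays of the box to integral curves of combinations of the rows
   of [Z]. *)
Theorem radial_box r n (U : set 'rV[R]_n) (Z : 'rV[R]_n -> 'M[R]_(r, n))
    (W : 'M[R]_(n, r)) p : open U -> U p -> (forall k, Cmx k U Z) ->
  (forall x, U x -> Z x *m W = 1%:M) ->
  exists d O psi phi,
  [/\ [/\ 0 < d, O p & O `<=` U], diffeo O (box p W (Z p) d) psi phi,
    forall x, O x -> psi x *m W = x *m W,
    forall x, O x -> x *m W = p *m W -> psi x = x &
    (forall y, box p W (Z p) d y ->
       ((y - p) *m W) *m Z p *m jacobian phi y = ((y - p) *m W) *m Z (phi y)) /\
    (forall y, box p W (Z p) d y -> y *m W = p *m W ->
       Z p *m jacobian phi y = Z y)].
Proof.
move=> oU Up CZ ZW.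
have [rho rho0 KU] := nbhs_cball (open_near oU Up).
have [d [G [/andP[d0 drho] CG GP uniq]]] := local_flow oU rho0 KU CZ.
set F := Z p; have FW : F *m W = 1%:M by exact: ZW.
pose D : set 'rV[R]_(r + n) := oball (row_mx 0 p) d.
have oD : open D by exact: oball_open.
have inD (e : 'rV[R]_r) x : `|e| < d -> oball p d x -> D (row_mx e x).
  by move=> ed xd; rewrite /D /oball /= row_mxB subr0; exact: norm_row_mx_lt.
have G0 x : oball p d x -> G 0 x = x.
  move=> xd; have [|y [[_ y0 _] yP]] := GP 0 x _ xd; first by rewrite normr0.
  by have := yP 0; rewrite lexx ler01 scale0r y0 => -[].
(* Since [Z *m W] is the identity, [y t *m W] moves with constant velocity [e]: the [W]-coordinates
   record how far the flow has gone. *)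
have GW (e : 'rV[R]_r) x : `|e| < d -> oball p d x -> G e x *m W = x *m W + e.
  move=> ed xd; have [y [[cy y0 dy] yP]] := GP e x ed xd.
  have [] := yP 1; rewrite ?ler01 ?lexx // scale1r => -> _.
  rewrite -y0; apply: (@constant_velocity r (fun t => y t *m W)).
    by move=> t; apply: continuous_mulmx; [exact: cy|exact: cst_continuous].
  move=> t ti; have := is_derive_mulmx (dy t ti) (is_derive_cst W t 1).
  rewrite mulmx0 addr0 -mulmxA ZW ?mulmx1 //.
  apply: KU; apply: oball_cball; apply: (yP t _).2.
  by case/andP: ti => /ltW -> /ltW ->.
have Grev (e : 'rV[R]_r) x : `|e| < d -> oball p d x -> oball p d (G e x) -> G (- e) (G e x) = x.
  move=> ed xd Gd; have [y [ys yP]] := GP e x ed xd.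
  have [] := yP 1; rewrite ?ler01 ?lexx // scale1r => Gy _.
  have := uniq (- e) (G e x) (fun t => y (1 - t)).
  rewrite subrr; have [_ -> _] := ys => H; apply/esym; apply: H => //.
  - by rewrite normrN.
  - rewrite Gy; have -> : (fun x0 => - e *m Z x0) = (fun x0 => - (e *m Z x0)).
      by apply/funext => w; rewrite mulNmx.
    exact: (@solves_rev R n (fun x0 => e *m Z x0) x y ys).
  - move=> t /andP[t0 t1]; apply: oball_cball; apply: (yP _ _).2.
    by rewrite subr_ge0 t1 /= gerBl.
(* Shrinking to [d1] keeps the end points of the flow inside the [d]-ball, where [Grev] can flow
   them back. *)
have [d1 /= d10 Gd1] : exists2 d1 : R, 0 < d1 &
    oball (row_mx 0 p) d1 `<=` [set z : 'rV[R]_(r + n) | oball p d (G (lsubmx z) (rsubmx z))].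
  apply: nbhs_oball.
  have Dp : D (row_mx 0 p) by apply: inD; rewrite ?normr0 //; exact: oball_center.
  have := Cmx_continuous (CG 0%N) Dp; apply.
  rewrite row_mxKl row_mxKr G0; last exact: oball_center.
  exact: nbhs_oballW.
pose dd := Num.min d1 d.
have dd0 : 0 < dd by rewrite lt_min d10.
have ddd1 : dd <= d1 by rewrite ge_min lexx.
have ddd : dd <= d by rewrite ge_min lexx orbT.
have Gdd (e : 'rV[R]_r) x : `|e| < dd -> oball p dd x -> oball p d (G e x).
  move=> ed xd; have := Gd1 (row_mx e x); rewrite /= row_mxKl row_mxKr; apply.
  rewrite /oball /= row_mxB subr0.
  by apply: norm_row_mx_lt => //; apply: lt_le_trans ddd1.
pose B := box p W F dd.
(* [psi] reads the elapsed flow from the [W]-coordinates, flows back to the slice, and returns along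
   the straight ray in the direction [F]; [phi] does the opposite. *)
pose psi x := G (- ((x - p) *m W)) x + ((x - p) *m W) *m F.
pose phi y := G ((y - p) *m W) (y - ((y - p) *m W) *m F).
pose O1 : set 'rV[R]_n := [set x | oball p d x /\ `|(x - p) *m W| < d].
pose O := O1 `&` psi @^-1` B.
have oO1 : open O1.
  by apply: openI; [exact: oball_open|exact: open_subW].
have CpW k V : open V -> Cmx k V (fun x => (x - p) *m W).
  move=> oV; apply: CmxM => //; last exact: Cmx_cst.
  by apply: CmxB => //; [exact: Cmx_id|exact: Cmx_cst].
have Cpsi k : Cmx k O1 psi.
  apply: CmxD => //; last first.
    by apply: CmxM => //; [exact: CpW|exact: Cmx_cst].
  apply: (@Cmx_ext _ _ _ _ oO1 _ _ ((fun z => G (lsubmx z) (rsubmx z)) \o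
     (fun x => row_mx (- ((x - p) *m W)) x))).
    by move=> x _; rewrite /= row_mxKl row_mxKr.
  apply: (Cmx_comp oO1 oD _ (CG k)).
    by move=> x [x1 x2]; apply: inD => //; rewrite normrN.
  by apply: Cmx_row; [apply: CmxN => //; exact: CpW|exact: Cmx_id].
have oB : open B by exact: box_open.
have BD y : B y -> `|(y - p) *m W| < d /\ oball p d (y - ((y - p) *m W) *m F).
  by move=> [y1 y2]; split; apply: lt_le_trans ddd.
have Cphi k : Cmx k B phi.
  apply: (@Cmx_ext _ _ _ _ oB _ _ ((fun z => G (lsubmx z) (rsubmx z)) \o
     (fun y => row_mx ((y - p) *m W) (y - ((y - p) *m W) *m F)))).
    by move=> x _; rewrite /= row_mxKl row_mxKr.
  apply: (Cmx_comp oB oD _ (CG k)).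
    by move=> x /BD [x1 x2]; apply: inD.
  apply: Cmx_row; first exact: CpW.
  apply: CmxB => //; first exact: Cmx_id.
  by apply: CmxM => //; [exact: CpW|exact: Cmx_cst].
have oO : open O.
  rewrite openE => x [h1 h2]; apply: filterI; first by apply: open_near.
  by apply: (Cmx_continuous (Cpsi 0%N) h1); exact: open_near.
have phiP y : B y -> [/\ oball p d (phi y), (phi y - p) *m W = (y - p) *m W &
    psi (phi y) = y].
  move=> By; have [y1 y2] := By; have [y3 y4] := BD y By.
  have [_ pW] := box_proj FW By.
  have E : (phi y - p) *m W = (y - p) *m W.
    by rewrite mulmxBl GW // pW addrC addKr.
  have Gd := Gdd _ _ y2 y1.
  split=> //; rewrite /psi E [G _ (phi y)]Grev //.
  by rewrite subrK.
have psiP x : O x -> (psi x - p) *m W = (x - p) *m W /\ phi (psi x) = x.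
  move=> [[x1 x2] Bx].
  have x2' : `|- ((x - p) *m W)| < d by rewrite normrN.
  have E : (psi x - p) *m W = (x - p) *m W.
    rewrite /psi mulmxBl mulmxDl GW // -(mulmxA _ F W) FW mulmx1 addrNK.
    by rewrite mulmxBl.
  split=> //; rewrite /phi E /psi addrK.
  rewrite -{1}[(x - p) *m W]opprK Grev //.
  have [_ h] := BD _ Bx; move: h; rewrite E /psi addrK.
  by [].
have phiE y : B y -> y *m W = p *m W -> phi y = y.
  move=> By yp; have E : (y - p) *m W = 0 by rewrite mulmxBl yp subrr.
  rewrite /phi E mul0mx subr0 G0 //.
  by have [_] := BD y By; rewrite E mul0mx subr0.
have line (e : 'rV[R]_r) q (t : R) : `|e| < dd -> oball p dd q -> q *m W = p *m W ->
   0 < t < 1 -> e *m F *m jacobian phi (q + t *: (e *m F)) = e *m Z (phi (q + t *: (e *m F))).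
  move=> ed qd qW ti.
  have lW (s : R) : (q + s *: (e *m F) - p) *m W = s *: e.
    by rewrite mulmxBl mulmxDl qW -scalemxAl -mulmxA FW mulmx1 addrAC subrr add0r.
  have lB (s : R) : 0 <= s <= 1 -> B (q + s *: (e *m F)).
    move=> /andP[s0 s1]; split; rewrite lW.
      by rewrite -scalemxAl addrK.
    by rewrite normrZ ger0_norm //; apply: le_lt_trans ed; rewrite ler_piMl.
  have ed' := lt_le_trans ed ddd; have qd' : oball p d q by exact: lt_le_trans qd ddd.
  have [y [[cy y0 dy] yP]] := GP e q ed' qd'.
  have phiy (s : R) : 0 <= s <= 1 -> phi (q + s *: (e *m F)) = y s.
    by move=> si; rewrite /phi lW -scalemxAl addrK; exact: (yP s si).1.
  have ti' : 0 <= t <= 1 by case/andP: ti => /ltW -> /ltW ->.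
  have d2 : is_derive t 1 (fun s => phi (q + s *: (e *m F)))
      (e *m F *m jacobian phi (q + t *: (e *m F))).
    by apply/is_derive_line; exact: is_derive_jacobian oB (Cphi 1%N) (lB t ti').
  have d3 : is_derive t 1 (fun s => phi (q + s *: (e *m F))) (e *m Z (y t)).
    apply: near_eq_is_derive (dy t ti).
    apply: filterS (near_itv01 ti) => s /andP[/ltW s0 /ltW s1].
    by apply/esym/phiy; rewrite s0 s1.
  have [_ e2] := d2; have [_ e3] := d3; rewrite phiy //.
  exact: etrans (esym e2) e3.
exists dd, O, psi, phi; split.
- split=> //.
    split; first by split; [exact: oball_center|rewrite subrr mul0mx normr0].
    rewrite /= /psi subrr mul0mx oppr0 mul0mx addr0 G0; last exact: oball_center.
    exact: box_center.
  by move=> x [[xd _] _]; apply: KU; apply: oball_cball; apply: lt_le_trans drho.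
- split=> //.
  + by move=> x Ox; split; [case: Ox|exact: (psiP x Ox).2].
  + move=> y By; have [h1 h2 h3] := phiP y By; split=> //; split.
      by split=> //; rewrite h2; exact: (BD y By).1.
    by rewrite /= h3.
  + by move=> k; split=> //; apply: Cmx_sub (Cpsi k) => x [].
- by move=> x Ox; have [] := psiP x Ox; rewrite !mulmxBl => /addIr.
- move=> x [[xd _] _] xW; rewrite /psi mulmxBl xW subrr oppr0 mul0mx addr0.
  exact: G0.
split.
- move=> y By; have [y1 y2] := By.
  set e := (y - p) *m W; set q := y - e *m F.
  have [_ qW] := box_proj FW By.
  have yE : y = q + e *m F by rewrite subrK.
  (* [line] only covers parameters strictly between 0 and 1. On a slightly longer ray, [y] sits at
     the parameter [s^-1]. *)
  have [s s1 sd] : exists2 s : R, 1 < s & `|s *: e| < dd.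
    have e1 : 0 < `|e| + 1 by rewrite ltr_wpDl.
    exists (1 + (dd - `|e|) / (`|e| + 1)).
      by rewrite ltrDl divr_gt0 // subr_gt0.
    have s0 : 0 < (dd - `|e|) / (`|e| + 1) by rewrite divr_gt0 // subr_gt0.
    rewrite normrZ ger0_norm; last by rewrite addr_ge0 // ltW.
    rewrite mulrDl mul1r -ltrBrDl mulrAC ltr_pdivrMr // mulrDr mulr1.
    by rewrite ltrDl subr_gt0.
  have s0 : 0 < s by apply: lt_trans s1.
  have := line (s *: e) q s^-1 sd y1 qW.
  rewrite -scalemxAl scalerA mulVf ?lt0r_neq0 // scale1r -yE.
  rewrite invr_gt0 s0 invf_lt1 // s1 => /(_ isT).
  rewrite -!scalemxAl => /(congr1 (fun v => s^-1 *: v)).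
  by rewrite !scalerA mulVf ?lt0r_neq0 // !scale1r.
- move=> y By yW; apply/row_matrixP => i.
  have yd : oball p dd y.
    by have [+ _] := By; rewrite mulmxBl yW subrr mul0mx subr0.
  rewrite -[in RHS](phiE y By yW) !row_mul.
  pose e : 'rV[R]_r := (dd / 2) *: delta_mx 0 i.
  have d20 : 0 < dd / 2 by rewrite divr_gt0.
  have ed : `|e| < dd.
    rewrite normrZ ger0_norm; last exact: ltW.
    apply: le_lt_trans (_ : _ <= dd / 2) _; last by rewrite ltr_pdivrMr // ltr_pMr // ltr1n.
    rewrite ler_piMr //; first exact: ltW.
    apply: mx_norm_le => // a b; rewrite !mxE.
    by case: (_ && _); rewrite ?normr1 ?normr0.
  (* A point of the slice is the start of its rays, which [line] does not reach; the identity is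
     extended to [t = 0] by continuity. The factor [dd / 2] in [e] only brings the ray into the
     box. *)
  pose w (t : R) := e *m F *m jacobian phi (y + t *: (e *m F)) - e *m Z (phi (y + t *: (e *m F))).
  have w0 (t : R) : 0 < t < 1 -> w t = 0.
    by move=> ti; rewrite /w line // subrr.
  have cw : {for 0, continuous w}.
    have cl : {for (0 : R), continuous (fun t : R => y + t *: (e *m F))}.
      apply: continuousD; first exact: cst_continuous.
      by apply: continuousZr_tmp; exact: cvg_id.
    have By0 : B (y + (0 : R) *: (e *m F)) by rewrite scale0r addr0.
    rewrite /w; apply: continuousB.
      apply: continuous_mulmx; first exact: cst_continuous.
      apply: (@continuous_comp _ _ _ (fun t : R => y + t *: (e *m F)) (jacobian phi)) => //.
      exact: Cmx_continuous (Cmx_jacobian oB (Cphi 1%N)) By0.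
    apply: continuous_mulmx; first exact: cst_continuous.
    apply: (@continuous_comp _ _ _ (phi \o (fun t : R => y + t *: (e *m F))) Z).
      apply: continuous_comp => //; exact: Cmx_continuous (Cphi 0%N) By0.
    apply: Cmx_continuous (CZ 0%N) _; rewrite /= scale0r addr0 phiE //.
    by apply: KU; apply: oball_cball; apply: lt_le_trans yd _; exact: le_trans drho.
  have w00 : w 0 = 0.
    apply/eqP; rewrite -normr_le0 leNgt; apply/negP => wp.
    move: cw => /cvgrPdist_lt /(_ _ wp) /nbhs_ballP [a /= a0 aP].
    pose t : R := Num.min (a / 2) (1 / 2).
    have t0 : 0 < t by rewrite lt_min !divr_gt0.
    have t1 : t < 1 by rewrite gt_min [X in _ || X]ltr_pdivrMr // mul1r ltr1n orbT.
    have := aP t; rewrite /ball /= sub0r normrN ger0_norm ?(ltW t0) //.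
    have -> : t < a by rewrite gt_min ltr_pdivrMr // ltr_pMr // ltr1n.
    by move=> /(_ isT); rewrite (w0 t) ?t0 ?t1 // subr0 ltxx.
  move: w00; rewrite /w scale0r addr0 => /eqP; rewrite subr_eq0 => /eqP.
  rewrite /e -!scalemxAl => /(congr1 (fun v => (dd / 2)^-1 *: v)).
  by rewrite !scalerA mulVf ?lt0r_neq0 // !scale1r -rowE => ->; rewrite -rowE.
Qed.

End RadialBox.

(** * Charts of manifolds *)

Section Charts.
Context {R : realType} {n : nat} {M : topologicalType} (c : chart R n M).

Definition cimg : set 'rV[R]_n := cmap c @` cdom c.

Lemma cinvP y : cimg y -> cdom c (cinv c y) /\ cmap c (cinv c y) = y.
Proof. by move=> [x cx <-]; rewrite cmapK. Qed.

Lemma cimgP x : cdom c x -> cimg (cmap c x).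
Proof. by exists x. Qed.

Lemma chart_open_img (O : set M) : open O -> open (cmap c @` (cdom c `&` O)).
Proof.
move=> oO; rewrite openE => _ [x [cx Ox] <-].
have h1 : nbhs (cmap c x) cimg.
  by apply: open_nbhs_nbhs; split; [exact: cimg_open|exact: cimgP].
have h2 : nbhs (cmap c x) (cinv c @^-1` O).
  apply: cinv_continuous; first exact: cimgP.
  by rewrite cmapK //; exact: open_nbhs_nbhs.
apply: filterS2 h1 h2 => y iy Oy; have [h3 h4] := cinvP iy.
by exists (cinv c y).
Qed.

Lemma chart_open_preimg (B : set 'rV[R]_n) : open B -> open (cdom c `&` cmap c @^-1` B).
Proof.
move=> oB; rewrite openE => x [cx Bx]; apply: filterI.
  by apply: open_nbhs_nbhs; split => //; exact: cdom_open.
by apply: cmap_continuous => //; exact: open_nbhs_nbhs.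
Qed.

Lemma chart_near (A : set M) x : cdom c x -> nbhs (cmap c x) [set y | cimg y -> A (cinv c y)] ->
  nbhs x A.
Proof.
move=> cx h; have h1 : nbhs x (cdom c) by apply: open_nbhs_nbhs; split => //; exact: cdom_open.
have h2 := cmap_continuous cx h.
by apply: filterS2 h1 h2 => z cz /= /(_ (cimgP cz)); rewrite cmapK.
Qed.

Section Straighten.
Context (O B : set 'rV[R]_n) (psi phi : 'rV[R]_n -> 'rV[R]_n).
Context (D : diffeo O B psi phi) (OI : O `<=` cimg).

Let sdom : set M := cdom c `&` cmap c @^-1` O.
Let smap := psi \o cmap c.
Let sinv := cinv c \o phi.

Let simg : smap @` sdom = B.
Proof.
have [_ _ pP qP _] := D; apply/seteqP; split.
  by move=> _ [x [cx Ox] <-]; have [] := pP _ Ox.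
move=> y /qP [Oy yE]; have [h1 h2] := cinvP (OI Oy).
by exists (cinv c (phi y)); [split=> //=; rewrite h2|rewrite /smap /= h2].
Qed.

Let sdom_open : open sdom.
Proof. by apply: chart_open_preimg; have [] := D. Qed.

Let simg_open : open (smap @` sdom).
Proof. by rewrite simg; have [] := D. Qed.

Let smap_continuous x : sdom x -> {for x, continuous smap}.
Proof.
move=> [cx Ox]; apply: continuous_comp; first exact: cmap_continuous.
by have [_ _ _ _ /(_ 0%N) [C0 _]] := D; exact: Cmx_continuous C0 Ox.
Qed.

Let sinv_continuous y : (smap @` sdom) y -> {for y, continuous sinv}.
Proof.
rewrite simg => By; have [_ _ _ qP /(_ 0%N) [_ C0]] := D.
apply: continuous_comp; first exact: Cmx_continuous C0 By.
by apply: cinv_continuous; apply: OI; have [] := qP _ By.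
Qed.

Let smapK x : sdom x -> sinv (smap x) = x.
Proof.
move=> [cx Ox]; have [_ _ pP _ _] := D; have [_ h] := pP _ Ox.
by rewrite /sinv /smap /= h cmapK.
Qed.

Definition straight_chart : chart R n M :=
  @Chart R n M sdom smap sinv sdom_open simg_open smap_continuous sinv_continuous smapK.

Lemma straight_img : cmap straight_chart @` cdom straight_chart = B.
Proof. exact: simg. Qed.

End Straighten.
End Charts.

Section ManifoldCharts.
Context {R : realType} {n : nat} {M : manifold R n}.
Implicit Types (c : chart R n M) (x : M).

Definition overlap c c' : set 'rV[R]_n := cmap c @` (cdom c `&` cdom c').

Lemma overlap_open c c' : open (overlap c c').
Proof. by apply: chart_open_img; exact: cdom_open. Qed.

Lemma transition_Cmx c c' k : atlas c -> atlas c' ->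
  Cmx k (overlap c c') (transition c c').
Proof.
by move=> ac ac'; have [/smooth_onE h _] := atlas_compatible ac ac'; exact: h.
Qed.

Lemma straight_atlas c O B psi phi (D : diffeo O B psi phi) (OI : O `<=` cimg c) :
  atlas c -> atlas (straight_chart D OI).
Proof.
move=> ac; apply: atlas_maximal => c' ac'.
have [oO oB pP qP CC] := D.
split; last rewrite setIC; apply/smooth_onE => k.
- have oS : open (overlap (straight_chart D OI) c') by exact: overlap_open.
  apply: (@Cmx_comp _ _ _ _ _ k (overlap c c') _ (transition c c') phi oS).
  + exact: overlap_open.
  + move=> _ [x [[cx Ox] c'x] <-] /=; have [_ ->] := pP _ Ox.
    by exists x.
  + exact: transition_Cmx.
  + apply: Cmx_sub (CC k).2 => _ [x [[cx Ox] c'x] <-] /=.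
    by have [] := pP _ Ox.
- have oS : open (overlap c' (straight_chart D OI)) by exact: overlap_open.
  apply: (@Cmx_comp _ _ _ _ _ k O _ psi (transition c' c) oS oO).
  + by move=> _ [x [c'x [cx Ox]] <-] /=; rewrite /transition /= cmapK.
  + exact: (CC k).1.
  + apply: Cmx_sub (transition_Cmx k ac' ac) => _ [x [c'x [cx Ox]] <-] /=.
    by exists x.
Qed.

Lemma diffeo_id (O : set 'rV[R]_n) : open O -> diffeo O O id id.
Proof. by move=> oO; split=> // k; split; exact: Cmx_id. Qed.

Lemma restrict_chart c (V : set M) : atlas c -> open V ->
  exists c', [/\ atlas c', cdom c' = cdom c `&` V, cmap c' = cmap c & cinv c' = cinv c].
Proof.
move=> ac oV.
have D := diffeo_id (@chart_open_img _ _ _ c V oV).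
have OI : cmap c @` (cdom c `&` V) `<=` cimg c by move=> _ [x [cx _] <-]; exists x.
exists (straight_chart D OI); split=> //; first exact: straight_atlas.
apply/seteqP; split=> x [cx] /=.
  move=> [z [cz Vz] e]; split=> //.
  by rewrite -(cmapK cx) -e cmapK.
by move=> Vx; split=> //; exists x.
Qed.

Definition Jt c c' x := jacobian (transition c c') (cmap c x).

Lemma jacobian_inv m (O O' : set 'rV[R]_m) (f g : 'rV[R]_m -> 'rV[R]_m) (x : 'rV[R]_m) :
  open O -> open O' -> O x -> Cmx 1 O f -> Cmx 1 O' g ->
  (forall y, O y -> O' (f y) /\ g (f y) = y) ->
  jacobian f x *m jacobian g (f x) = 1%:M.
Proof.
move=> oO oO' Ox Cf Cg fg; have [hx _] := fg x Ox.
rewrite -(jacobian_comp oO oO' Ox hx Cg Cf).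
apply: jacobian_eq.
  by apply: (differentiable_comp (C1_differentiable_rV oO Cf Ox));
     exact: C1_differentiable_rV oO' Cg hx.
move=> v; rewrite mulmx1.
apply: near_eq_is_derive (is_derive_id x v).
by apply: filterS (open_near oO Ox) => y /fg [_ /esym].
Qed.

Lemma Jt_inv c c' x : atlas c -> atlas c' -> cdom c x -> cdom c' x ->
  Jt c c' x *m Jt c' c x = 1%:M.
Proof.
move=> ac ac' cx c'x.
have := @jacobian_inv _ (overlap c c') (overlap c' c) (transition c c') (transition c' c)
  (cmap c x) (@overlap_open c c') (@overlap_open c' c) _ (transition_Cmx 1 ac ac')
  (transition_Cmx 1 ac' ac).
have -> : transition c c' (cmap c x) = cmap c' x by rewrite /transition /= cmapK.
apply; first by exists x.
by move=> _ [z [cz c'z] <-]; rewrite /transition /= !cmapK //; split=> //; exists z.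
Qed.

Lemma Jt_unit c c' x : atlas c -> atlas c' -> cdom c x -> cdom c' x ->
  Jt c c' x \in unitmx.
Proof.
move=> ac ac' cx c'x; have := Jt_inv ac ac' cx c'x.
by move: (Jt c c' x) (Jt c' c x) => A B /mulmx1_unit [].
Qed.

Variable (pi : poisson M).

Lemma bivec_change c c' x : atlas c -> atlas c' -> cdom c x -> cdom c' x ->
  bivec pi c' x = (Jt c c' x)^T *m bivec pi c x *m Jt c c' x.
Proof. by move=> ac ac' cx c'x; exact: bivec_tensor. Qed.

Lemma bivec_eqmx c c' x : atlas c -> atlas c' -> cdom c x -> cdom c' x ->
  (bivec pi c' x :=: bivec pi c x *m Jt c c' x)%MS.
Proof.
move=> ac ac' cx c'x; rewrite (bivec_change ac ac' cx c'x) -mulmxA.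
by apply: eqmxMfull; rewrite row_full_unit unitmx_tr Jt_unit.
Qed.

Lemma rank_bivec c c' x : atlas c -> atlas c' -> cdom c x -> cdom c' x ->
  \rank (bivec pi c' x) = \rank (bivec pi c x).
Proof.
move=> ac ac' cx c'x; rewrite (bivec_eqmx ac ac' cx c'x).
by rewrite mxrankMfree // row_free_unit Jt_unit.
Qed.

End ManifoldCharts.

Section SubmanifoldCharts.
Context {R : realType} {n : nat} {M : manifold R n} (S : submanifold M).
Implicit Types (c : chart R n M) (d : chart R (sdim S) S).

Lemma incl_continuous : continuous (@incl R n M S).
Proof. by have [[]] := @incl_immersion R n M S. Qed.

Definition sdomain d c : set 'rV[R]_(sdim S) := cmap d @` (cdom d `&` @incl R n M S @^-1` cdom c).

Lemma sdomain_open d c : open (sdomain d c).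
Proof.
apply: chart_open_img; apply: open_comp (cdom_open c) => x _; exact: incl_continuous.
Qed.

Lemma local_expr_Cmx d c k : atlas d -> atlas c ->
  Cmx k (sdomain d c) (local_expr (@incl R n M S) d c).
Proof.
move=> ad ac; have [[_ h] _] := @incl_immersion R n M S.
by have /smooth_onE := h d c ad ac; exact.
Qed.

Lemma tangent_free d c (y : S) : chart_at y d -> chart_at (incl y) c ->
  row_free (tangent_mx d c y).
Proof. by move=> hd hc; have [_] := @incl_immersion R n M S; exact. Qed.

Lemma rank_tangent d c (y : S) : chart_at y d -> chart_at (incl y) c ->
  \rank (tangent_mx d c y) = sdim S.
Proof. by move=> hd hc; apply/eqP; exact: tangent_free. Qed.

Lemma tangent_change d c c' (y : S) : chart_at y d -> chart_at (incl y) c ->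
  chart_at (incl y) c' ->
  tangent_mx d c' y = tangent_mx d c y *m Jt c c' (incl y).
Proof.
move=> [ad dy] [ac cy] [ac' c'y].
have U1 : sdomain d c (cmap d y) by exists y.
have U2 : sdomain d c' (cmap d y) by exists y.
have E : local_expr (@incl R n M S) d c (cmap d y) = cmap c (incl y) by rewrite /local_expr /= cmapK.
have W1 : overlap c c' (local_expr (@incl R n M S) d c (cmap d y)) by rewrite E; exists (incl y).
have C1 := local_expr_Cmx 1 ad ac.
have C2 := local_expr_Cmx 1 ad ac'.
have C3 := @transition_Cmx R n M c c' 1 ac ac'.
rewrite /tangent_mx /differential_mx /Jt -E.
rewrite -(jacobian_comp (@sdomain_open d c) (@overlap_open _ _ _ c c') U1 W1 C3 C1).
apply: jacobian_near.
- apply: filterS2 (open_near (@sdomain_open d c) U1) (open_near (@sdomain_open d c') U2).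
  move=> _ [z [dz cz] <-] _.
  by rewrite /local_expr /transition /= !cmapK.
- exact: C1_differentiable_rV (@sdomain_open d c') C2 U2.
- apply: (differentiable_comp (C1_differentiable_rV (@sdomain_open d c) C1 U1)).
  exact: C1_differentiable_rV (@overlap_open _ _ _ c c') C3 W1.
Qed.

End SubmanifoldCharts.

(** * Poisson bivectors along Hamiltonian curves *)

Section LinearOde.
Context {R : realType}.

Definition continuous01 (T : topologicalType) (f : R -> T) :=
  forall t : R, 0 <= t <= 1 -> {for t, continuous f}.

Lemma continuous01_clamp (T : topologicalType) (f : R -> T) :
  continuous01 f -> continuous (f \o clamp01).
Proof.
move=> cf t; apply: continuous_comp; first exact: continuous_clamp01.
by apply: cf; exact: clamp01_itv.
Qed.

Lemma bounded01 p q (f : R -> 'M[R]_(p, q)) : continuous01 f ->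
  exists2 C, 0 <= C & forall t : R, 0 <= t <= 1 -> `|f t| <= C.
Proof.
move=> cf.
have cw (t : R) : {for t, continuous (fun t => `|f (clamp01 t)|)}.
  apply: (@continuous_comp _ _ _ (f \o clamp01)); last exact: norm_continuous.
  exact: continuous01_clamp.
have [t0 t0i wmax] := @EVT_max R _ 0 1 ler01 (continuous_subspaceT cw).
exists (`|f (clamp01 t0)|) => // t ti.
by have := wmax t; rewrite in_itv /= clamp01_id //; exact.
Qed.

Lemma vanish01 p q (u du : R -> 'M[R]_(p, q)) (L : R) : continuous01 u ->
  (forall t : R, 0 < t < 1 -> is_derive t 1 u (du t)) ->
  (forall t : R, 0 < t < 1 -> `|du t| <= L * `|u t|) -> u 0 = 0 ->
  forall t, 0 <= t <= 1 -> u t = 0.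
Proof.
move=> cu ud ub u0 t ti.
have L0 : 0 < Num.max L 1 by rewrite lt_max ltr01 orbT.
have ti01 (s : R) : 0 < s < 1 -> 0 <= s <= 1 by case/andP => /ltW -> /ltW ->.
have := @gronwall R p q (u \o clamp01) du (Num.max L 1) 0 L0 (lexx _) _ _ _ t ti.
rewrite /= !clamp01_id ?lexx ?ler01 // u0 normr0 addr0 mulr0 mul0r => H.
apply/eqP; rewrite -normr_le0; apply: H.
- exact: continuous01_clamp.
- move=> s si; apply: near_eq_is_derive (ud s si).
  by apply: filterS (near_itv01 si) => w wi; rewrite /= clamp01_id // ti01.
- move=> s si; rewrite clamp01_id ?ti01 // addr0; apply: le_trans (ub _ si) _.
  by rewrite ler_wpM2r // le_max lexx.
Qed.

Lemma constant01 p q (u : R -> 'M[R]_(p, q)) : continuous01 u ->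
  (forall t : R, 0 < t < 1 -> is_derive t 1 u 0) ->
  forall t, 0 <= t <= 1 -> u t = u 0.
Proof.
move=> cu ud t ti; apply/eqP; rewrite -subr_eq0; apply/eqP.
refine (@vanish01 p q (fun t => u t - u 0) (fun=> 0) 0 _ _ _ _ t ti).
- by move=> s si; apply: continuousB; [exact: cu|exact: cst_continuous].
- move=> s si; have := is_deriveB (ud s si) (is_derive_cst (u 0) s 1).
  by rewrite subr0.
- by move=> s si; rewrite normr0 mul0r.
- by rewrite subrr.
Qed.

Lemma linear_ode_mx n (J : R -> 'M[R]_n) : continuous01 J ->
  exists Y : R -> 'M[R]_n, [/\ continuous01 Y, Y 0 = 1%:M &
    forall t : R, 0 < t < 1 -> is_derive t 1 Y (Y t *m J t)].
Proof.
move=> cJ; have [B B0 JB] := bounded01 cJ.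
have /choice [y yP] : forall i : 'I_n, exists y,
    solves (fun t y => y *m J (clamp01 t)) (delta_mx 0 i) y.
  move=> i; apply: (@linear_ode R n (J \o clamp01) B) => //.
    exact: continuous01_clamp.
  by move=> t; apply: JB; exact: clamp01_itv.
have yr (t : R) (i : 'I_n) : row i (\matrix_i0 y i0 t) = y i t by rewrite rowK.
exists (fun t => \matrix_i y i t); split.
- move=> t ti; apply/continuous_mxP => i j.
  rewrite (_ : (fun _ => _) = fun s => y i s 0 j).
    have [cy _ _] := yP i.
    by have := cy t; move/continuous_mxP; apply.
  by apply/funext => s; rewrite mxE.
- by apply/row_matrixP => i; rewrite yr row1; have [_ -> _] := yP i.
- move=> t ti; apply/is_derive_mxP => i j.
  have [_ _ dy] := yP i; have := dy t ti => /is_derive_mxP /(_ 0 j).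
  rewrite clamp01_id; last by case/andP: ti => /ltW -> /ltW ->.
  rewrite -(yr t i) -row_mul [row i _ 0 j]mxE.
  by congr is_derive; apply/funext => s; rewrite mxE.
Qed.

Lemma is_derive_trmx (V : normedModType R) p q (f : V -> 'M[R]_(p, q)) x v df :
  is_derive x v f df -> is_derive x v (fun y => (f y)^T) df^T.
Proof.
move=> /is_derive_mxP h; apply/is_derive_mxP => i j; rewrite mxE.
rewrite (_ : (fun y => _) = fun y => f y j i) //.
by apply/funext => y; rewrite mxE.
Qed.

Lemma continuous_trmx (T : topologicalType) p q (f : T -> 'M[R]_(p, q)) x :
  {for x, continuous f} -> {for x, continuous (fun y => (f y)^T)}.
Proof.
move=> /continuous_mxP h; apply/continuous_mxP => i j.
rewrite (_ : (fun y => _) = fun y => f y j i) //.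
by apply/funext => y; rewrite mxE.
Qed.

End LinearOde.

Section PoissonCoord.
Context {R : realType} {n : nat}.
Implicit Types (Om : set 'rV[R]_n) (P : 'rV[R]_n -> 'M[R]_n).

Definition poisson_on Om P :=
  [/\ open Om, forall k, Cmx k Om P, forall y, Om y -> (P y)^T = - P y &
    forall y, Om y ->
      let T i j k := \sum_l P y i l * partial l (fun z => P z j k) y in
      forall i j k, T i j k + T j k i + T k i j = 0].

(* The Jacobian of the vector field [a *m P] for a constant covector [a]. *)
Definition ham_jac P (a : 'rV[R]_n) y : 'M[R]_n :=
  \matrix_(l, k) \sum_i a 0 i * partial l (fun z => P z i k) y.

(* The Jacobi identity, read as a formula for the Lie derivative of the
   bivector along [a *m P]. *)
Lemma is_derive_ham Om P y a : poisson_on Om P -> Om y ->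
  is_derive y (a *m P y) P
    (P y *m ham_jac P a y + (ham_jac P a y)^T *m P y).
Proof.
move=> [oO CP skew jac] Oy; apply/is_derive_mxP => j k.
have dP j0 k0 : differentiable (fun z => P z j0 k0) y.
  exact: C1_differentiable oO (CP 1%N j0 k0) Oy.
have := is_derive_comp_partial (is_derive_id y (a *m P y)) (dP j k).
congr is_derive.
have sk l i k0 : partial l (fun z => P z i k0) y = - partial l (fun z => P z k0 i) y.
  rewrite /partial -deriveN; last exact: diff_derivable.
  apply: near_eq_derive; apply: filterS (open_near oO Oy) => z /skew /matrixP /(_ k0 i).
  by rewrite !mxE.
have sP i k0 : P y i k0 = - P y k0 i.
  by have := skew y Oy; move=> /matrixP /(_ k0 i); rewrite !mxE.
have {}jac := jac y Oy; rewrite /= in jac.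
have E i : \sum_l P y i l * partial l (fun z => P z j k) y =
    \sum_l P y j l * partial l (fun z => P z i k) y +
    \sum_l P y l k * partial l (fun z => P z i j) y.
  have := jac i j k.
  rewrite -addrA => /eqP; rewrite addr_eq0 => /eqP ->.
  rewrite opprD -!sumrN; congr (_ + _); apply: eq_bigr => l _.
    by rewrite (sk l k i) mulrN opprK.
  by rewrite (sP k l) mulNr opprK.
rewrite !mxE.
transitivity (\sum_i a 0 i * \sum_l P y i l * partial l (fun z => P z j k) y).
  under [RHS]eq_bigr do rewrite mulr_sumr.
  rewrite exchange_big /=; apply: eq_bigr => l _.
  by rewrite mxE mulr_suml; apply: eq_bigr => i _; rewrite mulrA.
under eq_bigr do rewrite E mulrDr.
rewrite big_split /=; congr (_ + _).
  under eq_bigr do rewrite mulr_sumr.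
  rewrite exchange_big /=; apply: eq_bigr => l _.
  by rewrite mxE mulr_sumr; apply: eq_bigr => i _; rewrite mulrCA.
under eq_bigr do rewrite mulr_sumr.
rewrite exchange_big /=; apply: eq_bigr => l _.
rewrite !mxE mulr_suml; apply: eq_bigr => i _.
by rewrite mulrCA mulrC.
Qed.

(** The derivative of [P] along a curve depends only on the velocity at that instant, so the formula
    for a constant covector applies to a time-dependent one, with [a] its value at time [t]. *)
Lemma is_derive_ham_curve Om P (x : R -> 'rV[R]_n) t a : poisson_on Om P -> Om (x t) ->
  is_derive t 1 x (a *m P (x t)) ->
  is_derive t 1 (P \o x)
    (P (x t) *m ham_jac P a (x t) + (ham_jac P a (x t))^T *m P (x t)).
Proof.
move=> PO Oy dx; have [oO CP _ _] := PO.
apply/is_derive_mxP => j k.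
have := is_derive_comp_partial dx (C1_differentiable oO (CP 1%N j k) Oy).
congr is_derive.
have dP : differentiable (fun z => P z j k) (x t).
  exact: C1_differentiable oO (CP 1%N j k) Oy.
have [_ h2] := is_derive_comp_partial (is_derive_id (x t) (a *m P (x t))) dP.
have /is_derive_mxP /(_ j k) [_ h1] := is_derive_ham a PO Oy.
by rewrite -h1 -h2.
Qed.

(* [Y] solves [Y' = Y B] with [B] the Jacobian of the Hamiltonian vector field,
   and [Phi] is its inverse. *)
Lemma transport Om P (x a : R -> 'rV[R]_n) : poisson_on Om P ->
  (forall t : R, 0 <= t <= 1 -> Om (x t)) -> continuous01 x -> continuous01 a ->
  (forall t : R, 0 < t < 1 -> is_derive t 1 x (a t *m P (x t))) ->
  exists Y Phi : R -> 'M[R]_n,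
  [/\ continuous01 Phi, Phi 0 = 1%:M,
    forall t : R, 0 < t < 1 ->
      is_derive t 1 Phi (- (ham_jac P (a t) (x t) *m Phi t)),
    forall t : R, 0 <= t <= 1 -> Y t *m Phi t = 1%:M &
    forall t : R, 0 <= t <= 1 -> P (x t) = (Y t)^T *m P (x 0) *m Y t].
Proof.
move=> PO Ox cx ca dx; have [oO CP skew jac] := PO.
pose B t := ham_jac P (a t) (x t).
have cB : continuous01 B.
  move=> t ti; apply/continuous_mxP => l k.
  rewrite (_ : (fun _ => _) = fun t => \sum_i a t 0 i * partial l (fun z => P z i k) (x t)); last first.
    by apply/funext => s; rewrite mxE.
  apply: (continuous_sum (F := fun i t => a t 0 i * partial l (fun z => P z i k) (x t))) => i.
  apply: continuousM; first by have := ca t ti; move/continuous_mxP; apply.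
  apply: (@continuous_comp _ _ _ x (partial l (fun z => P z i k))); first exact: cx.
  by apply: (((CP 1%N i k).2 l).2).1; exact: Ox.
have [Y [cY Y0 dY]] := linear_ode_mx cB.
have [|Psi [cPsi Psi0 dPsi]] := @linear_ode_mx R n (fun t => - (B t)^T).
  move=> t ti; apply: continuousN; apply: continuous_trmx; exact: cB.
have [b b0 Bb] := bounded01 cB.
have ti01 (s : R) : 0 < s < 1 -> 0 <= s <= 1 by case/andP => /ltW -> /ltW ->.
exists Y, (fun t => (Psi t)^T); split.
- by move=> t ti; apply: continuous_trmx; exact: cPsi.
- by rewrite Psi0 trmx1.
- move=> t ti; have := is_derive_trmx (dPsi t ti).
  by rewrite trmx_mul linearN /= trmxK mulNmx.
- move=> t ti; have := @constant01 R n n (fun t => Y t *m (Psi t)^T) _ _ t ti.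
  rewrite Y0 Psi0 trmx1 mulmx1; apply.
    by move=> s si; apply: continuous_mulmx; [exact: cY|apply: continuous_trmx; exact: cPsi].
  move=> s si; have := is_derive_mulmx (dY s si) (is_derive_trmx (dPsi s si)).
  by rewrite trmx_mul linearN /= trmxK mulNmx mulmxN mulmxA subrr.
- move=> t ti; apply/eqP; rewrite -subr_eq0; apply/eqP.
  (* The defect of the transport formula solves a homogeneous linear equation and vanishes at time
     0. *)
  pose u t := P (x t) - (Y t)^T *m P (x 0) *m Y t.
  refine (@vanish01 R n n u (fun t => u t *m B t + (B t)^T *m u t) (n%:R * b + n%:R * b) _ _ _ _ t ti).
  + move=> s si; apply: continuousB.
      apply: (@continuous_comp _ _ _ x P); first exact: cx.
      by apply: Cmx_continuous (CP 0%N) _; exact: Ox.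
    apply: continuous_mulmx; last exact: cY.
    apply: continuous_mulmx; last exact: cst_continuous.
    by apply: continuous_trmx; exact: cY.
  + move=> s si.
    have d1 := is_derive_ham_curve PO (Ox s (ti01 s si)) (dx s si).
    have d2 := is_derive_mulmx (is_derive_trmx (dY s si)) (is_derive_cst (P (x 0)) s 1).
    have d3 := is_derive_mulmx d2 (dY s si).
    have := is_deriveB d1 d3.
    congr is_derive; rewrite -/(B s) /u mulmx0 addr0 trmx_mul.
    rewrite mulmxBl mulmxBr !mulmxA.
    move: (P (x s) *m B s) (_ *m P (x s)) (_ *m Y s) (_ *m B s) => *.
    by apply/matrixP => ? ?; rewrite !mxE; ring.
  + move=> s si; have si' := ti01 s si.
    apply: le_trans (ler_normD _ _) _; rewrite mulrDl; apply: lerD.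
      apply: le_trans (norm_mulmx _ _) _; rewrite mulrAC ler_wpM2r //.
      by rewrite ler_wpM2l //; exact: Bb.
    apply: le_trans (norm_mulmx _ _) _; rewrite ler_wpM2r //.
    rewrite ler_wpM2l //; apply: le_trans (Bb s si').
    by apply: mx_norm_le => // i j; rewrite mxE; exact: ler_mxE.
  + by rewrite /u Y0 trmx1 mulmx1 mul1mx subrr.
Qed.

Lemma rank_transport Om P (x a : R -> 'rV[R]_n) : poisson_on Om P ->
  (forall t : R, 0 <= t <= 1 -> Om (x t)) -> continuous01 x -> continuous01 a ->
  (forall t : R, 0 < t < 1 -> is_derive t 1 x (a t *m P (x t))) ->
  forall t : R, 0 <= t <= 1 -> \rank (P (x t)) = \rank (P (x 0)).
Proof.
move=> PO Ox cx ca dx t ti.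
have [Y [Phi [_ _ _ YPhi ->]]] := transport PO Ox cx ca dx; last exact: ti.
have [Yu _] := mulmx1_unit (YPhi t ti).
rewrite mxrankMfree ?row_free_unit // -mxrank_tr trmx_mul trmxK.
by rewrite mxrankMfree ?row_free_unit // mxrank_tr.
Qed.

End PoissonCoord.

(** * Rank factorisations *)

Section LinearAlgebra.
Context {F : fieldType}.

(** [A] is a right inverse of the row factor of [P]. By skew-symmetry the transposed column factor
    has the same row space as [P], so [A^T] pairs it nondegenerately too. *)
Lemma skew_minor n (P : 'M[F]_n) : P^T = - P ->
  exists A : 'M[F]_(n, \rank P), A^T *m P *m A \in unitmx.
Proof.
move=> sP; have /row_freeP [A SA] := row_base_free P.
exists A; have -> : A^T *m P *m A = A^T *m col_base P.
  transitivity (A^T *m (col_base P *m row_base P) *m A); first by rewrite mulmx_base.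
  by rewrite mulmxA -(mulmxA _ (row_base P)) SA mulmx1.
have BT : (col_base P)^T = - (A^T *m col_base P) *m row_base P.
  have -> : (col_base P)^T = (row_base P *m A)^T *m (col_base P)^T.
    by rewrite SA trmx1 mul1mx.
  rewrite trmx_mul -mulmxA -trmx_mul mulmx_base sP mulNmx -mulmxA mulmx_base.
  by rewrite mulmxN.
rewrite -row_free_unit -row_leq_rank.
have h : \rank (col_base P)^T = \rank P by rewrite mxrank_tr; apply/eqP; exact: col_base_full.
by rewrite -{1}h BT mulNmx mxrank_opp mxrankM_maxl.
Qed.

(** Rank-nullity, as the kernel of the quotient map is the row space of [T]. Coregularity thereby
    becomes a statement on the dimension of the image of [pi^sharp] plus the tangent space. *)
Lemma rank_coker m n d (P : 'M[F]_(m, n)) (T : 'M[F]_(d, n)) :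
  (\rank (P *m cokermx T) + \rank T)%N = \rank (P + T)%MS.
Proof.
have kT : (kermx (cokermx T) :=: T)%MS.
  apply/eqmxP/andP; split; last by apply/sub_kermxP; rewrite mulmx_coker.
  by rewrite submxE mulmx_ker.
have h1 := mxrank_mul_ker P (cokermx T).
have h2 := mxrank_sum_cap P T.
have h3 : \rank (P :&: kermx (cokermx T))%MS = \rank (P :&: T)%MS.
  by rewrite (cap_eqmx (eqmx_refl P) kT).
by rewrite h3 in h1; apply: (@addIn (\rank (P :&: T))); rewrite addnAC h1 h2.
Qed.

(** In the full-rank factorisation of [P *m cokermx T], [a] is a left inverse of the column factor;
    [W] is the quotient map followed by a right inverse of the row factor, hence vanishes on [T]. *)
Lemma coker_frame m n d (P : 'M[F]_(m, n)) (T : 'M[F]_(d, n)) r :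
  \rank (P *m cokermx T) = r ->
  exists (a : 'M[F]_(r, m)) (W : 'M[F]_(n, r)), T *m W = 0 /\ a *m P *m W = 1%:M.
Proof.
move=> <-; set Q := P *m cokermx T.
have /row_freeP [b Sb] := row_base_free Q.
have /row_fullP [a aB] := col_base_full Q.
exists a, (cokermx T *m b); split; first by rewrite mulmxA mulmx_coker mul0mx.
transitivity (a *m (col_base Q *m row_base Q) *m b).
  by rewrite mulmx_base /Q !mulmxA.
by rewrite mulmxA aB mul1mx.
Qed.

(** The rows of [A^T *m P] already span the row space of [P], so [P = D *m (A^T *m P)], and
    multiplying by [A] determines [D]: the Schur complement of the minor vanishes. *)
Lemma rank_schur n k (P : 'M[F]_n) (A : 'M[F]_(n, k)) : A^T *m P *m A \in unitmx ->
  \rank P = k -> P = P *m A *m invmx (A^T *m P *m A) *m A^T *m P.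
Proof.
move=> Cu rP.
have rAP : \rank (A^T *m P) = k.
  apply/eqP; rewrite eqn_leq rank_leq_row /=.
  by rewrite -{1}(mxrank_unit Cu) mxrankM_maxl.
have sub : (P <= A^T *m P)%MS.
  have s1 : (A^T *m P <= P)%MS by exact: submxMl.
  by have := mxrank_leqif_sup s1 => /geq_leqif; rewrite rAP rP leqnn => <-.
have /submxP [D PD] := sub.
rewrite [in X in _ = X *m A *m _ *m _ *m _]PD.
by rewrite -(mulmxA D (A^T *m P) A) mulmxK // -mulmxA -PD.
Qed.

End LinearAlgebra.

Lemma is_derive_Cmx (R : realType) n p q (U : set 'rV[R]_n)
    (Z : 'rV[R]_n -> 'M[R]_(p, q)) y v : open U -> Cmx 1 U Z -> U y ->
  is_derive y v Z (\matrix_(i, k) \sum_l v 0 l * partial l (fun z => Z z i k) y).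
Proof.
move=> oU CZ Uy; apply/is_derive_mxP => i k; rewrite mxE.
exact: is_derive_comp_partial (is_derive_id y v) (C1_differentiable oU (CZ i k) Uy).
Qed.

Lemma is_derive_affine (R : realType) (V : normedModType R) (u v : V) (t : R) :
  is_derive t 1 (fun t : R => u + t *: v) v.
Proof. by apply: (proj2 (is_derive_line id _ _ _ _)); exact: is_derive_id. Qed.

Lemma is_derive_scale (R : realType) (V : normedModType R) (v : V) (t : R) :
  is_derive t 1 (fun t : R => t *: v) v.
Proof.
have := is_derive_affine 0 v t; congr is_derive.
by apply/funext => s; rewrite add0r.
Qed.

(** * Poisson bivectors in a box filled by Hamiltonian rays *)

Section PoissonBoxes.
Context {R : realType} {r n : nat}.
Variables (p : 'rV[R]_n) (W : 'M[R]_(n, r)) (F : 'M[R]_(r, n)) (d : R).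
Variables (P : 'rV[R]_n -> 'M[R]_n) (Ah : 'rV[R]_n -> 'M[R]_(r, n)).
Hypothesis FW : F *m W = 1%:M.
Notation Om := (box p W F d).
Hypothesis PO : poisson_on Om P.
Hypothesis CAh : forall k, Cmx k Om Ah.
Hypothesis radial : forall y, Om y ->
  ((y - p) *m W) *m F = ((y - p) *m W) *m Ah y *m P y.

(** The product rule for [e *m Ah *m P]: the derivative of the covector contributes a combination of
    rows of [P], the rest is the Jacobian with frozen covector. The radial identity supplies [D], so
    this Jacobian is known modulo the rows of [P], which is enough on columns killed by [P]. *)
Lemma ham_jacE (e : 'rV[R]_r) y v D : Om y ->
  is_derive y v (fun z => e *m Ah z *m P z) D ->
  exists b : 'rV[R]_n, v *m ham_jac P (e *m Ah y) y = D - b *m P y.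
Proof.
move=> Oy [_ dD]; have [oO CP _ _] := PO.
have Ca : Cmx 1 Om (fun z => e *m Ah z) by apply: CmxM => //; exact: Cmx_cst.
exists (v *m jacobian (fun z => e *m Ah z) y).
have [_ h] := is_derive_mulmx (is_derive_jacobian v oO Ca Oy) (is_derive_Cmx v oO (CP 1%N) Oy).
rewrite -dD h addrC addKr; apply/rowP => k; rewrite !mxE.
under eq_bigr do rewrite mxE mulr_sumr.
rewrite exchange_big /=; apply: eq_bigr => i _.
by rewrite mxE mulr_sumr; apply: eq_bigr => l _; rewrite mulrCA.
Qed.

Section Ray.
Variable y : 'rV[R]_n.
Hypothesis Oy : Om y.
Let e := (y - p) *m W.
Let q := y - e *m F.
Let x (t : R) := q + t *: (e *m F).

Lemma ray_in (t : R) : 0 <= t <= 1 -> Om (x t).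
Proof.
by move=> /andP[t0 t1]; apply: box_line => //; rewrite ger0_norm.
Qed.

Lemma ray_W (v : 'rV[R]_n) (t : R) (e' : 'rV[R]_r) : v *m W = 0 ->
  (q + v + t *: (e' *m F) - p) *m W = t *: e'.
Proof.
move=> vW; have qW : q *m W = p *m W := (box_proj FW Oy).2.
rewrite mulmxBl (mulmxDl (q + v)) (mulmxDl q) vW addr0 qW -scalemxAl -mulmxA FW mulmx1.
by rewrite addrAC subrr add0r.
Qed.

Lemma continuous_line (u v : 'rV[R]_n) : continuous (fun t : R => u + t *: v).
Proof.
move=> t; suff : {for t, continuous (fun t : R => u + t *: v)} by [].
apply: continuousD; first exact: cst_continuous.
by apply: continuousZr_tmp; exact: cvg_id.
Qed.

Lemma radial_scale z (t : R) (e' : 'rV[R]_r) : Om z -> t != 0 ->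
  (z - p) *m W = t *: e' -> e' *m F = e' *m Ah z *m P z.
Proof.
move=> Oz t0 zW; have := radial Oz; rewrite zW.
rewrite -!scalemxAl => /(congr1 (fun v => t^-1 *: v)).
by rewrite !scalerA mulVf // !scale1r.
Qed.

Lemma ray_ham (t : R) : 0 < t < 1 -> is_derive t 1 x (e *m Ah (x t) *m P (x t)).
Proof.
move=> /andP[t0 t1]; have ti : 0 <= t <= 1 by rewrite !ltW.
rewrite -(@radial_scale (x t) t e (ray_in ti)) ?lt0r_neq0 //.
  exact: is_derive_affine.
by have := @ray_W 0 t e (mul0mx _ _); rewrite addr0.
Qed.

Lemma ray_cont : continuous01 x.
Proof. by move=> t _; exact: continuous_line. Qed.

Lemma ray_cov_cont : continuous01 (fun t => e *m Ah (x t)).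
Proof.
move=> t ti; apply: continuous_mulmx; first exact: cst_continuous.
apply: (@continuous_comp _ _ _ x Ah); first exact: ray_cont.
have [oO _ _ _] := PO.
exact: Cmx_continuous (CAh 0%N) (ray_in ti).
Qed.

Lemma ray_rank : \rank (P y) = \rank (P q).
Proof.
have := rank_transport PO ray_in ray_cont ray_cov_cont ray_ham (t := 1).
rewrite ler01 lexx => /(_ isT).
by rewrite /x scale1r scale0r addr0 subrK.
Qed.

(* Both [Ex *m Phi *m K] and [t *: F *m Phi *m K] are constant along the ray;
   at its end [Phi *m K] and [K] therefore have the same column space, on which
   [P] vanishes by transport. *)
Lemma ray_poisson m (Ex : 'M[R]_(m, n)) (K : 'M[R]_n) : Ex *m W = 0 ->
  Ex *m K = 0 -> F *m K = 0 ->
  (forall C : 'M[R]_n, Ex *m C = 0 -> F *m C = 0 -> C = K *m C) ->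
  P q *m K = 0 -> P y *m K = 0.
Proof.
move=> ExW ExK FK Kmax PqK.
have [Y [Phi [cPhi Phi0 dPhi YPhi PY]]] := transport PO ray_in ray_cont ray_cov_cont ray_ham.
have [oO CP _ _] := PO.
have x0 : x 0 = q by rewrite /x scale0r addr0.
have x1 : x 1 = y by rewrite /x scale1r subrK.
have ti01 (s : R) : 0 < s < 1 -> 0 <= s <= 1 by case/andP => /ltW -> /ltW ->.
have PPhi t : 0 <= t <= 1 -> P (x t) *m Phi t *m K = 0.
  move=> ti; rewrite PY // x0 -(mulmxA _ (Y t)) YPhi // mulmx1 -mulmxA PqK.
  by rewrite mulmx0.
pose B t := ham_jac P (e *m Ah (x t)) (x t).
have dPhiK (s : R) : 0 < s < 1 -> is_derive s 1 (fun t => Phi t *m K) (- (B s *m Phi s *m K)).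
  move=> si; have := is_derive_mulmx (dPhi s si) (is_derive_cst K s 1).
  by rewrite mulmx0 addr0 mulNmx.
have cPhiK : continuous01 (fun t => Phi t *m K).
  by move=> s si; apply: continuous_mulmx; [exact: cPhi|exact: cst_continuous].
have nearOm (s : R) (v : 'rV[R]_n) : 0 <= s <= 1 -> \forall t \near (0 : R), Om (x s + t *: v).
  move=> si; apply: (@continuous_line (x s) v 0).
  by rewrite scale0r addr0; apply: open_near => //; exact: ray_in.
have z1 : Ex *m (Phi 1 *m K) = 0.
  have H := @constant01 R m n (fun t => Ex *m (Phi t *m K)).
  have -> : Ex *m (Phi 1 *m K) = Ex *m (Phi 0 *m K).
    apply: H; last by rewrite lexx ler01.
      by move=> s si; apply: continuous_mulmx; [exact: cst_continuous|exact: cPhiK].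
    move=> s si; have := is_derive_mulmx (is_derive_cst Ex s 1) (dPhiK s si).
    rewrite mul0mx add0r mulmxN.
    suff -> : Ex *m (B s *m Phi s *m K) = 0 by rewrite oppr0.
    apply/row_matrixP => i; rewrite row0 row_mul; set v := row i Ex.
    have vW : v *m W = 0 by rewrite -row_mul ExW row0.
    have Oxs := ray_in (ti01 s si).
    (* A displacement with [v *m W = 0] does not change the ray parameter, so the field stays equal
       to [e *m F] along it, and [D] is 0. *)
    have [|b bE] := @ham_jacE e (x s) v 0 Oxs.
      have xs0 : x s = x s + 0 *: v by rewrite scale0r addr0.
      rewrite [X in is_derive X]xs0; apply/is_derive_line.
      apply: (@near_eq_is_derive _ _ _ (fun=> e *m F)).
        have := nearOm s v (ti01 s si); apply: filterS => t Ot.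
        apply: (@radial_scale _ s) => //; first by case/andP: si => /lt0r_neq0.
        have := @ray_W (t *: v) s e; rewrite -scalemxAl vW scaler0 => /(_ erefl).
        by rewrite (_ : x s + t *: v = q + t *: v + s *: (e *m F)) // /x addrAC.
    rewrite -(mulmxA (B s)) mulmxA bE sub0r mulNmx -mulmxA (mulmxA (P _)) PPhi ?ti01 //.
    by rewrite mulmx0 oppr0.
  by rewrite Phi0 mul1mx ExK.
have z2 : F *m (Phi 1 *m K) = 0.
  (* With the factor [t] the initial value is 0. Modulo rows of [P], [s *: D] times [B s] is [D]
     again, which cancels the term produced by differentiating [t]. *)
  have H := @constant01 R r n (fun t => (t *: F) *m (Phi t *m K)).
  suff h : (1 *: F) *m (Phi 1 *m K) = (0 *: F) *m (Phi 0 *m K).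
    by move: h; rewrite scale0r mul0mx scale1r.
  apply: H; last by rewrite lexx ler01.
    move=> s si; apply: continuous_mulmx; last exact: cPhiK.
    by apply: continuousZr_tmp; exact: cvg_id.
  move=> s si; have dF := is_derive_scale F s.
    have := is_derive_mulmx dF (dPhiK s si).
  suff -> : F *m (Phi s *m K) + s *: F *m - (B s *m Phi s *m K) = 0 by [].
  apply/row_matrixP => i; rewrite row0 linearD /= !row_mul mulmxN.
  have -> : row i (s *: F) = s *: (row i F) by apply/rowP => j; rewrite !mxE.
  set D := row i F; pose dl : 'rV[R]_r := delta_mx 0 i.
  have DE : D = dl *m F by rewrite -rowE.
  have Oxs := ray_in (ti01 s si).
  have s0 : s != 0 by case/andP: si => /lt0r_neq0.
  (* Moving by [t *: (s *: D)] from the point at time [s] changes the ray parameter from [e] to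
     [e + t *: dl]. The field for the fixed [e] is therefore the radial one minus its [dl] part. *)
  have [|b bE] := @ham_jacE e (x s) (s *: D) (D - dl *m (Ah (x s) *m P (x s))) Oxs.
    have xs0 : x s = x s + 0 *: (s *: D) by rewrite scale0r addr0.
    rewrite [X in is_derive X]xs0; apply/is_derive_line.
    pose z (t : R) := x s + t *: (s *: D).
    apply: (@near_eq_is_derive _ _ _ (fun t : R => (e *m F + t *: D) -
       (0 + t *: dl) *m (Ah (z t) *m P (z t)))).
      have := nearOm s (s *: D) (ti01 s si); apply: filterS => t Ot.
      have h : (e + t *: dl) *m F = (e + t *: dl) *m Ah (z t) *m P (z t).
        apply: (@radial_scale _ s) => //.
        have := @ray_W 0 s (e + t *: dl) (mul0mx _ _); rewrite addr0 => <-.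
        congr ((_ - _) *m _); rewrite /z /x -addrA; congr (_ + _).
        by rewrite mulmxDl scalerDr -scalemxAl DE !scalerA [t * s]mulrC.
      rewrite add0r; move: h; rewrite !mulmxDl -!scalemxAl -DE => ->.
      by rewrite mulmxA addrK.
    have CAP : Cmx 1 Om (fun y => Ah y *m P y) by exact: CmxM.
    have [DM dM] : exists DM, is_derive (0 : R) 1 (fun t => Ah (z t) *m P (z t)) DM.
      eexists; apply/(is_derive_line (fun y => Ah y *m P y)).
      by rewrite scale0r addr0; exact: is_derive_Cmx oO CAP Oxs.
    apply: is_deriveB.
      exact: is_derive_affine.
    have dl' := is_derive_affine 0 dl (0 : R).
    have := is_derive_mulmx dl' dM.
    by rewrite scale0r addr0 mul0mx addr0 /z scale0r addr0.
  rewrite -(mulmxA (B s)) (mulmxA (s *: D)) bE !mulmxBl -!mulmxA.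
  have PPhi' : P (x s) *m (Phi s *m K) = 0 by rewrite mulmxA PPhi // ti01.
  by rewrite PPhi' !mulmx0 !subr0 subrr.
pose C := Phi 1 *m K.
have CK : C = K *m C by exact: Kmax.
have i1 : 0 <= (1 : R) <= 1 by rewrite ler01 lexx.
have [_ Pu] := mulmx1_unit (YPhi 1 i1).
have sub : (C^T <= K^T)%MS by rewrite CK trmx_mul submxMl.
have rk : \rank C^T = \rank K^T.
  rewrite !mxrank_tr /C (eqmxMfull K) // row_full_unit //.
have /submxP [G GE] : (K^T <= C^T)%MS.
  by have := mxrank_leqif_sup sub => /geq_leqif; rewrite rk leqnn => <-.
have KE : K = C *m G^T by rewrite -[LHS]trmxK GE trmx_mul trmxK.
by rewrite KE mulmxA /C mulmxA -x1 PPhi // mul0mx.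
Qed.

End Ray.

Hypothesis FP : forall y, Om y -> y *m W = p *m W -> F = Ah y *m P y.

(** [y] and [y'] have the same foot [q] on the slice. The rank there is [r] by [ray_rank], so the
    row space of [P q] is that of [F]; [ray_poisson] with an empty [Ex] carries this to [y']. *)
Lemma leaf_slice y y' : Om y -> Om y' -> \rank (P y) = r ->
  (y' - y) *m (1%:M - W *m F) = 0 -> (P y' :=: F)%MS.
Proof.
move=> Oy Oy' ry yy'.
set K := 1%:M - W *m F; have FK : F *m K = 0.
  by rewrite mulmxBr mulmx1 mulmxA FW mul1mx subrr.
have qq : y' - ((y' - p) *m W) *m F = y - ((y - p) *m W) *m F.
  apply/eqP; rewrite -subr_eq0 -yy' mulmxBr mulmx1 mulmxA !mulmxBl; apply/eqP.
  move: (y' *m W *m F) (y *m W *m F) (p *m W *m F) => a b c.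
  by apply/rowP => j; rewrite !mxE; ring.
have [Oq qW] := box_proj FW Oy.
have rF : \rank F = r by apply/eqP; apply/row_freeP; exists W.
set q := y - ((y - p) *m W) *m F in qq Oq qW.
have Fq : (F <= P q)%MS by rewrite {1}(FP Oq qW) submxMl.
have rq : \rank (P q) = r by rewrite -(ray_rank Oy).
have PqF : (P q <= F)%MS.
  by have := mxrank_leqif_sup Fq => /geq_leqif; rewrite rF rq leqnn => <-.
have PqK : P q *m K = 0 by have /submxP [G ->] := PqF; rewrite -mulmxA FK mulmx0.
have PyK : P y' *m K = 0.
  apply: (@ray_poisson y' Oy' 0 0 K); rewrite ?mul0mx ?qq //.
  by move=> C _ FC; rewrite mulmxBl mul1mx -mulmxA FC mulmx0 subr0.
have PyF : (P y' <= F)%MS.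
  apply/submxP; exists (P y' *m W); move: PyK.
  by rewrite mulmxBr mulmx1 => /eqP; rewrite subr_eq0 mulmxA => /eqP.
apply/eqmxP; rewrite PyF /=.
have := mxrank_leqif_sup PyF => /geq_leqif <-.
by rewrite rF (ray_rank Oy') qq rq.
Qed.

End PoissonBoxes.

(** * Adapted charts of Poisson manifolds *)

Section PoissonCharts.
Context {R : realType} {n : nat} {M : manifold R n} (pi : poisson M).
Implicit Types (c : chart R n M).

Definition cbivec c y := bivec pi c (cinv c y).

Lemma poisson_on_chart c : atlas c -> poisson_on (cimg c) (cbivec c).
Proof.
move=> ac; split.
- exact: cimg_open.
- move=> k i j; have := bivec_smooth pi ac i k j.
  by under eq_fun do rewrite mxE.
- by move=> y /cinvP [cx _]; exact: bivec_skew.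
- move=> y /cinvP [cx yE]; have := @bivec_jacobi R n M pi (cinv c y) c (conj ac cx).
  by rewrite /= yE.
Qed.

(* The last two clauses say that the rays along [F] are Hamiltonian curves for
   the covectors [Ah], also at their starting points. *)
Definition pbox r c p (W : 'M[R]_(n, r)) (F : 'M[R]_(r, n)) d (Ah : 'rV[R]_n -> 'M[R]_(r, n)) :=
  [/\ [/\ atlas c, F *m W = 1%:M & 0 < d], cimg c = box p W F d,
      forall k, Cmx k (cimg c) Ah,
      forall y, cimg c y -> ((y - p) *m W) *m F = ((y - p) *m W) *m Ah y *m cbivec c y &
      forall y, cimg c y -> y *m W = p *m W -> F = Ah y *m cbivec c y].

(** [D = a P W] stays invertible near [q], and the rows of [Z = D^-1 a P] are Hamiltonian with
    [Z *m W = 1], as [radial_box] requires. The tensor law rewrites its identities for the new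
    chart; cancelling the Jacobian [J] of [phi] leaves the covectors [D^-1 a J^T]. The final clause
    keeps whatever lies in the slice where it was. *)
Lemma pbox_exists c0 q (V : set M) r (a : 'M[R]_(r, n)) (W : 'M[R]_(n, r)) :
  atlas c0 -> cdom c0 q -> open V -> V q -> a *m bivec pi c0 q *m W \in unitmx ->
  exists c F d Ah,
  [/\ pbox c (cmap c0 q) W F d Ah,
      cdom c q /\ cmap c q = cmap c0 q, cdom c `<=` cdom c0 `&` V,
      F = invmx (a *m bivec pi c0 q *m W) *m (a *m bivec pi c0 q) &
      forall x, cdom c x -> cmap c x *m W = cmap c0 x *m W /\
        (cmap c0 x *m W = cmap c0 q *m W -> cmap c x = cmap c0 x)].
Proof.
move=> ac0 c0q oV Vq aPW; set p := cmap c0 q.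
have PO := poisson_on_chart ac0; have [oI CP _ _] := PO.
pose P0 := cbivec c0.
have P0p : P0 p = bivec pi c0 q by rewrite /P0 /cbivec cmapK.
pose D y := a *m P0 y *m W.
have CD k : Cmx k (cimg c0) D.
  by apply: CmxM => //; [apply: CmxM => //; exact: Cmx_cst|exact: Cmx_cst].
pose U0 : set 'rV[R]_n := [set y | cimg c0 y /\ D y \in unitmx].
have oU0 : open U0 by exact: unitmx_open oI (CD 0%N).
pose U := (cmap c0 @` (cdom c0 `&` V)) `&` U0.
have oU : open U by apply: openI => //; exact: chart_open_img.
have Up : U p.
  split; first by exists q.
  by split; [exists q|rewrite /D P0p].
have UI : U `<=` cimg c0 by move=> y [_ []].
have Du y : U y -> D y \in unitmx by move=> [_ []].
pose Z y := invmx (D y) *m (a *m P0 y).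
have CZ k : Cmx k U Z.
  apply: CmxM => //; first by apply: Cmx_inv => //; exact: Cmx_sub (CD k).
  by apply: CmxM => //; [exact: Cmx_cst|exact: Cmx_sub (CP k)].
have ZW y : U y -> Z y *m W = 1%:M.
  by move=> Uy; rewrite /Z -mulmxA mulVmx // Du.
have [d [B [psi [phi [[d0 Op OU] DD psiW psi_id [rad1 rad2]]]]]] :=
  radial_box oU Up CZ ZW.
have OI : B `<=` cimg c0 by move=> y /OU /UI.
pose c := straight_chart DD OI.
have ac : atlas c by exact: straight_atlas.
have [oO oB psiP phiP CC] := DD.
have cI : cimg c = box p W (Z p) d by exact: straight_img.
have cJ y : box p W (Z p) d y -> P0 (phi y) = (jacobian phi y)^T *m cbivec c y *m jacobian phi y.
  move=> By; have [Oy psiy] := phiP y By.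
  have Iy : cimg c y by rewrite cI.
  have [cz zE] := cinvP Iy.
  have [c0z _] := cz.
  have := bivec_change pi ac ac0 cz c0z.
  rewrite /P0 /cbivec /= => ->; rewrite /Jt zE.
  suff -> : jacobian (transition c c0) y = jacobian phi y by [].
  apply: jacobian_near.
  - apply: filterS (open_near oB By) => z Bz.
    by rewrite /transition /= (cinvP (OI _ (phiP z Bz).1)).2.
  - apply: C1_differentiable_rV (@overlap_open _ _ _ c c0) (transition_Cmx 1 ac ac0) _.
    by exists (cinv c y).
  - exact: C1_differentiable_rV oB (CC 1%N).2 By.
have Ju y : box p W (Z p) d y -> row_free (jacobian phi y).
  move=> By; have [Oy psiy] := phiP y By.
  have := jacobian_inv oB oO By (CC 1%N).2 (CC 1%N).1 phiP.
  by move=> /mulmx1_unit [h _]; rewrite row_free_unit.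
have phi_id y : box p W (Z p) d y -> y *m W = p *m W -> phi y = y.
  move=> By yW; have [Oy psiy] := phiP y By.
  have := psi_id _ Oy; rewrite psiy => h; apply/esym/h.
  by rewrite -yW -[in RHS]psiy psiW.
have ZE y : box p W (Z p) d y -> Z (phi y) =
    (invmx (D (phi y)) *m a *m (jacobian phi y)^T) *m cbivec c y *m jacobian phi y.
  by move=> By; rewrite /Z (cJ y By) !mulmxA.
exists c, (Z p), d, (fun y => invmx (D (phi y)) *m a *m (jacobian phi y)^T).
split.
- split=> //.
  + by rewrite ZW.
  + rewrite cI => k; apply: CmxM => //; last first.
      by apply: Cmx_tr; apply: Cmx_jacobian => //; exact: (CC k.+1).2.
    apply: CmxM => //; last exact: Cmx_cst.
    apply: (@Cmx_comp _ _ _ _ _ k U _ (fun y => invmx (D y)) phi oB oU).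
    + by move=> y /phiP [/OU].
    + by apply: Cmx_inv => //; exact: Cmx_sub (CD k).
    + exact: (CC k).2.
  + rewrite cI => y By; have := rad1 y By; rewrite (ZE y By) !mulmxA.
    by move=> h; apply: (row_free_inj (Ju y By)).
  + rewrite cI => y By yW; apply: (row_free_inj (Ju y By)); rewrite (rad2 y By yW) -(ZE y By).
    by rewrite phi_id.
- split; first by split.
  by rewrite /= psi_id.
- move=> x [c0x Ox]; split=> //.
  have [[z [c0z Vz] zE] _] := OU _ Ox.
  by rewrite -(cmapK c0x) -zE cmapK.
- by rewrite /Z /D P0p.
- by move=> x [c0x Ox]; split; [exact: psiW|exact: psi_id].
Qed.

Lemma pbox_poisson_on r c p (W : 'M[R]_(n, r)) F d Ah : pbox c p W F d Ah ->
  poisson_on (box p W F d) (cbivec c).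
Proof. by move=> [[ac _ _] cI _ _ _]; rewrite -cI; exact: poisson_on_chart. Qed.

(** Points of other rank may occur in the same chart, so only the slices through a point of rank [k]
    are claimed to be integral. *)
Definition leafbox k (V : set M) c (E : 'M[R]_(k, n)) (A : 'M[R]_(n, k)) :=
  [/\ atlas c, E *m A = 1%:M, cdom c `<=` V, convexs (cimg c) &
      forall x y, cdom c x -> cdom c y -> \rank (bivec pi c x) = k ->
        (cmap c y - cmap c x) *m (1%:M - A *m E) = 0 -> (bivec pi c y :=: E)%MS].

(** The case where [r] is the full rank: the pairing is the invertible minor of [skew_minor], with
    [a = A^T] and [W = A]. *)
Lemma leafbox_exists k (V : set M) q c0 : open V -> V q -> atlas c0 -> cdom c0 q ->
  \rank (bivec pi c0 q) = k ->
  exists c (E : 'M[R]_(k, n)) (A : 'M[R]_(n, k)), leafbox V c E A /\ cdom c q.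
Proof.
move=> oV Vq ac0 c0q rk; have [] := skew_minor (@bivec_skew R n M pi q c0 (conj ac0 c0q)).
rewrite rk => A Au.
have [c [F [d [Ah [B [cq _] cV _ _]]]]] := pbox_exists ac0 c0q oV Vq Au.
have [[ac FW d0] cI CA rad FP] := B.
exists c, F, A; split=> //; split=> //.
- by move=> x /cV [].
- by rewrite cI; exact: box_convex.
- move=> x y cx cy rx xy; rewrite -(cmapK cy).
  rewrite cI in CA rad FP.
  apply: (leaf_slice FW (pbox_poisson_on B) CA rad FP _ _ _ xy).
  + by rewrite -cI; exact: cimgP.
  + by rewrite -cI; exact: cimgP.
  + by rewrite /cbivec cmapK.
Qed.

End PoissonCharts.

(** * Gluing plaques *)

Section TransitionGlue.
Context {R : realType} {k : nat} {T : topologicalType}.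
Implicit Types d b : chart R k T.

Lemma transitionK d b y : cdom d y -> transition d b (cmap d y) = cmap b y.
Proof. by move=> dy; rewrite /transition /= cmapK. Qed.

Lemma compatible_sym d b : compatible d b -> compatible b d.
Proof. by move=> [h1 h2]; split; rewrite setIC. Qed.

Lemma transition_local d d' b j :
  smooth_on (cmap d @` (cdom d `&` cdom b)) (transition d b) ->
  smooth_on (cmap b @` (cdom b `&` cdom d')) (transition b d') ->
  Cmx j (cmap d @` (cdom d `&` (cdom d' `&` cdom b))) (transition d d').
Proof.
move=> /smooth_onE h1 /smooth_onE h2.
have o1 : open (cmap d @` (cdom d `&` (cdom d' `&` cdom b))).
  by apply: chart_open_img; apply: openI; exact: cdom_open.
have o2 : open (cmap b @` (cdom b `&` cdom d')) by apply: chart_open_img; exact: cdom_open.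
apply: (@Cmx_ext _ _ _ _ o1 _ _ (transition b d' \o transition d b)).
  by move=> _ [y [dy [d'y bY]] <-]; rewrite /transition /= !cmapK.
apply: (Cmx_comp o1 o2 _ (h2 j)).
  by move=> _ [y [dy [d'y bY]] <-]; rewrite /transition /= cmapK //; exists y.
by apply: Cmx_sub (h1 j) => _ [y [dy [_ bY]] <-]; exists y.
Qed.

(** Around each point the transition factors through a chart of [B], and smoothness is local; this
    is why [B] has to cover. *)
Lemma compatible_trans (B : set (chart R k T)) d d' :
  (forall y, exists2 b, B b & cdom b y) ->
  (forall b, B b -> compatible b d) -> (forall b, B b -> compatible b d') ->
  compatible d d'.
Proof.
have H d1 d2 : (forall y, exists2 b, B b & cdom b y) ->
  (forall b, B b -> compatible b d1) -> (forall b, B b -> compatible b d2) ->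
  smooth_on (cmap d1 @` (cdom d1 `&` cdom d2)) (transition d1 d2).
  move=> cB h1 h2; apply/smooth_onE => j; apply: Cmx_local => _ [y [d1y d2y] <-].
  have [b Bb bY] := cB y.
  exists (cmap d1 @` (cdom d1 `&` (cdom d2 `&` cdom b))); first by exists y.
  apply: (@transition_local d1 d2 b).
    by have [_] := h1 b Bb; rewrite setIC.
  by have [] := h2 b Bb.
move=> cB h1 h2; split; first exact: H.
by rewrite setIC; exact: H.
Qed.

End TransitionGlue.

Lemma Jt_refl (R : realType) n (M : manifold R n) (c c' : chart R n M) x : atlas c -> cdom c x -> cmap c' = cmap c -> Jt c c' x = 1%:M.
Proof.
move=> ac cx e; rewrite /Jt.
have -> : transition c c' = transition c c by rewrite /transition e.
have oc : overlap c c (cmap c x) by exists x.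
have oO := @overlap_open _ _ _ c c.
apply: jacobian_eq; first exact: C1_differentiable_rV oO (transition_Cmx 1 ac ac) oc.
move=> v; rewrite mulmx1; apply: near_eq_is_derive (is_derive_id _ v).
by apply: filterS (open_near oO oc) => _ [z [z1 z2] <-]; rewrite transitionK.
Qed.

(* The set [(cmap x - pbase) *m (1 - pcoord *m pdir) = 0], where
   [pdir *m pcoord = 1]: the affine slice through [pbase] with direction the row
   space of [pdir], on which [pcoord] gives the linear coordinates. *)
Record plaque (R : realType) (n : nat) (M : manifold R n) (k : nat) := Plaque {
  pchart : chart R n M;
  pbase : 'rV[R]_n;
  pdir : 'M[R]_(k, n);
  pcoord : 'M[R]_(n, k) }.

Section Plaques.
Context {R : realType} {n : nat} {M : manifold R n} {k : nat}.
Implicit Types Q : plaque M k.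

(** The projection that kills [pdir]: it measures displacements normal to the slice. *)
Definition pcut Q : 'M[R]_n := 1%:M - pcoord Q *m pdir Q.

Definition plaque_set Q : set M :=
  [set x | cdom (pchart Q) x /\ (cmap (pchart Q) x - pbase Q) *m pcut Q = 0].

Definition plaque_wf Q := atlas (pchart Q) /\ pdir Q *m pcoord Q = 1%:M.

Definition paff Q (u : 'rV[R]_k) := pbase Q + u *m pdir Q.

Definition pimg Q : set 'rV[R]_k := [set u | cimg (pchart Q) (paff Q u)].

Definition ppoint Q u : M := cinv (pchart Q) (paff Q u).

Definition pcoo Q x : 'rV[R]_k := (cmap (pchart Q) x - pbase Q) *m pcoord Q.

Lemma pdir_cut Q : plaque_wf Q -> pdir Q *m pcut Q = 0.
Proof. by move=> [_ h]; rewrite mulmxBr mulmx1 mulmxA h mul1mx subrr. Qed.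

Lemma pcooK Q x : plaque_set Q x -> paff Q (pcoo Q x) = cmap (pchart Q) x.
Proof.
move=> [_]; rewrite mulmxBr mulmx1 => /eqP; rewrite subr_eq0 => /eqP h.
by rewrite /paff /pcoo -mulmxA -h addrC subrK.
Qed.

Lemma ppointK Q x : plaque_set Q x -> ppoint Q (pcoo Q x) = x.
Proof. by move=> Qx; rewrite /ppoint pcooK // cmapK //; case: Qx. Qed.

Lemma pcoo_img Q x : plaque_set Q x -> pimg Q (pcoo Q x).
Proof. by move=> Qx; rewrite /pimg /= pcooK //; apply: cimgP; case: Qx. Qed.

Lemma ppointP Q u : plaque_wf Q -> pimg Q u -> plaque_set Q (ppoint Q u) /\ pcoo Q (ppoint Q u) = u.
Proof.
move=> wQ /cinvP [cx cE]; split; last first.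
  by rewrite /pcoo /ppoint cE /paff addrAC subrr add0r -mulmxA wQ.2 mulmx1.
split=> //; rewrite /ppoint cE /paff addrAC subrr add0r -mulmxA pdir_cut //.
by rewrite mulmx0.
Qed.

Lemma continuous_paff Q : continuous (paff Q).
Proof.
move=> u; suff : {for u, continuous (paff Q)} by [].
apply: continuousD; first exact: cst_continuous.
by apply: continuous_mulmx; [exact: cvg_id|exact: cst_continuous].
Qed.

Lemma pimg_open Q : open (pimg Q).
Proof.
apply: (@open_comp _ _ (paff Q) (cimg (pchart Q))); last exact: cimg_open.
by move=> u _; exact: continuous_paff.
Qed.

Lemma Cmx_paff Q j : Cmx j setT (paff Q).
Proof.
apply: CmxD; [exact: openT|exact: Cmx_cst|].
by apply: CmxM; [exact: openT|exact: Cmx_id|exact: Cmx_cst].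
Qed.

Lemma jacobian_paff Q u : jacobian (paff Q) u = pdir Q.
Proof.
apply: jacobian_eq; first by apply: (C1_differentiable_rV openT (Cmx_paff Q 1)).
move=> v; have := is_derive_mulmx (is_derive_id u v) (is_derive_cst (pdir Q) u v).
rewrite mulmx0 addr0 => h; have := is_deriveD (is_derive_cst (pbase Q) u v) h.
by rewrite add0r.
Qed.

Lemma continuous_ppoint Q u : pimg Q u -> {for u, continuous (ppoint Q)}.
Proof.
move=> Iu; apply: continuous_comp; first exact: continuous_paff.
exact: cinv_continuous.
Qed.

Lemma continuous_pcoo Q x : cdom (pchart Q) x -> {for x, continuous (pcoo Q)}.
Proof.
move=> cx; apply: continuous_mulmx; last exact: cst_continuous.
by apply: continuousB; [exact: cmap_continuous|exact: cst_continuous].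
Qed.

End Plaques.

(** As a subtype of [M] it has an injective inclusion by construction, and it inherits the Hausdorff
    property since its topology is finer than the induced one. *)
Definition glued (R : realType) (n : nat) (M : manifold R n) (k : nat)
    (D : set (plaque M k)) : Type :=
  {x : M | `[< exists2 Q, D Q & plaque_set Q x >]}.

Section GluedTopology.
Context {R : realType} {n : nat} {M : manifold R n} {k : nat}.
Variable D : set (plaque M k).

HB.instance Definition _ := [isSub of glued D for @sval _ _].
HB.instance Definition _ := [Choice of glued D by <:].

Definition gincl (y : glued D) : M := val y.

(* The final topology for the inclusions of the plaques, which carry the topology
   of [M]. *)
Definition gopen (U : set (glued D)) := forall y Q, U y -> D Q -> plaque_set Q (gincl y) ->
  exists O, [/\ open O, O (gincl y) & forall z, plaque_set Q (gincl z) -> O (gincl z) -> U z].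

Lemma gopenT : gopen setT.
Proof. by move=> y Q _ _ _; exists setT; split=> //; exact: openT. Qed.

Lemma gopenI : setI_closed gopen.
Proof.
move=> U V gU gV y Q [Uy Vy] DQ Qy.
have [A [oA Ay AU]] := gU y Q Uy DQ Qy.
have [B [oB By BV]] := gV y Q Vy DQ Qy.
exists (A `&` B); split=> //; first exact: openI.
by move=> z Qz [Az Bz]; split; [exact: AU|exact: BV].
Qed.

Lemma gopen_bigU (I : Type) (f : I -> set (glued D)) : (forall i, gopen (f i)) ->
  gopen (\bigcup_i f i).
Proof.
move=> gf y Q [i _ fy] DQ Qy; have [A [oA Ay AU]] := gf i y Q fy DQ Qy.
by exists A; split=> // z Qz Az; exists i => //; exact: AU.
Qed.

HB.instance Definition _ := isOpenTopological.Build (glued D) gopenT gopenI gopen_bigU.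

Lemma glued_open (U : set (glued D)) : open U = gopen U.
Proof. by []. Qed.

End GluedTopology.

Section GluedManifold.
Context {R : realType} {n : nat} {M : manifold R n} {k : nat}.
Variable D : set (plaque M k).
Hypothesis cD : countable D.
Hypothesis wD : forall Q, D Q -> plaque_wf Q.
Hypothesis DD : forall Q Q' x, D Q -> D Q' -> plaque_set Q x -> plaque_set Q' x ->
  exists O, [/\ open O, O x & plaque_set Q `&` O `<=` plaque_set Q'].
Implicit Types (Q : plaque M k) (y : glued D).

Lemma gincl_cover y : exists2 Q, D Q & plaque_set Q (gincl y).
Proof. by have /asboolP := valP y. Qed.

Lemma gincl_lift Q x : D Q -> plaque_set Q x -> exists y : glued D, gincl y = x.
Proof.
move=> DQ Qx; have h : `[< exists2 Q, D Q & plaque_set Q x >] by apply/asboolP; exists Q.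
by exists (exist _ x h).
Qed.

Lemma gincl_inj : injective (@gincl R n M k D).
Proof. exact: val_inj. Qed.

Lemma gopen_pset Q O : D Q -> open O -> open [set y : glued D | plaque_set Q (gincl y) /\ O (gincl y)].
Proof.
move=> DQ oO; rewrite glued_open => y Q' [Qy Oy] DQ' Q'y.
have [G [oG Gy OQ]] := DD DQ' DQ Q'y Qy.
exists (G `&` O); split=> //; first exact: openI.
by move=> z Q'z [Gz Oz]; split=> //; apply: OQ.
Qed.

Lemma gincl_continuous : continuous (@gincl R n M k D).
Proof.
apply/continuousP => O oO; rewrite glued_open => y Q Oy DQ Qy.
by exists O.
Qed.

Lemma glued_hausdorff : hausdorff_space (glued D).
Proof.
move=> y z yz; apply: gincl_inj; apply: (@points_hausdorff R n M) => A B Ay Bz.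
have [w [Aw Bw]] := yz _ _ (gincl_continuous Ay) (gincl_continuous Bz).
by exists (gincl w).
Qed.

Lemma glued_second_countable : @second_countable (glued D).
Proof.
have [B cB [Bo Bb]] := @points_second_countable R n M.
pose f (QO : plaque M k * set M) := [set y : glued D | plaque_set QO.1 (gincl y) /\ QO.2 (gincl y)].
exists (f @` (D `*` B)).
  by apply: sub_countable (card_image_le _ _) _; exact: countableX.
split=> [_ [[Q O] [/= DQ BO] <-]|y U].
  by apply: gopen_pset => //; exact: Bo.
rewrite nbhsE => -[V [oV Vy] VU].
have [Q DQ Qy] := gincl_cover y.
have [A [oA Ay AV]] := oV y Q Vy DQ Qy.
have [W [BW Wy] WA] := Bb (gincl y) A (open_nbhs_nbhs (conj oA Ay)).
exists (f (Q, W)); first by split; [exists (Q, W)|].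
by move=> z [/= Qz Wz]; apply: VU; apply: AV => //; exact: WA.
Qed.

Section Base.
Variables (Q : plaque M k) (DQ : D Q) (y0 : glued D).

Let bdom : set (glued D) := [set y | plaque_set Q (gincl y)].
Let bmap y := pcoo Q (gincl y).
(** [y0] is only the default value outside [pimg Q]; it makes the inverse chart total. *)
Let binv u : glued D := insubd y0 (ppoint Q u).

Let bdom_open : open bdom.
Proof.
have := gopen_pset DQ openT; congr open.
by apply/seteqP; split=> y //= [].
Qed.

Let binvE u : pimg Q u -> gincl (binv u) = ppoint Q u.
Proof.
move=> Iu; rewrite /gincl /binv insubdK //; apply/asboolP; exists Q => //.
by have [] := ppointP (wD DQ) Iu.
Qed.

Let bimg : bmap @` bdom = pimg Q.
Proof.
apply/seteqP; split=> [_ [y Qy <-]|u Iu]; first exact: pcoo_img.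
have [h1 h2] := ppointP (wD DQ) Iu.
by exists (binv u); rewrite /bdom /bmap /= binvE.
Qed.

Let bimg_open : open (bmap @` bdom).
Proof. by rewrite bimg; exact: pimg_open. Qed.

Let bmap_continuous y : bdom y -> {for y, continuous bmap}.
Proof.
move=> Qy; apply: continuous_comp; first exact: gincl_continuous.
by apply: continuous_pcoo; case: Qy.
Qed.

Let binv_continuous u : (bmap @` bdom) u -> {for u, continuous binv}.
Proof.
rewrite bimg => Iu A; rewrite nbhsE => -[U [oU Uu] UA].
have [Qu _] := ppointP (wD DQ) Iu.
have := oU (binv u) Q Uu DQ; rewrite binvE // => /(_ Qu) [G [oG Gu GU]].
have h1 := open_near (pimg_open (Q := Q)) Iu.
have h2 := continuous_ppoint Iu (open_nbhs_nbhs (conj oG Gu)).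
apply: filterS2 h1 h2 => v Iv Gv; apply: UA; apply: GU; rewrite binvE //.
by have [] := ppointP (wD DQ) Iv.
Qed.

Let bmapK y : bdom y -> binv (bmap y) = y.
Proof.
move=> Qy; apply: gincl_inj; rewrite binvE; last exact: pcoo_img.
exact: ppointK.
Qed.

Definition base_chart : chart R k (glued D) :=
  @Chart R k (glued D) bdom bmap binv bdom_open bimg_open bmap_continuous binv_continuous bmapK.

End Base.

Lemma base_transition Q Q' (DQ : D Q) (DQ' : D Q') y0 y0' :
  smooth_on (cmap (base_chart DQ y0) @` (cdom (base_chart DQ y0) `&` cdom (base_chart DQ' y0')))
    (transition (base_chart DQ y0) (base_chart DQ' y0')).
Proof.
apply/smooth_onE => j.
set b := base_chart DQ y0; set b' := base_chart DQ' y0'.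
have oU : open (cmap b @` (cdom b `&` cdom b')) by apply: chart_open_img; exact: cdom_open.
pose f w := (transition (pchart Q) (pchart Q') w - pbase Q') *m pcoord Q'.
apply: (@Cmx_ext _ _ _ _ oU _ _ (f \o paff Q)).
  move=> _ [y [by_ b'y] <-]; rewrite transitionK // /f /= pcooK // transitionK //.
  by case: by_.
apply: (Cmx_comp oU (@overlap_open _ _ _ (pchart Q) (pchart Q'))).
- move=> _ [y [by_ b'y] <-] /=; rewrite pcooK //.
  by exists (gincl y) => //; split; [case: by_|case: b'y].
- apply: CmxM; [exact: overlap_open| |exact: Cmx_cst].
  apply: CmxB; [exact: overlap_open| |exact: Cmx_cst].
  by apply: transition_Cmx; [case: (wD DQ)|case: (wD DQ')].
- by apply: Cmx_sub (Cmx_paff Q j).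
Qed.

Lemma base_compatible Q Q' (DQ : D Q) (DQ' : D Q') y0 y0' :
  compatible (base_chart DQ y0) (base_chart DQ' y0').
Proof. by split; [|rewrite setIC]; exact: base_transition. Qed.

Definition bases : set (chart R k (glued D)) :=
  [set b | exists Q (DQ : D Q) y0, b = base_chart DQ y0].

(** All charts compatible with the base charts, so that maximality is immediate. *)
Definition gatlas : set (chart R k (glued D)) :=
  [set d | forall b, bases b -> compatible b d].

Lemma bases_cover y : exists2 b, bases b & cdom b y.
Proof.
have [Q DQ Qy] := gincl_cover y.
by exists (base_chart DQ y) => //; exists Q, DQ, y.
Qed.

Lemma bases_atlas b : bases b -> gatlas b.
Proof.
by move=> [Q [DQ [y0 ->]]] _ [Q' [DQ' [y0' ->]]]; exact: base_compatible.
Qed.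

Lemma gatlas_cover y : exists2 c, gatlas c & cdom c y.
Proof. by have [b /bases_atlas] := bases_cover y; exists b. Qed.

Lemma gatlas_compatible d d' : gatlas d -> gatlas d' -> compatible d d'.
Proof. by move=> h h'; apply: (compatible_trans bases_cover). Qed.

Lemma gatlas_maximal d : (forall d', gatlas d' -> compatible d d') -> gatlas d.
Proof. by move=> h b /bases_atlas /h /compatible_sym. Qed.

Definition glued_manifold : manifold R k :=
  @Manifold R k (glued D) gatlas glued_hausdorff glued_second_countable
    gatlas_cover gatlas_compatible gatlas_maximal.

Local Notation G := glued_manifold.

Definition ginclM (y : G) : M := gincl y.

Section LocalExpr.
Variables (Q : plaque M k) (DQ : D Q) (d : chart R k G) (c : chart R n M) (y : G).
Hypotheses (ad : atlas d) (ac : atlas c) (dy : cdom d y) (cy : cdom c (ginclM y)).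
Hypothesis Qy : plaque_set Q (ginclM y).

Let b : chart R k G := base_chart DQ y.
Let ab : atlas b.
Proof. by apply: bases_atlas; exists Q, DQ, y. Qed.
Let V1 := cmap d @` (cdom d `&` (cdom b `&` ginclM @^-1` cdom c)).

Let oV1 : open V1.
Proof.
apply: chart_open_img; apply: openI; first exact: cdom_open.
apply: open_comp (cdom_open c) => z _; exact: gincl_continuous.
Qed.

Let V1y : V1 (cmap d y). Proof. by exists y. Qed.

Let g := transition (pchart Q) c \o (paff Q \o transition d b).

Let affE z : cdom d z -> cdom b z ->
  (paff Q \o transition d b) (cmap d z) = cmap (pchart Q) (gincl z).
Proof.
move=> dz bz; transitivity (paff Q (cmap b z)); last exact: pcooK bz.
by congr (paff Q _); exact: transitionK.
Qed.

Let localE u : V1 u -> g u = local_expr ginclM d c u.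
Proof.
move=> [z [dz [bz cz]] <-].
transitivity (transition (pchart Q) c (cmap (pchart Q) (gincl z))).
  by congr (transition _ _ _); exact: affE.
rewrite transitionK; last by case: bz.
by rewrite /local_expr /comp cmapK.
Qed.

Let C1 j : Cmx j V1 (transition d b).
Proof.
apply: Cmx_sub (transition_Cmx j ad ab) => _ [z [dz [bz _]] <-].
by exists z.
Qed.

Let C2 j : Cmx j V1 (paff Q \o transition d b).
Proof. exact: (Cmx_comp oV1 openT (fun _ _ => I) (Cmx_paff Q j) (C1 j)). Qed.

Let W := overlap (pchart Q) c.

Let V1W u : V1 u -> W ((paff Q \o transition d b) u).
Proof.
move=> [z [dz [bz cz]] <-]; rewrite affE //.
by exists (gincl z) => //; split=> //; case: bz.
Qed.

Let C3 j : Cmx j W (transition (pchart Q) c).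
Proof. by apply: transition_Cmx => //; case: (wD DQ). Qed.

Let C4 j : Cmx j V1 g.
Proof. exact: (Cmx_comp oV1 (@overlap_open _ _ _ (pchart Q) c) V1W (C3 j) (C2 j)). Qed.

Lemma glocal_Cmx j : exists2 V, V (cmap d y) & Cmx j V (local_expr ginclM d c).
Proof. by exists V1 => //; apply: (Cmx_ext oV1 localE (C4 j)). Qed.

(** Read in the base chart of [Q], the inclusion is the affine map [paff Q] with Jacobian [pdir Q];
    the outer factors are changes of charts. *)
Lemma glocal_differential :
  differential_mx ginclM d c y =
  Jt d b y *m pdir Q *m Jt (pchart Q) c (ginclM y).
Proof.
rewrite /differential_mx.
have -> : jacobian (local_expr ginclM d c) (cmap d y) = jacobian g (cmap d y).
  apply: jacobian_near.
  - by apply: filterS (open_near oV1 V1y) => u /localE.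
  - exact: C1_differentiable_rV oV1 (Cmx_ext oV1 localE (C4 1)) V1y.
  - exact: C1_differentiable_rV oV1 (C4 1) V1y.
rewrite (jacobian_comp oV1 (@overlap_open _ _ _ (pchart Q) c) V1y (V1W V1y) (C3 1) (C2 1)).
rewrite (jacobian_comp oV1 openT V1y I (Cmx_paff Q 1) (C1 1)).
rewrite jacobian_paff /Jt; congr (_ *m _ *m jacobian _ _).
exact: affE.
Qed.

Lemma glocal_unit : Jt d b y \in unitmx.
Proof. exact: Jt_unit. Qed.

End LocalExpr.

Lemma ginclM_immersion : immersion ginclM.
Proof.
split.
  split; first exact: gincl_continuous.
  move=> d c ad ac; apply/smooth_onE => j; apply: Cmx_local => _ [y [dy cy] <-].
  have [Q DQ Qy] := gincl_cover y.
  exact: (@glocal_Cmx Q DQ d c y).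
move=> y d c [ad dy] [ac cy]; have [Q DQ Qy] := gincl_cover y.
rewrite (@glocal_differential Q DQ d c y) //.
have u1 := @glocal_unit Q DQ d y ad dy Qy.
have u2 : Jt (pchart Q) c (ginclM y) \in unitmx.
  by apply: Jt_unit => //; [case: (wD DQ)|case: Qy].
have fE : row_free (pdir Q) by apply/row_freeP; exists (pcoord Q); case: (wD DQ).
rewrite -row_leq_rank mxrankMfree ?row_free_unit // (eqmxMfull (pdir Q)) ?row_full_unit //.
by rewrite row_leq_rank.
Qed.

Definition glued_submanifold : submanifold M :=
  @Submanifold R n M k G ginclM gincl_inj ginclM_immersion.

End GluedManifold.

(** The interface through which the glued manifold is used. The third and fourth clauses say that,
    near a point, neighbourhoods in [S] and neighbourhoods within a plaque through it are the
    same. *)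
Definition glues (R : realType) n (M : manifold R n) k (D : set (plaque M k))
    (S : submanifold M) :=
  [/\ sdim S = k,
      support_set S = \bigcup_(Q in D) plaque_set Q,
      forall U : set S, open U -> forall y Q, U y -> D Q -> plaque_set Q (incl y) ->
        exists O, [/\ open O, O (incl y) &
          forall z : S, plaque_set Q (incl z) -> O (incl z) -> U z],
      forall (y : S) Q O (A : set S), D Q -> plaque_set Q (incl y) -> open O -> O (incl y) ->
        (forall z : S, plaque_set Q (incl z) -> O (incl z) -> A z) -> nbhs y A &
      forall (y : S) d Q, chart_at y d -> D Q -> plaque_set Q (incl y) ->
        (tangent_mx d (pchart Q) y :=: pdir Q)%MS].

(** The overlap condition makes the intersection of two plaques relatively open in each, so that
    plaques are open in the final topology and serve as chart domains. Countability of [D] yields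
    second countability. *)
Theorem glue_plaques (R : realType) n (M : manifold R n) k (D : set (plaque M k)) :
  countable D -> (forall Q, D Q -> plaque_wf Q) ->
  (forall Q Q' x, D Q -> D Q' -> plaque_set Q x -> plaque_set Q' x ->
    exists O, [/\ open O, O x & plaque_set Q `&` O `<=` plaque_set Q']) ->
  exists S : submanifold M, glues D S.
Proof.
move=> cD wD DD; exists (glued_submanifold cD wD DD); split=> //.
- apply/seteqP; split=> [_ [y _ <-]|x [Q DQ Qx]].
    by have [Q DQ Qy] := gincl_cover y; exists Q.
  by have [y yx] := gincl_lift DQ Qx; exists y.
- move=> y Q O A DQ Qy oO Oy OA.
  have h := open_nbhs_nbhs (conj (gopen_pset DD DQ oO) (conj Qy Oy)).
  by apply: filterS h => z [Qz Oz]; exact: OA.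
- move=> y d Q [ad dy] DQ Qy; have [aQ _] := wD Q DQ.
  have [cy _] := Qy.
  rewrite /tangent_mx (@glocal_differential _ _ _ _ _ cD wD DD Q DQ d (pchart Q) y) //.
  have u1 := @glocal_unit _ _ _ _ _ cD wD DD Q DQ d y ad dy Qy.
  rewrite (Jt_refl aQ cy) // mulmx1; apply: eqmxMfull.
  by rewrite row_full_unit.
Qed.

(** For each basic open set contained in some [dom i], one such [i] is chosen. *)
Lemma lindelof (T : topologicalType) (I : Type) (dom : I -> set T) :
  @second_countable T -> (forall i, open (dom i)) ->
  exists2 C : set I, countable C & forall i x, dom i x -> exists2 j, C j & dom j x.
Proof.
move=> [B cB [Bo Bb]] od.
have [[i0 _]|nI] := pselect (exists i : I, True); last first.
  by exists set0 => [|i]; [exact: countable0|case: nI; exists i].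
have /choice [g gP] : forall W : set T, exists i, (exists i, W `<=` dom i) -> W `<=` dom i.
  by move=> W; have [[i h]|h] := pselect (exists i, W `<=` dom i); [exists i|exists i0].
exists (g @` B); first exact: sub_countable (card_image_le _ _) _.
move=> i x ix; have [W [BW Wx] Wi] := Bb x (dom i) (open_nbhs_nbhs (conj (od i) ix)).
exists (g W); first by exists W.
by apply: (gP W) => //; exists i.
Qed.

Lemma nbhs_open (T : topologicalType) (U : set T) x : open U -> U x -> nbhs x U.
Proof. by move=> oU Ux; exact: open_nbhs_nbhs. Qed.

Lemma connected_clopen (T : topologicalType) (U : set T) t0 : connected [set: T] ->
  open U -> open (~` U) -> U t0 -> forall t, U t.
Proof.
move=> cT oU oCU Ut0 t; suff -> : U = setT by [].
apply: cT; first by exists t0.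
  by exists U => //; rewrite setTI.
by exists U; [rewrite -[U]setCK; exact: open_closedC|rewrite setTI].
Qed.

Lemma connected_line (R : realType) : connected [set: R].
Proof. by apply/connected_intervalP => x y _ _ z _. Qed.

(** * Symplectic leaves *)

Section SliceLocal.
Context {R : realType} {n : nat} {M : manifold R n} (L : submanifold M).

(* Gronwall: a submanifold that starts on the slice [(x - w) *m K = 0] stays in
   it if the normal component of its tangent vectors is bounded by a multiple of
   the distance to the slice. *)
Lemma slice_local (y : L) (d : chart R (sdim L) L) (c : chart R n M) (w : 'rV[R]_n)
    (K : 'M[R]_n) (C : R) :
  chart_at y d -> atlas c -> cdom c (incl y) -> (cmap c (incl y) - w) *m K = 0 ->
  (\forall z \near y, `|tangent_mx d c z *m K| <= C * `|(cmap c (incl z) - w) *m K|) ->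
  \forall z \near y, cdom c (incl z) /\ (cmap c (incl z) - w) *m K = 0.
Proof.
move=> [ad dy] ac cy yw near_y.
pose f := local_expr (@incl R n M L) d c.
have fE z : cdom d z -> f (cmap d z) = cmap c (incl z).
  by move=> dz; rewrite /f /local_expr /comp cmapK.
have U0 : sdomain d c (cmap d y) by exists y.
have oU := @sdomain_open R n M L d c.
have Cf := local_expr_Cmx 1 ad ac.
have n1 := open_near oU U0.
have n2 : \forall u \near cmap d y,
    `|tangent_mx d c (cinv d u) *m K| <= C * `|(cmap c (incl (cinv d u)) - w) *m K|.
  have hc := cinv_continuous (cimgP dy).
  by rewrite /prop_for /continuous_at cmapK // in hc; exact: hc _ near_y.
have [rho rho0 hrho] := nbhs_oball (filterI n1 n2).
have fK u : oball (cmap d y) rho u -> (f u - w) *m K = 0.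
  move=> uB; set u0 := cmap d y in uB hrho *.
  pose x (t : R) := u0 + t *: (u - u0).
  have xB (t : R) : 0 <= t <= 1 -> oball u0 rho (x t).
    by move=> ti; apply: oball_convex => //; exact: oball_center.
  pose g t := (f (x t) - w) *m K.
  have gu : g 1 = (f u - w) *m K by rewrite /g /x scale1r [u0 + _]addrC subrK.
  rewrite -gu.
  have ti01 (s : R) : 0 < s < 1 -> 0 <= s <= 1 by case/andP => /ltW -> /ltW ->.
  have dg (s : R) : 0 <= s <= 1 -> is_derive s 1 g ((u - u0) *m jacobian f (x s) *m K).
    move=> si; have [Ux _] := hrho _ (xB s si).
    have d1 : is_derive s 1 (fun t => f (x t)) ((u - u0) *m jacobian f (x s)).
      by apply/is_derive_line; exact: is_derive_jacobian oU Cf Ux.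
    have := is_derive_mulmx (is_deriveB d1 (is_derive_cst w s 1)) (is_derive_cst K s 1).
    by rewrite mulmx0 addr0 subr0.
  apply: (@vanish01 R 1 n g (fun s => (u - u0) *m jacobian f (x s) *m K)
    ((sdim L)%:R * `|u - u0| * C)).
  - move=> s si; have [Ux _] := hrho _ (xB s si).
    apply: continuous_mulmx; last exact: cst_continuous.
    apply: continuousB; last exact: cst_continuous.
    apply: (@continuous_comp _ _ _ x f); first exact: continuous_line.
    exact: Cmx_continuous Cf Ux.
  - by move=> s /ti01; exact: dg.
  - move=> s /ti01 si; have [Ux] := hrho _ (xB s si).
    have [z [dz cz] zE] := Ux.
    rewrite -/(x s) -zE cmapK // /tangent_mx /differential_mx zE -(fE z dz) zE => h.
    rewrite -mulmxA; apply: le_trans (norm_mulmx _ _) _.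
    by rewrite -[leRHS]mulrA; apply: ler_wpM2l; [exact: mulr_ge0|exact: h].
  - by rewrite /g /x scale0r addr0 fE.
  - by rewrite ler01 lexx.
apply: (chart_near dy).
apply: filterS (nbhs_oballW (cmap d y) rho0) => u uB Iu.
have [[z [dz cz] zE] _] := hrho u uB.
by rewrite -zE cmapK //; split=> //; rewrite -fE // zE fK.
Qed.

End SliceLocal.

Section Leaves.
Context {R : realType} {n : nat} {M : manifold R n} (pi : poisson M).
Variables (V : set M) (k : nat).
Hypothesis oV : open V.
Implicit Types (Q P : plaque M k) (x : M) (c : chart R n M).

Definition has_rank x := forall c, chart_at x c -> \rank (bivec pi c x) = k.

Lemma has_rankP c x : atlas c -> cdom c x -> \rank (bivec pi c x) = k -> has_rank x.
Proof. by move=> ac cx rk c' [ac' c'x]; rewrite (rank_bivec pi ac ac' cx c'x). Qed.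

Definition leafy Q := leafbox pi V (pchart Q) (pdir Q) (pcoord Q).

Lemma leafy_wf Q : leafy Q -> plaque_wf Q.
Proof. by case. Qed.

(** The base is multiplied by [pcut] so that the record depends on the slice and not on the point:
    two points of one slice give equal plaques, which the counting argument relies on. *)
Definition plaque_at Q x :=
  Plaque (pchart Q) (cmap (pchart Q) x *m pcut Q) (pdir Q) (pcoord Q).

Lemma pcut_idem Q : plaque_wf Q -> pcut Q *m pcut Q = pcut Q.
Proof.
move=> wQ; rewrite {1}/pcut mulmxBl mul1mx -mulmxA pdir_cut //.
by rewrite mulmx0 subr0.
Qed.

Lemma plaque_set_atE Q x : plaque_wf Q -> plaque_set (plaque_at Q x) =
  [set z | cdom (pchart Q) z /\ (cmap (pchart Q) z - cmap (pchart Q) x) *m pcut Q = 0].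
Proof.
move=> wQ; apply/seteqP; split=> z [cz /= h]; split=> //; move: h.
  by rewrite -/(pcut Q) !mulmxBl -mulmxA pcut_idem.
by rewrite -/(pcut Q) !mulmxBl -mulmxA pcut_idem.
Qed.

Lemma plaque_set_at_refl Q x : plaque_wf Q -> cdom (pchart Q) x -> plaque_set (plaque_at Q x) x.
Proof. by move=> wQ cx; rewrite plaque_set_atE //; split=> //; rewrite subrr mul0mx. Qed.

Lemma plaque_at_eq Q x z : plaque_wf Q -> plaque_set (plaque_at Q x) z -> plaque_at Q z = plaque_at Q x.
Proof.
move=> wQ; rewrite plaque_set_atE // => -[_]; rewrite mulmxBl => /eqP.
by rewrite subr_eq0 /plaque_at => /eqP ->.
Qed.

Lemma leafy_bivec Q x z : leafy Q -> cdom (pchart Q) x -> has_rank x ->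
  plaque_set (plaque_at Q x) z -> (bivec pi (pchart Q) z :=: pdir Q)%MS.
Proof.
move=> lQ cx rx; rewrite (plaque_set_atE _ (leafy_wf lQ)) => -[cz h].
by have [aQ _ _ _ H] := lQ; exact: (H x z cx cz (rx _ (conj aQ cx)) h).
Qed.

Lemma leafy_rank Q x z : leafy Q -> cdom (pchart Q) x -> has_rank x ->
  plaque_set (plaque_at Q x) z -> has_rank z.
Proof.
move=> lQ cx rx Qz; have [aQ EA _ _ _] := lQ; have [cz _] := Qz.
apply: (has_rankP aQ cz); rewrite (leafy_bivec lQ cx rx Qz).
by apply/eqP; apply/row_freeP; exists (pcoord Q).
Qed.

(* Maps that locally stay in one plaque; both inclusions of integral manifolds
   and Hamiltonian curves are of this kind. *)
Definition leafwise (T : topologicalType) (g : T -> M) :=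
  (forall t, V (g t) /\ has_rank (g t)) /\
  forall t Q, leafy Q -> cdom (pchart Q) (g t) ->
    \forall s \near t, plaque_set (plaque_at Q (g t)) (g s).

(** The tangency clause of [integral_in] alone, so that it can be used without establishing
    connectedness, for instance for a single glued plaque. *)
Definition characteristic (L : submanifold M) :=
  forall (y : L) d c, chart_at y d -> chart_at (incl y) c ->
    (tangent_mx d c y == bivec pi c (incl y))%MS.

Lemma characteristic_leafwise (L : submanifold M) : sdim L = k -> characteristic L ->
  support_set L `<=` V -> leafwise (@incl R n M L).
Proof.
move=> dL cL LV.
have rk (y : L) : has_rank (incl y).
  move=> c hc; have [d ad dy] := atlas_cover y.
  have := cL y d c (conj ad dy) hc; move/eqmxP => h.
  by rewrite -h rank_tangent.
split; first by move=> y; split=> //; apply: LV; exists y.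
move=> y Q lQ Qy; have [aQ EA _ _ _] := lQ; have wQ := leafy_wf lQ.
have [d ad dy] := atlas_cover y.
have y0 : (cmap (pchart Q) (incl y) - cmap (pchart Q) (incl y)) *m pcut Q = 0.
  by rewrite subrr mul0mx.
rewrite plaque_set_atE //.
(* The rank is [k] all along [L], so nearby tangent vectors lie in [pdir Q] exactly and the constant
   is 0. *)
apply: (slice_local (C := 0) (conj ad dy) aQ Qy y0).
have n1 : \forall z \near y, cdom d z by apply: nbhs_open => //; exact: cdom_open.
have n2 : \forall z \near y, cdom (pchart Q) (incl z).
  by apply: incl_continuous; apply: nbhs_open => //; exact: cdom_open.
apply: filterS2 n1 n2 => z dz Qz; rewrite mul0r.
have /eqmxP h := cL z d (pchart Q) (conj ad dz) (conj aQ Qz).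
have := leafy_bivec lQ Qz (rk z) (plaque_set_at_refl wQ Qz) => hb.
have /submxP [G GE] : (tangent_mx d (pchart Q) z <= pdir Q)%MS by rewrite h hb.
by rewrite GE -mulmxA pdir_cut // mulmx0 normr0.
Qed.

Lemma glues_characteristic (D : set (plaque M k)) (S : submanifold M) : glues D S ->
  (forall Q, D Q -> atlas (pchart Q)) ->
  (forall Q x, D Q -> plaque_set Q x -> (bivec pi (pchart Q) x :=: pdir Q)%MS) ->
  characteristic S.
Proof.
move=> [dS sS _ _ tS] aD bD y d c hd [ac cy].
have : support_set S (incl y) by exists y.
rewrite sS => -[Q DQ Qy]; have aQ := aD Q DQ; have Qd := Qy.1.
rewrite (tangent_change hd (conj aQ Qd) (conj ac cy)).
apply/eqmxP; apply: eqmx_trans (eqmx_sym (bivec_eqmx pi aQ ac Qd cy)).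
apply: eqmxMr; apply: eqmx_trans (tS y d Q hd DQ Qy) (eqmx_sym _).
exact: bD.
Qed.

(** The plaque of [Q], glued by itself, is an integral submanifold, hence locally stays in one slice
    of [Q']. *)
Lemma plaque_overlap Q x Q' z : leafy Q -> cdom (pchart Q) x -> has_rank x ->
  leafy Q' -> cdom (pchart Q') z -> plaque_set (plaque_at Q x) z ->
  exists A, [/\ open A, A z & plaque_set (plaque_at Q x) `&` A `<=` plaque_set (plaque_at Q' z)].
Proof.
move=> lQ Qx rx lQ' Q'z Qz; pose D := [set plaque_at Q x].
have wQ := leafy_wf lQ.
have [|_ ->||S gS] := @glue_plaques R n M k D; [exact: countable1|by []| |].
  by move=> _ _ w -> -> _ _; exists setT; split; [exact: openT|by []|move=> ? []].
have [dS sS oS _ _] := gS.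
have cS : characteristic S.
  apply: (glues_characteristic gS) => [_ ->|_ w -> Qw]; first by case: wQ.
  exact: leafy_bivec rx Qw.
have SV : support_set S `<=` V.
  by rewrite sS => w [_ -> [Qw _]]; have [_ _ QV _ _] := lQ; exact: QV.
have : support_set S z by rewrite sS; exists (plaque_at Q x).
move=> [y _ yz].
have [_ lw] := characteristic_leafwise dS cS SV.
rewrite -yz in Q'z Qz *.
have : nbhs y [set s | plaque_set (plaque_at Q' (incl y)) (incl s)] by exact: lw.
rewrite nbhsE => -[U [oU Uy] UQ].
have [A [oA Ay AU]] := oS U oU y (plaque_at Q x) Uy erefl Qz.
exists A; split=> // w [Qw Aw].
have : support_set S w by rewrite sS; exists (plaque_at Q x).
by move=> [y' _ y'w]; rewrite -y'w in Qw Aw *; apply: UQ; exact: AU.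
Qed.

Lemma leafy_cover : exists2 B : set (plaque M k), countable B & (forall Q, B Q -> leafy Q) /\
  forall x, V x -> has_rank x -> exists2 Q, B Q & cdom (pchart Q) x.
Proof.
have [C cC CP] := @lindelof M {Q | leafy Q} (fun q => cdom (pchart (sval q)))
  (@points_second_countable R n M) (fun q => cdom_open (pchart (sval q))).
exists (sval @` C); first exact: sub_countable (card_image_le _ _) _.
split=> [_ [[Q lQ] _ <-] //|x Vx rx].
have [c0 ac0 c0x] := atlas_cover x.
have [c [E [A [lb cx]]]] := leafbox_exists oV Vx ac0 c0x (rx _ (conj ac0 c0x)).
have [Q' CQ' Q'x] := CP (exist _ (Plaque c 0 E A) lb) x cx.
by exists (sval Q') => //; exists Q'.
Qed.

Section Leaf.
Variables (B : set (plaque M k)) (x0 : M).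
Hypotheses (cB : countable B) (lB : forall Q, B Q -> leafy Q).
Hypothesis coverB : forall x, V x -> has_rank x -> exists2 Q, B Q & cdom (pchart Q) x.
Hypotheses (Vx0 : V x0) (rx0 : has_rank x0).

Fixpoint reach m : set (plaque M k) :=
  if m is m'.+1 then
    [set P | exists Q x, [/\ B Q, cdom (pchart Q) x, P = plaque_at Q x &
       exists2 P', reach m' P' & plaque_set P' x]]
  else [set P | exists Q, [/\ B Q, cdom (pchart Q) x0 & P = plaque_at Q x0]].

Definition leaf_plaques := \bigcup_m reach m.

Lemma reach_leafy m P : reach m P -> exists Q x,
  [/\ B Q, cdom (pchart Q) x, has_rank x & P = plaque_at Q x].
Proof.
elim: m P => [|m IH] P /=; first by move=> [Q [BQ Qx ->]]; exists Q, x0.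
move=> [Q [x [BQ Qx -> [P' /IH [Q' [x' [BQ' Q'x' rx' ->]]] P'x]]]].
by exists Q, x; split=> //; apply: leafy_rank P'x => //; exact: lB.
Qed.

(* A plaque reached in one more step is determined by its chart, the previous
   plaque and a set of a countable basis over which the two coincide. *)
Lemma reach_countable m : countable (reach m).
Proof.
elim: m => [|m IH].
  apply: sub_countable cB; apply: card_le_trans (card_image_le (fun Q => plaque_at Q x0) B).
  by apply: subset_card_le => P [Q [BQ _ ->]]; exists Q.
have [W cW [Wo Wb]] := @points_second_countable R n M.
pose T (a : plaque M k * plaque M k * set M) : set 'rV[R]_n :=
  [set zeta | exists x, [/\ cdom (pchart a.1.1) x, a.2 x, plaque_set a.1.2 x,
    zeta = cmap (pchart a.1.1) x *m pcut a.1.1 &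
    plaque_set a.1.2 `&` a.2 `<=` plaque_set (plaque_at a.1.1 x)]].
pose g a := Plaque (pchart a.1.1) (xget 0 (T a)) (pdir a.1.1) (pcoord a.1.1).
have cP : countable (B `*` reach m `*` W) by apply: countableX => //; exact: countableX.
apply: sub_countable cP; apply: card_le_trans (card_image_le g _).
apply: subset_card_le => P [Q [x [BQ Qx -> [P' rP' P'x]]]].
have lQ := lB BQ; have wQ := leafy_wf lQ.
have [Q' [x' [BQ' Q'x' rx' P'E]]] := reach_leafy rP'.
rewrite P'E in P'x.
have [A [oA Ax AP]] := plaque_overlap (lB BQ') Q'x' rx' lQ Qx P'x.
have [A' [WA' A'x] A'A] := Wb x A (open_nbhs_nbhs (conj oA Ax)).
have T0 : T (Q, P', A') (cmap (pchart Q) x *m pcut Q).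
  exists x; split=> //; first by rewrite P'E.
  by move=> w [/= P'w A'w]; apply: AP; split; [rewrite -P'E|exact: A'A].
exists (Q, P', A'); first by [].
rewrite /g /=; have /= := xgetI 0 T0.
case: xgetP => // zeta -> [x1 [Qx1 A'x1 P'x1 -> h]] _.
(* The chosen base may come from another point [x1], but the inclusion recorded in [T] puts [x] on
   the slice of [x1], so the plaques are equal. *)
have := h x; rewrite /= P'E => /(_ (conj P'x A'x)) /(plaque_at_eq wQ).
by rewrite /plaque_at => ->.
Qed.

Lemma leaf_plaques_countable : countable leaf_plaques.
Proof. by apply: bigcup_countable => // m _; exact: reach_countable. Qed.

Lemma leaf_plaques_leafy P : leaf_plaques P -> exists Q x,
  [/\ B Q, cdom (pchart Q) x, has_rank x & P = plaque_at Q x].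
Proof. by move=> [m _]; exact: reach_leafy. Qed.

Lemma leaf_plaques_step P Q x : leaf_plaques P -> plaque_set P x -> B Q -> cdom (pchart Q) x ->
  leaf_plaques (plaque_at Q x).
Proof. by move=> [m _ rP] Px BQ Qx; exists m.+1 => //; exists Q, x; split=> //; exists P. Qed.

Lemma leaf_glues : exists S, glues leaf_plaques S.
Proof.
apply: glue_plaques; first exact: leaf_plaques_countable.
  by move=> _ /leaf_plaques_leafy [Q [x [/lB /leafy_wf wQ _ _ ->]]].
move=> _ P x /leaf_plaques_leafy [Q [z [BQ Qz rz ->]]].
move=> /leaf_plaques_leafy [Q' [z' [BQ' Q'z' rz' ->]]] Qx Q'x.
have [cx _] := Q'x.
have [A [oA Ax AP]] := plaque_overlap (lB BQ) Qz rz (lB BQ') cx Qx.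
exists A; split=> //.
by rewrite (plaque_at_eq (leafy_wf (lB BQ')) Q'x) in AP.
Qed.

Variables (S : submanifold M) (gS : glues leaf_plaques S).

Lemma leaf_supportE x : support_set S x <-> exists2 P, leaf_plaques P & plaque_set P x.
Proof. by have [_ -> _ _ _] := gS; split=> -[P]; exists P. Qed.

Lemma leaf_sub : support_set S `<=` V.
Proof.
move=> x /leaf_supportE [_ /leaf_plaques_leafy [Q [z [BQ Qz _ ->]]] [Qx _]].
by have [_ _ QV _ _] := lB BQ; exact: QV.
Qed.

Lemma leaf_start : support_set S x0.
Proof.
have [Q BQ Qx] := coverB Vx0 rx0; apply/leaf_supportE; exists (plaque_at Q x0).
  by exists 0%N => //; exists Q.
by apply: plaque_set_at_refl => //; exact: leafy_wf (lB BQ).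
Qed.

Lemma leaf_characteristic : characteristic S.
Proof.
apply: (glues_characteristic gS).
  by move=> _ /leaf_plaques_leafy [Q [z [/lB [aQ _ _ _ _] _ _ ->]]].
move=> _ x /leaf_plaques_leafy [Q [z [/lB lQ Qz rz ->]]]; exact: leafy_bivec lQ Qz rz.
Qed.

(** The parameters sent into the leaf form a clopen set, as membership passes along a plaque in both
    directions. For inclusions this gives the maximality of the leaf; for Hamiltonian rays it puts
    their end points on the leaf. *)
Lemma leaf_absorbs (T : topologicalType) (g : T -> M) t0 : connected [set: T] ->
  leafwise g -> support_set S (g t0) -> forall t, support_set S (g t).
Proof.
move=> cT [gV gl]; apply: (connected_clopen (U := g @^-1` support_set S) cT).
- rewrite openE => t /leaf_supportE [P lP Pt]; have [Vt rt] := gV t.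
  have [Q BQ Qt] := coverB Vt rt.
  have := gl t Q (lB BQ) Qt; apply: filterS => s Qs.
  apply/leaf_supportE; exists (plaque_at Q (g t)) => //.
  exact: leaf_plaques_step lP Pt BQ Qt.
- rewrite openE => t nt; have [Vt rt] := gV t.
  have [Q BQ Qt] := coverB Vt rt; have wQ := leafy_wf (lB BQ).
  have := gl t Q (lB BQ) Qt; apply: filterS => s Qs /leaf_supportE [P lP Ps].
  apply: nt; apply/leaf_supportE; exists (plaque_at Q (g s)).
    by apply: leaf_plaques_step lP Ps BQ _; case: Qs.
  by rewrite (plaque_at_eq wQ Qs); exact: plaque_set_at_refl.
Qed.

(** A clopen set is pulled back to the real line along the segment joining the two points in the
    convex chart image; the open-set clause of [glues] makes the pull-back clopen. *)
Lemma plaque_connected P (W : set S) (y z : S) : leaf_plaques P -> open W -> open (~` W) ->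
  plaque_set P (incl y) -> plaque_set P (incl z) -> W y -> W z.
Proof.
move=> lP oW oCW Py Pz Wy.
have [Q [x [BQ Qx _ PE]]] := leaf_plaques_leafy lP.
have [_ _ _ convQ _] := lB BQ.
have wP : plaque_wf P by rewrite PE; exact: leafy_wf (lB BQ).
set u0 := pcoo P (incl y); set u1 := pcoo P (incl z).
pose w (t : R) := u0 + clamp01 t *: (u1 - u0).
have Iw t : pimg P (w t).
  rewrite /pimg /=.
  have -> : paff P (w t) = paff P u0 + clamp01 t *: (paff P u1 - paff P u0).
    rewrite /paff /w mulmxDl -scalemxAl mulmxBl.
    by apply/rowP => j; rewrite !mxE; ring.
  have convP : convexs (cimg (pchart P)) by rewrite PE.
  by apply: convP (clamp01_itv t); exact: pcoo_img.
pose g t := ppoint P (w t).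
have Pg t : plaque_set P (g t) by have [] := ppointP wP (Iw t).
have cg t : {for t, continuous g}.
  apply: continuous_comp; last exact: continuous_ppoint.
  apply: (@continuous_comp _ _ _ clamp01 (fun t : R => u0 + t *: (u1 - u0))).
    exact: continuous_clamp01.
  exact: continuous_line.
have Sg t : exists y' : S, incl y' = g t.
  suff /leaf_supportE [y' _ e] : exists2 P, leaf_plaques P & plaque_set P (g t) by exists y'.
  by exists P.
have [_ _ oS _ _] := gS.
have H (U : set S) : open U -> open [set t | exists2 y', U y' & incl y' = g t].
  move=> oU; rewrite openE => t [y' Uy' yt].
  have Py' : plaque_set P (incl y') by rewrite yt.
  have [A [oA Ay AU]] := oS U oU y' P Uy' lP Py'.
  rewrite yt in Ay.
  have nA : nbhs t [set s | A (g s)] := cg t A (open_nbhs_nbhs (conj oA Ay)).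
  apply: filterS nA => s As.
  by have [y'' e] := Sg s; exists y'' => //; apply: AU; rewrite e.
pose A := [set t | exists2 y', W y' & incl y' = g t].
have CA : ~` A = [set t | exists2 y', (~` W) y' & incl y' = g t].
  apply/seteqP; split=> t.
    by move=> nA; have [y' e] := Sg t; exists y' => // Wy'; apply: nA; exists y'.
  by move=> [y' nW e] [y'' Wy'' e']; apply: nW; rewrite (incl_inj (etrans e (esym e'))).
have A0 : A 0.
  exists y => //; rewrite /g /w clamp01_id ?lexx ?ler01 // scale0r addr0.
  by rewrite ppointK.
have := connected_clopen (@connected_line R) (H W oW) _ A0.
rewrite -/A CA => /(_ (H _ oCW) 1) [z' Wz'].
rewrite /g /w clamp01_id ?lexx ?ler01 // scale1r addrC subrK ppointK //.
by move=> /incl_inj <-.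
Qed.

(** Consecutive plaques of a chain share a point, so a clopen set containing the start spreads by
    induction on the length. *)
Lemma leaf_connected : connected [set: S].
Proof.
have [y0 _ yx0] := leaf_start.
have H (W : set S) : open W -> open (~` W) -> W y0 -> W = setT.
  move=> oW oCW W0; suff K m P (y : S) : reach m P -> plaque_set P (incl y) -> W y.
    apply/seteqP; split=> // y _.
    have /leaf_supportE [P [m _ rP] Py] : support_set S (incl y) by exists y.
    exact: K rP Py.
  elim: m P y => [|m IH] P y rP Py.
    have [Q [BQ Qx PE]] := rP.
    apply: (plaque_connected (P := P) _ oW oCW _ Py W0); first by exists 0%N.
    by rewrite PE yx0; exact: plaque_set_at_refl (leafy_wf (lB BQ)) Qx.
  have [Q [x [BQ Qx PE [P' rP' P'x]]]] := rP.
  have /leaf_supportE [z _ zx] : exists2 P, leaf_plaques P & plaque_set P x.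
    by exists P' => //; exists m.
  apply: (plaque_connected (P := P) (y := z) _ oW oCW _ Py); first by exists m.+1.
    by rewrite PE zx; exact: plaque_set_at_refl (leafy_wf (lB BQ)) Qx.
  by apply: IH rP' _; rewrite zx.
move=> U [y1 Uy1] [C oC]; rewrite setTI => UC [C' cC']; rewrite setTI => UC'.
have oU : open U by rewrite UC.
have oCU : open (~` U) by rewrite UC'; exact: closed_openC.
have [|nU] := pselect (U y0); first exact: H.
have := H _ oCU; rewrite setCK => /(_ oU nU) e.
by have : (~` U) y1 by rewrite e.
Qed.

End Leaf.

Theorem leaf_exists x0 : V x0 -> has_rank x0 -> exists S : submanifold M,
  [/\ integral_in pi V S, support_set S x0, sdim S = k &
    forall (T : topologicalType) (g : T -> M) t0, connected [set: T] ->
    leafwise g -> support_set S (g t0) -> forall t, support_set S (g t)].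
Proof.
move=> Vx0 rx0; have [B cB [lB coverB]] := leafy_cover.
have [S gS] := leaf_glues cB lB rx0.
exists S; split.
- split; first exact: leaf_connected lB coverB Vx0 rx0 S gS.
    exact: leaf_sub lB rx0 S gS.
  exact: leaf_characteristic lB rx0 S gS.
- exact: leaf_start coverB Vx0 rx0 S gS.
- by case: gS.
- by move=> T g t0; apply: leaf_absorbs gS T g t0.
Qed.

(** In a leafy chart the normal component of the segment has zero derivative, because [v] stays in
    the image of the bivector. Clamping defines the curve on the whole line, which is connected. *)
Lemma line_leafwise c (q v : 'rV[R]_n) : atlas c ->
  (forall t : R, 0 <= t <= 1 -> let y := q + t *: v in
    [/\ cimg c y, V (cinv c y), has_rank (cinv c y) & (v <= bivec pi c (cinv c y))%MS]) ->
  leafwise (fun t => cinv c (q + clamp01 t *: v)).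
Proof.
move=> ac H; pose y (t : R) := q + t *: v.
split=> [t|t Q lQ Qt]; first by have [] := H _ (clamp01_itv t).
have [aQ EA QV _ _] := lQ; have wQ := leafy_wf lQ.
set t0 := clamp01 t in Qt *; have t0i : 0 <= t0 <= 1 by exact: clamp01_itv.
have [I0 _ r0 _] := H _ t0i.
pose f := transition c (pchart Q).
have oO := @overlap_open _ _ _ c (pchart Q).
have O0 : overlap c (pchart Q) (y t0).
  by have [h1 h2] := cinvP I0; exists (cinv c (y t0)).
have Cf := transition_Cmx 1 ac aQ.
have /nbhs_ballP [rho /= rho0 hrho] : nbhs t0 [set s | overlap c (pchart Q) (y s)].
  by apply: (@continuous_line R n q v); exact: nbhs_open.
have n1 : \forall s \near t, `|t0 - clamp01 s| < rho.
  exact: (@continuous_clamp01 R t _ (nbhsx_ballx t0 rho rho0)).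
apply: filterS n1 => s; set s0 := clamp01 s => sr.
have s0i : 0 <= s0 <= 1 by exact: clamp01_itv.
have Os (u : R) : 0 <= u <= 1 -> 0 <= t0 + u * (s0 - t0) <= 1 /\
    overlap c (pchart Q) (y (t0 + u * (s0 - t0))).
  move=> /andP[u0 u1]; split.
    have /andP[a0 a1] := t0i; have /andP[b0 b1] := s0i.
    have -> : t0 + u * (s0 - t0) = (1 - u) * t0 + u * s0 by ring.
    apply/andP; split; first by rewrite addr_ge0 // mulr_ge0 // subr_ge0.
    have h : (1 - u) * t0 + u * s0 <= (1 - u) * 1 + u * 1.
      by apply: lerD; apply: ler_wpM2l; rewrite ?subr_ge0.
    by apply: le_trans h _; rewrite !mulr1 subrK.
  apply: hrho; rewrite /ball /= opprD addNKr normrN normrM ger0_norm //.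
  by apply: le_lt_trans sr; rewrite distrC ler_piMl.
(* The times between [t0] and [s0], in either order, are reparametrised by [u] in [[0, 1]]. *)
pose g (u : R) := (f (y (t0 + u * (s0 - t0))) - cmap (pchart Q) (cinv c (y t0))) *m pcut Q.
pose b := y t0; pose e := (s0 - t0) *: v.
have yE (u : R) : y (t0 + u * (s0 - t0)) = b + u *: e.
  by rewrite /y /b /y /e scalerDl addrA scalerA.
have dg (u : R) : 0 <= u <= 1 -> is_derive u 1 g 0.
  move=> ui; have [wi Ou] := Os u ui.
  have d1 : is_derive u 1 (fun u : R => f (b + u *: e)) (e *m jacobian f (b + u *: e)).
    by apply/is_derive_line; apply: is_derive_jacobian oO Cf _; rewrite -yE.
  have := is_derive_mulmx (is_deriveB d1 (is_derive_cst (cmap (pchart Q) (cinv c (y t0))) u 1))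
    (is_derive_cst (pcut Q) u 1).
  rewrite mulmx0 addr0 subr0.
  suff -> : e *m jacobian f (b + u *: e) *m pcut Q = 0.
    by congr is_derive; apply/funext => u'; rewrite /g yE.
  have [Iw Vw rw vw] := H _ wi; rewrite -/(y _) yE in Iw Vw rw vw.
  have [z [cz Qz] zE] := Ou; rewrite yE in zE.
  have zE' : cinv c (b + u *: e) = z by rewrite -zE cmapK.
  rewrite zE' in vw rw.
  rewrite /e -!scalemxAl; apply/eqP; rewrite scaler_eq0; apply/orP; right.
  have hb := leafy_bivec lQ Qz rw (plaque_set_at_refl wQ Qz).
  have he := bivec_eqmx pi ac aQ cz Qz; rewrite /Jt zE in he.
  have : (v *m jacobian f (b + u *: e)%R <= pdir Q)%MS.
    by rewrite -hb he; exact: submxMr.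
  by move=> /submxP [G ->]; rewrite -mulmxA pdir_cut // mulmx0.
have cg : continuous01 g.
  by move=> u /dg [h _]; apply/differentiable_continuous/derivable1_diffP.
have dg1 (u : R) : 0 < u < 1 -> is_derive u 1 g 0.
  by move=> /andP[/ltW u0 /ltW u1]; apply: dg; rewrite u0 u1.
have i1 : 0 <= (1 : R) <= 1 by rewrite ler01 lexx.
have e1 : t0 + 1 * (s0 - t0) = s0 by rewrite mul1r addrC subrK.
have g01 := constant01 cg dg1 i1.
have O1 : overlap c (pchart Q) (y s0).
  by have [_] := Os 1 i1; rewrite e1.
have [z [cz Qz] zE] := O1.
have zE' : cinv c (y s0) = z by rewrite -zE cmapK.
rewrite plaque_set_atE //; split; first by rewrite zE'.
move: g01; rewrite /g e1 mul0r addr0.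
rewrite /f /transition /= -/(y t0) -/(y s0) subrr mul0mx.
by [].
Qed.

End Leaves.

Lemma local_lipschitz (R : realType) n p q (U : set 'rV[R]_n)
    (Z : 'rV[R]_n -> 'M[R]_(p, q)) x0 : open U -> Cmx 1 U Z -> U x0 ->
  exists rho L : R, [/\ 0 < rho, 0 <= L & forall x y,
    oball x0 rho x -> oball x0 rho y -> `|Z y - Z x| <= L * `|y - x|].
Proof.
move=> oU CZ Ux0; have [rho rho0 hrho] := nbhs_cball (open_near oU Ux0).
have /choice [L LP] : forall i : 'I_p, exists L, 0 <= L /\ forall x y,
    cball x0 rho x -> cball x0 rho y -> `|row i (Z y) - row i (Z x)| <= L * `|y - x|.
  move=> i; have [|L L0 LP] := @C1_lipschitz R n q U (cball x0 rho) (fun x => row i (Z x)) oU _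
    (@cball_closed _ _ _ _) (@cball_bounded _ _ _ _) (@cball_convex _ _ _ _) hrho.
    by move=> a b; under eq_fun do rewrite mxE; exact: CZ.
  by exists L.
exists rho, (\sum_i L i); split=> //.
  by apply: sumr_ge0 => i _; have [] := LP i.
move=> x y /oball_cball xB /oball_cball yB; apply: mx_norm_le => [|i j].
  by rewrite mulr_ge0 //; apply: sumr_ge0 => i _; have [] := LP i.
have [Li0 /(_ x y xB yB) h] := LP i.
have := ler_mxE (row i (Z y) - row i (Z x)) 0 j; rewrite !mxE => h1.
apply: le_trans h1 _; apply: le_trans h _.
rewrite ler_wpM2r // (bigD1 i) //= lerDl.
by apply: sumr_ge0 => i' _; have [] := LP i'.
Qed.

Lemma norm_mulmx_le (R : realType) p q r (A : 'M[R]_(p, q)) (B : 'M[R]_(q, r)) a b :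
  `|A| <= a -> `|B| <= b -> `|A *m B| <= q%:R * a * b.
Proof.
move=> Aa Bb; apply: le_trans (norm_mulmx _ _) _.
by apply: ler_pM; rewrite ?mulr_ge0 ?ler_wpM2l.
Qed.

(** * Leaves through points and sets they cannot leave *)

Section PoissonManifold.
Context {R : realType} {n : nat} {M : manifold R n} (pi : poisson M).

Lemma has_rank_uniq k k' (x : M) : has_rank pi k x -> has_rank pi k' x -> k = k'.
Proof.
by move=> h h'; have [c ac cx] := atlas_cover x; rewrite -(h c (conj ac cx)) -(h' c (conj ac cx)).
Qed.

Lemma characteristic_rank (L : submanifold M) (y : L) : characteristic pi L ->
  has_rank pi (sdim L) (incl y).
Proof.
move=> cL c hc; have [d ad dy] := atlas_cover y.
by have /eqmxP <- := cL y d c (conj ad dy) hc; rewrite rank_tangent.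
Qed.

Lemma integral_in_leafwise V (L : submanifold M) : integral_in pi V L ->
  leafwise pi V (sdim L) (@incl R n M L).
Proof. by move=> [_ LV cL]; exact: characteristic_leafwise. Qed.

(** Maximality: an integral submanifold containing the leaf has the same dimension, as the rank at a
    common point determines it; its inclusion is then leafwise and is absorbed. *)
Lemma leaf_through (V : set M) k x : open V -> V x -> has_rank pi k x ->
  exists S : submanifold M, [/\ symplectic_leaf pi V S, support_set S x &
    forall (T : topologicalType) (g : T -> M) t0, connected [set: T] ->
    leafwise pi V k g -> support_set S (g t0) -> forall t, support_set S (g t)].
Proof.
move=> oV Vx rx; have [S [iS Sx dS aS]] := leaf_exists oV Vx rx.
exists S; split=> //; split=> // L' iL' SL'.
apply/seteqP; split=> //.
have [y _ yx] := SL' x Sx.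
have rL' := integral_in_leafwise iL'.
have e : sdim L' = k.
  have [_ _ cL'] := iL'; have := @characteristic_rank L' y cL'.
  by rewrite yx => r'; exact: has_rank_uniq r' rx.
have {}rL' : leafwise pi V k (@incl R n M L') by rewrite -e.
have [cn _ _] := iL'.
move=> z [y' _ <-]; apply: (aS _ _ y cn rL').
by rewrite yx.
Qed.

(** The two halves of a connectedness argument: closedness relative to [V], and openness along every
    integral submanifold, connected or not. *)
Definition absorbing (V A : set M) :=
  (forall x, V x -> ~ A x -> nbhs x (~` A)) /\
  forall (L : submanifold M) (y : L), characteristic pi L -> support_set L `<=` V ->
    A (incl y) -> \forall z \near y, A (incl z).

Lemma absorbing_sub V A (L : submanifold M) x : absorbing V A -> integral_in pi V L ->
  support_set L x -> A x -> support_set L `<=` A.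
Proof.
move=> [A1 A2] [cn LV cL] [y _ yx] Ax z [y' _ <-].
apply: (connected_clopen (U := [set y | A (incl y)]) (t0 := y) cn); last by rewrite /= yx.
- by rewrite openE => w Aw; exact: A2.
- rewrite openE => w nAw; have : nbhs (incl w) (~` A).
    by apply: A1 => //; apply: LV; exists w.
  exact: (@incl_continuous R n M L w).
Qed.

Lemma continuous_tangent (L : submanifold M) (y : L) d c : chart_at y d -> chart_at (incl y) c ->
  {for y, continuous (@tangent_mx R n M L d c)}.
Proof.
move=> [ad dy] [ac cy].
apply: (@continuous_comp _ _ _ (cmap d) (jacobian (local_expr (@incl R n M L) d c))).
  exact: cmap_continuous.
have U0 : sdomain d c (cmap d y) by exists y.
have oU := @sdomain_open R n M L d c.
exact: Cmx_continuous (Cmx_jacobian oU (local_expr_Cmx 1 ad ac)) U0.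
Qed.

Lemma near_norm_bounded (T : topologicalType) p q (f : T -> 'M[R]_(p, q)) x :
  {for x, continuous f} -> \forall y \near x, `|f y| <= `|f x| + 1.
Proof.
move=> /cvgrPdist_lt /(_ 1 ltr01); apply: filterS => y h.
rewrite -[f y](subKr (f x)); apply: le_trans (ler_normB _ _) _.
by rewrite lerD2l; exact: ltW.
Qed.

(* By Lipschitz continuity the component of [pi] normal to the plaque is bounded
   by the distance to the plaque, and by the Schur complement the tangent vectors
   of [L] are bounded combinations of the rows of [pi]. *)
Lemma poisson_plaque_local m (Q : plaque M m) (L : submanifold M) (y : L) :
  plaque_wf Q -> (forall z, plaque_set Q z -> bivec pi (pchart Q) z *m pcut Q = 0) ->
  characteristic pi L -> plaque_set Q (incl y) -> \forall z \near y, plaque_set Q (incl z).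
Proof.
move=> wQ PQ cL [cy yQ]; have [aQ _] := wQ.
set c := pchart Q in PQ cy yQ aQ *; set K := pcut Q in PQ yQ *; set w := pbase Q in yQ *.
have [d ad dy] := atlas_cover y.
have [oI CP sk _] := poisson_on_chart pi aQ; set B := cbivec pi c in CP sk.
set x0 := cmap c (incl y).
have Ix0 : cimg c x0 by exact: cimgP.
have Bz z : cdom c z -> B (cmap c z) = bivec pi c z by move=> cz; rewrite /B /cbivec cmapK.
(* Along [L] the rank is constantly the dimension of [L], so a minor invertible at [y] determines
   the whole bivector at nearby points of [L]. *)
have rB (z : L) : cdom c (incl z) -> \rank (B (cmap c (incl z))) = sdim L.
  by move=> cz; rewrite Bz //; exact: (@characteristic_rank L z cL c (conj aQ cz)).
have [A0 A0u] := skew_minor (sk _ Ix0).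
have e0 : \rank (B x0) = sdim L by exact: rB.
rewrite e0 in A0 A0u.
pose Cm x := A0^T *m B x *m A0.
have CC k : Cmx k (cimg c) Cm.
  by apply: CmxM => //; [apply: CmxM => //; exact: Cmx_cst|exact: Cmx_cst].
pose U := [set x | cimg c x /\ Cm x \in unitmx].
have oU : open U by exact: unitmx_open.
have U0 : U x0 by split.
pose E x := A0 *m invmx (Cm x) *m A0^T.
have cE : {for x0, continuous E}.
  apply: continuous_mulmx; last exact: cst_continuous.
  apply: continuous_mulmx; first exact: cst_continuous.
  apply: Cmx_continuous U0; apply: Cmx_inv => //; first by move=> x [].
  by apply: Cmx_sub (CC 0%N) => x [].
have [rho [Lc [rho0 Lc0 Lip]]] := local_lipschitz oI (CP 1%N) Ix0.
(* The projection onto the slice of [Q], where the normal part of the bivector vanishes. *)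
pose pr x := x - (x - w) *m K.
have cpr : {for x0, continuous pr}.
  apply: continuousB; first exact: cvg_id.
  apply: continuous_mulmx; last exact: cst_continuous.
  by apply: continuousB; [exact: cvg_id|exact: cst_continuous].
have pr0 : pr x0 = x0 by rewrite /pr yQ subr0.
have n1 : \forall x \near x0, U x by exact: open_near.
have n2 : \forall x \near x0, oball x0 rho x by exact: nbhs_oballW.
have n3 : \forall x \near x0, oball x0 rho (pr x) /\ cimg c (pr x).
  have h : nbhs (pr x0) (oball x0 rho `&` cimg c).
    by rewrite pr0; apply: filterI; [exact: nbhs_oballW|exact: open_near].
  exact: cpr _ h.
have n4 := near_norm_bounded cE.
have cx : {for y, continuous (cmap c \o @incl R n M L)}.
  apply: continuous_comp; first exact: incl_continuous.
  exact: cmap_continuous.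
pose N := [set x | [/\ U x, oball x0 rho x, oball x0 rho (pr x), cimg c (pr x) &
  `|E x| <= `|E x0| + 1]].
have nN : nbhs x0 N.
  by apply: filterS2 (filterI n1 n2) (filterI n3 n4) => x [? ?] [[? ?] ?].
have n5 : \forall z \near y, N (cmap c (incl z)) by exact: cx _ nN.
have n6 := near_norm_bounded (continuous_tangent (conj ad dy) (conj aQ cy)).
have n7 : \forall z \near y, cdom c (incl z).
  by apply: incl_continuous; exact: nbhs_open (cdom_open c) cy.
have n8 : \forall z \near y, cdom d z by exact: nbhs_open (cdom_open d) dy.
set b1 := `|E x0| + 1 in N n4 nN n5; set b2 := `|_| + 1 in n6.
have b10 : 0 <= b1 by rewrite addr_ge0.
have b20 : 0 <= b2 by rewrite addr_ge0.
have near_y : \forall z \near y, `|tangent_mx d c z *m K| <=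
    n%:R * b2 * (n%:R * b1 * (n%:R * Lc * `|K|)) * `|(cmap c (incl z) - w) *m K|.
  apply: filterS2 n5 (filterI n6 (filterI n7 n8)) => z [z1 z2 z3 z3' z4] [z6 [z7 z8]].
  set x := cmap c (incl z) in z1 z2 z3 z3' z4 *.
  have [G GE] : exists G, tangent_mx d c z = G *m B x.
    apply/submxP; rewrite Bz //.
    by have /eqmxP -> := cL z d c (conj ad z8) (conj aQ z7).
  have Bs : B x = B x *m A0 *m invmx (Cm x) *m A0^T *m B x.
    by apply: rank_schur; [case: z1|exact: rB].
  (* [E x] is a generalised inverse of [B x], bounded near [y]; it replaces the uncontrolled
     coefficient [G] by a bounded one. *)
  have TE : tangent_mx d c z = tangent_mx d c z *m E x *m B x.
    by rewrite GE {1}Bs /E !mulmxA.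
  have prK : B (pr x) *m K = 0.
    have [h1 h2] := cinvP z3'; apply: (PQ (cinv c (pr x))); split=> //.
    rewrite -/c h2 /pr -/K -/w addrAC mulmxBl -mulmxA /K pcut_idem //.
    by rewrite subrr.
  have BK : `|B x *m K| <= n%:R * Lc * `|(x - w) *m K| * `|K|.
    have -> : B x *m K = (B x - B (pr x)) *m K by rewrite mulmxBl prK subr0.
    apply: le_trans (norm_mulmx _ _) _; rewrite ler_wpM2r // -mulrA ler_wpM2l //.
    have := Lip (pr x) x z3 z2.
    suff -> : x - pr x = (x - w) *m K by [].
    by rewrite /pr opprB [LHS]addrC subrK.
  rewrite TE -(mulmxA _ (B x)) -(mulmxA _ (E x)).
  have h1 := norm_mulmx_le z6 (norm_mulmx_le z4 BK).
  by apply: le_trans h1 _; rewrite -!mulrA [X in _ * (_ * (_ * (_ * (_ * (_ * X)))))]mulrC.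
by have := slice_local (conj ad dy) aQ cy yQ near_y; apply: filterS => z [].
Qed.

End PoissonManifold.

(** * Tubes around a coregular submanifold *)

Section Straightening.
Context {R : realType} {n : nat} {M : manifold R n} (S : submanifold M).

Lemma tangent_eqmx d d' c (y : S) : chart_at y d -> chart_at y d' -> chart_at (incl y) c ->
  (tangent_mx d' c y :=: tangent_mx d c y)%MS.
Proof.
move=> [ad dy] [ad' d'y] [ac cy].
have U1 : sdomain d c (cmap d y) by exists y.
have U2 : sdomain d' c (cmap d' y) by exists y.
have W1 : overlap d' d (cmap d' y) by exists y.
have C1 := local_expr_Cmx 1 ad ac.
have C2 := local_expr_Cmx 1 ad' ac.
have C3 := @transition_Cmx R _ S d' d 1 ad' ad.
have tE : transition d' d (cmap d' y) = cmap d y by exact: transitionK.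
pose W : set 'rV[R]_(sdim S) := cmap d' @` (cdom d' `&` (cdom d `&` @incl R n M S @^-1` cdom c)).
have oW : open W.
  apply: chart_open_img; apply: openI; first exact: cdom_open.
  apply: open_comp (cdom_open c) => z _; exact: incl_continuous.
have Wy : W (cmap d' y) by exists y.
have CW : Cmx 1 W (transition d' d).
  by apply: Cmx_sub C3 => _ [z [dz [bz _]] <-]; exists z.
have US : sdomain d c (transition d' d (cmap d' y)) by rewrite tE.
have E : tangent_mx d' c y = Jt d' d y *m tangent_mx d c y.
  rewrite /tangent_mx /differential_mx /Jt -tE.
  rewrite -(jacobian_comp oW (@sdomain_open _ _ _ _ d c) Wy US C1 CW).
  apply: jacobian_near.
  - apply: filterS (open_near oW Wy) => _ [z [dz [bz cz]] <-].
    by rewrite /local_expr /transition /= !cmapK.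
  - exact: C1_differentiable_rV (@sdomain_open _ _ _ _ d' c) C2 U2.
  - apply: (differentiable_comp (C1_differentiable_rV oW CW Wy)).
    exact: C1_differentiable_rV (@sdomain_open _ _ _ _ d c) C1 US.
by rewrite E; apply: eqmxMfull; rewrite row_full_unit Jt_unit.
Qed.

Lemma diffeo_sym (m : nat) (A B : set 'rV[R]_m) f g : diffeo A B f g -> diffeo B A g f.
Proof. by move=> [oA oB fP gP C]; split=> // k; have [] := C k. Qed.

(** [Th] follows the parametrisation [f] of [S] in the directions seen by [A] and translates in the
    complementary directions [K]. Its Jacobian at [p] is [A J + (1 - A J) = 1], and it maps the
    slice [p + v J] into [S]; its local inverse is the change of chart. *)
Theorem straighten (y0 : S) : embedded S -> exists Q : plaque M (sdim S),
  [/\ plaque_wf Q, cdom (pchart Q) (incl y0), pbase Q = cmap (pchart Q) (incl y0),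
    forall x, cdom (pchart Q) x -> (support_set S x <-> plaque_set Q x) &
    forall (y : S) d, chart_at y d -> cdom (pchart Q) (incl y) ->
      (tangent_mx d (pchart Q) y :=: pdir Q)%MS].
Proof.
move=> emb; have [d ad dy0] := atlas_cover y0.
set x0 := incl y0; have [c1 ac1 c1x0] := atlas_cover x0.
set u0 := cmap d y0; set p := cmap c1 x0.
pose f := local_expr (@incl R n M S) d c1.
have fE z : cdom d z -> f (cmap d z) = cmap c1 (incl z).
  by move=> dz; rewrite /f /local_expr /comp cmapK.
have oU := @sdomain_open R n M S d c1.
have U0 : sdomain d c1 u0 by exists y0.
have Cf k := local_expr_Cmx k ad ac1.
set J := jacobian f u0.
have /row_freeP [A JA] : row_free J by exact: (tangent_free (conj ad dy0) (conj ac1 c1x0)).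
pose K := 1%:M - A *m J.
have JK : J *m K = 0 by rewrite mulmxBr mulmx1 mulmxA JA mul1mx subrr.
have KA : K *m A = 0 by rewrite mulmxBl mul1mx -mulmxA JA mulmx1 subrr.
pose a (eta : 'rV[R]_n) := u0 + (eta - p) *m A.
pose Th eta := f (a eta) + (eta - p) *m K.
have ca : continuous a.
  move=> eta; suff : {for eta, continuous a} by [].
  apply: continuousD; first exact: cst_continuous.
  exact: continuous_subW.
have ap : a p = u0 by rewrite /a subrr mul0mx addr0.
have fu0 : f u0 = p by rewrite /u0 fE.
have Thp : Th p = p by rewrite /Th ap subrr mul0mx addr0 fu0.
pose U1 := a @^-1` sdomain d c1.
have oU1 : open U1 by apply: open_comp oU => eta _; exact: ca.
have Ca k V : open V -> Cmx k V a.
  move=> oV; apply: CmxD => //; first exact: Cmx_cst.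
  apply: CmxM => //; last exact: Cmx_cst.
  by apply: CmxB => //; [exact: Cmx_id|exact: Cmx_cst].
have CTh1 k : Cmx k U1 Th.
  apply: CmxD => //.
    exact: (Cmx_comp oU1 oU (fun _ h => h) (Cf k) (Ca k _ oU1)).
  apply: CmxM => //; last exact: Cmx_cst.
  by apply: CmxB => //; [exact: Cmx_id|exact: Cmx_cst].
pose U2 := U1 `&` Th @^-1` cimg c1.
have U2p : U2 p by split; [rewrite /U1 /= ap|rewrite /= Thp; exact: cimgP].
have oU2 : open U2.
  rewrite openE => eta [h1 h2]; apply: filterI; first exact: open_near.
  by apply: (Cmx_continuous (CTh1 0%N) h1); apply: nbhs_open => //; exact: cimg_open.
have CTh k : Cmx k U2 Th by apply: Cmx_sub (CTh1 k) => eta [].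
have JTh : jacobian Th p = 1%:M.
  apply: jacobian_eq; first exact: C1_differentiable_rV oU2 (CTh 1%N) U2p.
  move=> v; rewrite mulmx1.
  have d1 : is_derive p v (fun eta => eta - p) v.
    by have := is_deriveB (is_derive_id p v) (is_derive_cst p p v); rewrite subr0.
  have d2 : is_derive p v a (v *m A).
    have := is_deriveD (is_derive_cst u0 p v) (is_derive_mulmx d1 (is_derive_cst A p v)).
    by rewrite add0r mulmx0 addr0.
  have d3 := is_derive_mulmx d1 (is_derive_cst K p v).
  rewrite mulmx0 addr0 in d3.
  have U0' : sdomain d c1 (a p) by rewrite ap.
  have := is_deriveD (is_derive_comp_jacobian oU (Cf 1%N) U0' d2) d3.
  congr is_derive; rewrite ap -/J /K mulmxBr mulmx1 mulmxA.
  by rewrite addrC subrK.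
have [|V [V' [g [Vp VU DV]]]] := inverse_function oU2 U2p CTh; first by rewrite JTh unitmx1.
have [oV oV' ThP gP Cg] := DV.
have V'I : V' `<=` cimg c1 by move=> y /gP [/VU [_ h] e]; rewrite -e.
pose c2 := straight_chart (diffeo_sym DV) V'I.
have ac2 : atlas c2 by exact: straight_atlas.
have [rho rho0 hrho] : exists2 rho, 0 < rho & oball u0 rho `<=`
    [set u | sdomain d c1 u /\ V (p + (u - u0) *m J)].
  apply: nbhs_oball; apply: filterI; first exact: open_near.
  have cc : {for u0, continuous (fun u : 'rV[R]_(sdim S) => p + (u - u0) *m J)}.
    apply: continuousD; first exact: cst_continuous.
    exact: continuous_subW.
  by apply: cc; rewrite subrr mul0mx addr0; exact: open_near.
have gE u : oball u0 rho u -> g (f u) = p + (u - u0) *m J.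
  move=> uB; have [_ Vu] := hrho u uB; have [_ h] := ThP _ Vu.
  rewrite -[RHS]h; congr (g _).
  have e : p + (u - u0) *m J - p = (u - u0) *m J by rewrite addrAC subrr add0r.
  rewrite /Th /a e -!mulmxA JA JK mulmx1 mulmx0 addr0.
  by congr f; rewrite addrC subrK.
pose W := cdom d `&` cmap d @^-1` oball u0 rho.
have oW : open W by apply: chart_open_preimg; exact: oball_open.
(* Embeddedness excludes further sheets: every point of [S] in [N] comes from the parametrised piece
   [W]. *)
have [N oN WN] := emb W oW.
have [c [ac cdE cmE _]] := restrict_chart ac2 oN.
have WNy y : W y <-> N (incl y) by rewrite WN.
have cgE y : W y -> cmap c (incl y) = p + (cmap d y - u0) *m J.
  by move=> [dy yB]; rewrite cmE /= -fE // gE.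
have Wy0 : W y0 by split=> //; exact: oball_center.
have cx0 : cmap c x0 = p by rewrite cgE // subrr mul0mx addr0.
have cdx0 : cdom c x0.
  rewrite cdE; split; last exact/WNy.
  split; first exact: c1x0.
  by have [h _] := ThP p Vp; rewrite Thp in h.
exists (Plaque c p J A); split.
- by split.
- exact: cdx0.
- exact: esym cx0.
- move=> x; rewrite [cdom _]cdE => -[[c1x V'x] Nx]; split.
    move=> [y _ yx]; split; first by rewrite /= cdE.
    have Wy : W y by apply/WNy; rewrite yx.
    by rewrite /= -yx cgE // addrAC subrr add0r -mulmxA JK mulmx0.
  move=> [_]; rewrite /= cmE /= => h; rewrite -/(K) in h.
  have [Vg e] := gP _ V'x; have [[y [dy cy] yE] _] := VU _ Vg.
  have : Th (g (cmap c1 x)) = f (cmap d y) by rewrite /Th yE h addr0.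
  rewrite e fE // => e'; exists y => //.
  by rewrite -(cmapK cy) -e' cmapK.
- move=> y d' hd' cy.
  have Wy : W y by apply/WNy; move: cy; rewrite cdE => -[].
  have [dy yB] := Wy.
  apply: eqmx_trans (tangent_eqmx (conj ad dy) hd' (conj ac cy)) _.
  suff -> : tangent_mx d c y = J by [].
  have Us : sdomain d c (cmap d y) by exists y.
  apply: jacobian_eq; first exact: C1_differentiable_rV (@sdomain_open _ _ _ _ d c) (local_expr_Cmx 1 ad ac) Us.
  move=> v; apply: (@near_eq_is_derive _ _ _ (fun u : 'rV[R]_(sdim S) => p + (u - u0) *m J)).
    have nI : nbhs (cmap d y) (cimg d) by apply: open_near (cimgP dy); exact: cimg_open.
    have nr : nbhs (cmap d y) (oball u0 rho) by apply: open_near yB; exact: oball_open.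
    by apply: filterS2 nI nr => _ [z dz <-] zB; rewrite /local_expr /comp cmapK // cgE.
  have d1 : is_derive (cmap d y) v (fun u : 'rV[R]_(sdim S) => u - u0) v.
    have := is_deriveB (is_derive_id (cmap d y) v) (is_derive_cst u0 (cmap d y) v).
    by rewrite subr0.
  have := is_deriveD (is_derive_cst p (cmap d y) v) (is_derive_mulmx d1 (is_derive_cst J (cmap d y) v)).
  by rewrite add0r mulmx0 addr0.
Qed.

End Straightening.

Lemma rank_coker_eqmx (F : fieldType) m n d d' (P : 'M[F]_(m, n)) (T : 'M[F]_(d, n))
    (T' : 'M[F]_(d', n)) : (T :=: T')%MS ->
  \rank (P *m cokermx T) = \rank (P *m cokermx T').
Proof.
move=> TT; apply: (@addIn (\rank T)); rewrite rank_coker TT rank_coker.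
by rewrite (adds_eqmx (eqmx_refl P) TT).
Qed.

Section Tubes.
Context {R : realType} {n : nat} {M : manifold R n} (pi : poisson M).
Variables (X : submanifold M) (r : nat).
Hypothesis eX : embedded X.
Hypothesis cX : forall (y : X) d c, chart_at y d -> chart_at (incl y) c ->
  \rank (bivec pi c (incl y) *m cokermx (tangent_mx d c y)) = r.

(** The plaque will be the local saturation, with [X] as its part of vanishing [W]-coordinates;
    [F *m pcut Q = 0] keeps the rays inside it. *)
Definition tube (Q : plaque M (sdim X + r)) (W : 'M[R]_(n, r)) F dl Ah :=
  [/\ plaque_wf Q, pbox pi (pchart Q) (pbase Q) W F dl Ah, F *m pcut Q = 0,
    forall z, plaque_set Q z -> bivec pi (pchart Q) z *m pcut Q = 0 &
    forall x, cdom (pchart Q) x -> (support_set X x <->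
      plaque_set Q x /\ (cmap (pchart Q) x - pbase Q) *m W = 0)].

Lemma tube_exists (y0 : X) : exists Q W F dl Ah, tube Q W F dl Ah /\ cdom (pchart Q) (incl y0).
Proof.
have [Q0 [wQ0 c0q p0 XQ0 TE]] := straighten y0 eX.
set q := incl y0 in c0q p0; have [ac0 EA0] := wQ0.
set c0 := pchart Q0 in c0q p0 XQ0 TE ac0; set E := pdir Q0 in EA0 TE.
set A0 := pcoord Q0 in EA0; set p := cmap c0 q in p0.
have EK0 : E *m pcut Q0 = 0 by exact: pdir_cut.
have [d ad dy0] := atlas_cover y0.
have rE : \rank (bivec pi c0 q *m cokermx E) = r.
  rewrite -(cX (conj ad dy0) (conj ac0 c0q)).
  exact: rank_coker_eqmx (eqmx_sym (TE y0 d (conj ad dy0) c0q)).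
have [a [W [EW aPW]]] := coker_frame rE.
have aPWu : a *m bivec pi c0 q *m W \in unitmx by rewrite aPW unitmx1.
have [c [F [dl [Ah [pb [cq cqE] cc0 _ agree]]]]] := pbox_exists ac0 c0q openT I aPWu.
have [[ac FW dl0] cI CA rad FP] := pb.
(* The correction makes the columns of [A'] and [W] dual to the rows of [E] and [F]. *)
pose A' := A0 - W *m F *m A0.
have EA' : E *m A' = 1%:M by rewrite mulmxBr EA0 !mulmxA EW !mul0mx subr0.
have FA' : F *m A' = 0 by rewrite mulmxBr !mulmxA FW mul1mx subrr.
pose Q := Plaque c p (col_mx E F) (row_mx A' W).
have wQ : plaque_wf Q.
  split=> //=; rewrite mul_col_row EA' EW FA' FW.
  by rewrite scalar_mx_block.
set K := pcut Q.
have [EK FK] : E *m K = 0 /\ F *m K = 0.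
  have := pdir_cut wQ; rewrite /= mul_col_mx -/K => h.
  by split; [have := congr1 usubmx h|have := congr1 dsubmx h]; rewrite (col_mxKu, col_mxKd) linear0.
have KE : K = 1%:M - (A' *m E + W *m F) by rewrite /K /pcut /= mul_row_col.
have XQ x : cdom c x -> (support_set X x <-> plaque_set Q x /\ (cmap c x - p) *m W = 0).
  move=> cx; have [c0x _] := cc0 x cx; have [cW cE] := agree x cx.
  rewrite (XQ0 x c0x); split.
    move=> [_]; rewrite -/c0 p0 mulmxBr mulmx1 => /eqP; rewrite subr_eq0 => /eqP h.
    have hE : cmap c0 x - p = (cmap c0 x - p) *m A0 *m E by rewrite -mulmxA -h.
    have h0 : (cmap c0 x - p) *m W = 0 by rewrite hE -mulmxA EW mulmx0.
    have e : cmap c x = cmap c0 x.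
      by apply: cE; apply/eqP; rewrite -subr_eq0 -mulmxBl h0.
    split; last by rewrite e.
    by split=> //=; rewrite e hE -mulmxA EK mulmx0.
  move=> [[_ /= h] h0].
  have e : cmap c x = cmap c0 x.
    by apply: cE; rewrite -cW; apply/eqP; rewrite -subr_eq0 -mulmxBl h0.
  split=> //; rewrite -/c0 p0 -e.
  move: h; rewrite -/K KE mulmxBr mulmx1 mulmxDr (mulmxA _ W) h0 mul0mx addr0 => /eqP.
  by rewrite subr_eq0 => /eqP ->; rewrite mulmxA -(mulmxA _ E) EK0 mulmx0.
(* The two charts agree on [X], hence so do its tangent spaces in them. *)
have tE (y : X) d' : chart_at y d' -> cdom c (incl y) -> (tangent_mx d' c y :=: E)%MS.
  move=> [ad' d'y] cy; have [c0y _] := cc0 _ cy.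
  apply: eqmx_trans (TE y d' (conj ad' d'y) c0y).
  suff -> : tangent_mx d' c y = tangent_mx d' c0 y by [].
  have Uy : sdomain d' c (cmap d' y) by exists y.
  have Uy0 : sdomain d' c0 (cmap d' y) by exists y.
  have oU := @sdomain_open R n M X d' c.
  have oU0 := @sdomain_open R n M X d' c0.
  apply: jacobian_near.
  - apply: filterS (open_near oU Uy) => _ [z [dz cz] <-].
    rewrite /local_expr /comp cmapK //.
    have [_ cE] := agree _ cz; have [cW _] := agree _ cz.
    have /(XQ _ cz) [_ h0] : support_set X (incl z) by exists z.
    by apply: cE; rewrite -cW; apply/eqP; rewrite -subr_eq0 -mulmxBl h0.
  - exact: C1_differentiable_rV oU (local_expr_Cmx 1 ad' ac) Uy.
  - exact: C1_differentiable_rV oU0 (local_expr_Cmx 1 ad' ac0) Uy0.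
(* Coregularity at every point: the image of the bivector plus the tangent space has dimension
   [sdim X + r]. It contains the rows of [E] and [F], which are as many and independent, so they
   span it. *)
have PX x : support_set X x -> cdom c x -> bivec pi c x *m K = 0.
  move=> Xx cx; have [_ h0] := (XQ x cx).1 Xx.
  have [y _ yx] := Xx; rewrite -yx in cx h0 *.
  have [d' ad' d'y] := atlas_cover y.
  have rk := cX (conj ad' d'y) (conj ac cx).
  rewrite (rank_coker_eqmx _ (tE y d' (conj ad' d'y) cx)) in rk.
  have rs := rank_coker (bivec pi c (incl y)) E; rewrite rk in rs.
  have FPx : (F <= bivec pi c (incl y))%MS.
    have := FP (cmap c (incl y)) (cimgP cx); rewrite /cbivec cmapK // => ->.
      exact: submxMl.
    by apply/eqP; rewrite -subr_eq0 -mulmxBl h0.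
  have sub : (col_mx E F <= bivec pi c (incl y) + E)%MS.
    by rewrite col_mx_sub addsmxSr (submx_trans FPx (addsmxSl _ _)).
  have rC : \rank (col_mx E F) = (sdim X + r)%N.
    by apply/eqP; apply/row_freeP; exists (row_mx A' W); case: wQ.
  have rE' : \rank E = sdim X by apply/eqP; apply/row_freeP; exists A0.
  have /submxP [G GE] : (bivec pi c (incl y) <= col_mx E F)%MS.
    apply: submx_trans (addsmxSl _ E) _.
    have := mxrank_leqif_sup sub => /geq_leqif <-.
    by rewrite rC -rs rE' addnC.
  by rewrite GE -mulmxA; have := pdir_cut wQ; rewrite -/K /= => ->; rewrite mulmx0.
exists Q, W, F, dl, Ah; split=> //; split=> //.
move=> z [/= cz zK]; rewrite -/K in zK *.
have Bz : box p W F dl (cmap c z) by rewrite -cI; exact: cimgP.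
have [Bq qW] := box_proj FW Bz.
set e := (cmap c z - p) *m W in Bq qW; set qh := cmap c z - e *m F in Bq qW.
have Iq : cimg c qh by rewrite cI.
have [cx xE] := cinvP Iq.
(* The foot of the ray stays in the plaque since [F] is tangent to it, and its [W]-coordinates
   vanish, so it lies on [X]; [ray_poisson] starts from there. *)
have Xx : support_set X (cinv c qh).
  apply/(XQ _ cx); rewrite xE; split; last by rewrite mulmxBl qW subrr.
  by split=> //=; rewrite xE -/K /qh addrAC mulmxBl -mulmxA FK mulmx0 subr0.
rewrite -[z in bivec _ _ z](cmapK cz).
rewrite cI in CA rad.
apply: (ray_poisson FW (pbox_poisson_on pb) CA rad Bz EW EK FK); last exact: PX.
by move=> C EC FC; rewrite KE mulmxBl mul1mx mulmxDl -!mulmxA EC FC !mulmx0 addr0 subr0.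
Qed.

End Tubes.

Section TubeGerms.
Context {R : realType} {n : nat} {M : manifold R n} (pi : poisson M).
Variables (X : submanifold M) (r : nat).

Definition is_tube (Q : plaque M (sdim X + r)) :=
  exists W F dl Ah, tube pi Q W F dl Ah.

Lemma tube_sub Q x : is_tube Q -> cdom (pchart Q) x -> support_set X x -> plaque_set Q x.
Proof. by move=> [W [F [dl [Ah [_ _ _ _ XQ]]]]] cx /(XQ x cx) []. Qed.

Lemma plaque_set_closed m (Q : plaque M m) v : cdom (pchart Q) v -> ~ plaque_set Q v ->
  nbhs v (~` plaque_set Q).
Proof.
move=> cv nQ; have cf : {for v, continuous (fun x => (cmap (pchart Q) x - pbase Q) *m pcut Q)}.
  apply: continuous_mulmx; last exact: cst_continuous.
  by apply: continuousB; [exact: cmap_continuous|exact: cst_continuous].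
have v0 : (cmap (pchart Q) v - pbase Q) *m pcut Q != 0 by apply/eqP => h; apply: nQ.
by apply: filterS (cvgr_neq0 _ cf v0) => z /eqP z0 [_].
Qed.

(** The curve runs inside [O], and [V] is any larger set, so the same curve serves for the leaves of
    [O] and for those of the final neighbourhood. The rank [k] depends on the ray. *)
Definition rays (Q : plaque M (sdim X + r)) (O : set M) :=
  forall z, O z -> plaque_set Q z -> exists q, [/\ support_set X q, O q &
    forall V : set M, O `<=` V -> exists k (g : R -> M),
      [/\ has_rank pi k q, leafwise pi V k g, g 0 = q & g 1 = z]].

(** A smaller box with the same [W] and [F], recentred at [x], fits into [N]. Since [x] lies on the
    slice of the old box, both boxes project along the rays onto the same slice. *)
Lemma tube_ray Q x (N : set M) : is_tube Q -> support_set X x -> cdom (pchart Q) x ->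
  open N -> N x ->
  exists O, [/\ open O, O x, O `<=` N & rays Q O].
Proof.
move=> [W [F [dl [Ah [wQ pb FK _ XQ]]]]] Xx cx oN Nx.
have PO := pbox_poisson_on pb.
have [[ac FW dl0] cI CA rad FP] := pb.
set c := pchart Q in cx XQ PO ac cI CA rad FP *; set p := pbase Q in PO XQ cI rad FP.
have [_ x0W] := (XQ x cx).1 Xx.
set y0 := cmap c x in x0W.
have nN : nbhs y0 (cmap c @` (cdom c `&` N)).
  by apply: nbhs_open; [exact: chart_open_img|exists x].
have [dt dt0 boxN] := nbhs_box W F nN.
have boxI : box y0 W F dt `<=` cimg c by move=> y /boxN [z [cz _] <-]; exact: cimgP.
exists (cdom c `&` cmap c @^-1` box y0 W F dt); split.
- by apply: chart_open_preimg; exact: box_open.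
- by split=> //; exact: box_center.
- by move=> z [cz /boxN [w [cw Nw] wz]]; rewrite -(cmapK cz) -wz cmapK.
move=> z [cz Bz] Qz; set y := cmap c z in Bz.
set e := (y - p) *m W.
have y0W : y0 *m W = p *m W by apply/eqP; rewrite -subr_eq0 -mulmxBl x0W.
have eE : (y - y0) *m W = e.
  by rewrite mulmxBl y0W -mulmxBl.
have [Bq qW] := box_proj FW Bz.
rewrite eE in Bq qW; set q := y - e *m F in Bq qW.
rewrite y0W in qW.
have Bt (t : R) : 0 <= t <= 1 -> box y0 W F dt (q + t *: (e *m F)).
  move=> /andP[t0 t1]; have := box_line (s := t) FW Bz.
  by rewrite eE; apply; rewrite ger0_norm.
have [cq qE] := cinvP (boxI _ Bq).
have tW (t : R) : (q + t *: (e *m F) - p) *m W = t *: e.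
  by rewrite mulmxBl mulmxDl qW -scalemxAl -mulmxA FW mulmx1 addrAC subrr add0r.
exists (cinv c q); split.
- apply/(XQ _ cq); rewrite qE; split; last by rewrite mulmxBl qW subrr.
  split=> //; rewrite -/c qE -/p /q addrAC mulmxBl -mulmxA FK mulmx0 subr0.
  by case: Qz.
- by split=> //; rewrite /= qE.
move=> V OV; exists (\rank (cbivec pi c q)), (fun t => cinv c (q + clamp01 t *: (e *m F))).
have rk (t : R) : 0 <= t <= 1 ->
    \rank (cbivec pi c (q + t *: (e *m F))) = \rank (cbivec pi c q).
  move=> ti; have := boxI _ (Bt t ti); rewrite cI => Bp.
  have rad' := rad; have CA' := CA; rewrite cI in rad' CA'.
  by rewrite (ray_rank FW PO CA' rad' Bp) tW -scalemxAl addrK.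
have hr (t : R) : 0 <= t <= 1 ->
    has_rank pi (\rank (cbivec pi c q)) (cinv c (q + t *: (e *m F))).
  move=> ti; have [ct _] := cinvP (boxI _ (Bt t ti)).
  by apply: (has_rankP ac ct); exact: rk.
split.
- by have := hr 0; rewrite scale0r addr0; apply; rewrite lexx ler01.
- apply: line_leafwise => // t ti /=; have It := boxI _ (Bt t ti).
  have [ct tE] := cinvP It; split=> //.
  + by apply: OV; split=> //; rewrite /= tE; exact: Bt.
  + exact: hr.
  (* At [t = 0] the radial identity reads [0 = 0]; tangency at the foot is the last clause of
     [pbox]. *)
  have [t0|t0] := eqVneq t 0.
    rewrite t0 scale0r addr0 in It *; rewrite (FP q It qW) mulmxA.
    exact: submxMl.
  have := rad _ It; rewrite tW -!scalemxAl => /(congr1 (fun v => t^-1 *: v)).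
  rewrite !scalerA mulVf // !scale1r => h.
  by rewrite [X in (X <= _)%MS]h; exact: submxMl.
- by rewrite clamp01_id ?lexx ?ler01 // scale0r addr0.
- by rewrite clamp01_id ?lexx ?ler01 // scale1r subrK cmapK.
Qed.

(** The leaves used are those of an open set [N] inside the chart domain of [Q2], where the second
    plaque is closed and hence absorbing. *)
Lemma tube_germ Q1 Q2 x : is_tube Q1 -> is_tube Q2 -> support_set X x ->
  cdom (pchart Q1) x -> cdom (pchart Q2) x ->
  \forall z \near x, plaque_set Q1 z -> plaque_set Q2 z.
Proof.
move=> T1 T2 Xx c1x c2x.
have [N [oN Nx Nc2 Nray]] := tube_ray T1 Xx c1x (cdom_open (pchart Q2)) c2x.
have nN := nbhs_open oN Nx; apply: filterS nN => z Nz Q1z.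
have [q [Xq Nq rq]] := Nray z Nz Q1z.
have [k [g [hq lg g0 g1]]] := rq N (fun _ h => h).
have [S [[iS _] Sq aS]] := leaf_through oN Nq hq.
have Sz : support_set S z.
  by rewrite -g1; apply: (aS _ g 0) => //; [exact: connected_line|rewrite g0].
have [W [F [dl [Ah [wQ2 _ _ PQ2 _]]]]] := T2.
apply: (absorbing_sub (V := N) _ iS Sq); last exact: Sz.
  split=> [v Nv nv|L y cL LN Qy]; first exact: plaque_set_closed (Nc2 _ Nv) nv.
  exact: poisson_plaque_local wQ2 PQ2 cL Qy.
exact: tube_sub T2 (Nc2 _ Nq) Xq.
Qed.

End TubeGerms.

(** * Globalisation *)

Section Globalisation.
Context {R : realType} {n : nat} {M : manifold R n} (pi : poisson M).
Variables (X : submanifold M) (r : nat).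
Hypothesis eX : embedded X.
Hypothesis cX : forall (y : X) d c, chart_at y d -> chart_at (incl y) c ->
  \rank (bivec pi c (incl y) *m cokermx (tangent_mx d c y)) = r.

(** The image of a closed ball is compact, hence closed in [M]. The germs of two tubes are compared
    also at points that are only in the closure of an indexed set, and these must still lie in its
    chart. *)
Lemma shrink_chart (c : chart R n M) x : cdom c x ->
  exists V : set M, [/\ open V, V x & closure V `<=` cdom c].
Proof.
move=> cx; have [rho rho0 hrho] := nbhs_cball (open_near (@cimg_open _ _ _ c) (cimgP cx)).
exists (cdom c `&` cmap c @^-1` oball (cmap c x) rho); split.
- by apply: chart_open_preimg; exact: oball_open.
- by split=> //; exact: oball_center.
have cK : closed (cinv c @` cball (cmap c x) rho).
  apply: compact_closed; first exact: points_hausdorff.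
  apply: continuous_compact; last first.
    by apply: bounded_closed_compact; [exact: cball_bounded|exact: cball_closed].
  apply: continuous_in_subspaceT => y /[1!inE] /hrho; exact: cinv_continuous.
have sub : cdom c `&` cmap c @^-1` oball (cmap c x) rho `<=` cinv c @` cball (cmap c x) rho.
  by move=> z [cz zB]; exists (cmap c z); [exact: oball_cball|rewrite cmapK].
move=> z /(closureS sub); rewrite -(closure_id _).1 // => -[y yB <-].
by have [] := cinvP (hrho y yB).
Qed.

Local Notation index := (plaque M (sdim X + r) * set M)%type.

Definition admissible (i : index) :=
  [/\ is_tube pi i.1, open i.2 & closure i.2 `<=` cdom (pchart i.1)].

Lemma admissible_cover x : support_set X x -> exists2 i, admissible i & i.2 x.
Proof.
move=> [y _ <-]; have [Q [W [F [dl [Ah [TQ cy]]]]]] := tube_exists eX cX y.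
have [V [oV Vy VQ]] := shrink_chart cy.
by exists (Q, V) => //; split=> //; exists W, F, dl, Ah.
Qed.

Lemma countable_cover : exists (C : set index) (f : index -> nat),
  [/\ forall i, C i -> admissible i, forall i j, C i -> C j -> f i = f j -> i = j &
    forall x, support_set X x -> exists2 i, C i & i.2 x].
Proof.
have od (i : {i | admissible i}) : open (sval i).2 by case: i => i [].
have [C cC CP] := lindelof (@points_second_countable R n M) od.
have : countable (sval @` C) by apply: sub_countable (card_image_le _ _) _.
move=> /countable_injP [f finj]; exists (sval @` C), f; split.
- by move=> _ [[i ai] _ <-].
- by move=> i j Ci Cj; apply: finj; rewrite inE.
- move=> x Xx; have [i ai ix] := admissible_cover Xx.
  by have [j Cj jx] := CP (exist _ i ai) x ix; exists (sval j) => //; exists j.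
Qed.

Variables (C : set index) (f : index -> nat).
Hypothesis Cadm : forall i, C i -> admissible i.
Hypothesis finj : forall i j, C i -> C j -> f i = f j -> i = j.
Hypothesis Ccover : forall x, support_set X x -> exists2 i, C i & i.2 x.

Lemma cover_dom i z : C i -> i.2 z -> cdom (pchart i.1) z.
Proof. by move=> /Cadm [_ _ h] iz; apply: h; exact: subset_closure. Qed.

(** Testing [closure j.2 x] rather than [j.2 x] leaves no uncontrolled boundary point: in the
    closure the germs at [x] can be compared, outside it a neighbourhood of [x] misses [j.2]. *)
Definition consistent x (i j : index) z :=
  (closure j.2 x -> plaque_set j.1 z <-> plaque_set i.1 z) /\
  (~ closure j.2 x -> ~ j.2 z).

(* Only the finitely many boxes of smaller index than [i] are constrained, so
   that such a neighbourhood of [x] exists; two good sets agree since one of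
   their indices is the smaller one. *)
Definition good x i (O : set M) :=
  [/\ C i, open O /\ O x, O `<=` i.2, rays pi i.1 O &
    forall j, C j -> (f j < f i)%N -> forall z, O z -> consistent x i j z].

Lemma good_exists x : support_set X x -> exists i O, good x i O.
Proof.
move=> Xx.
have [i Ci ix] := Ccover Xx.
have [Ti oi cli] := Cadm Ci; have idx := cover_dom Ci ix.
(* [f] is injective on [C], so each number [m'] carries at most one condition; the finitely many
   below [f i] are then intersected by induction. *)
have near1 m' : \forall z \near x, forall j, C j -> f j = m' -> (f j < f i)%N -> consistent x i j z.
  have [[j [Cj fj jlt]]|nj] := pselect (exists j, [/\ C j, f j = m' & (f j < f i)%N]); last first.
    by apply: nearW => z j Cj fj jlt; case: nj; exists j.
  have [Tj oj clj] := Cadm Cj.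
  suff h : \forall z \near x, consistent x i j z.
    apply: filterS h => z h j' Cj' fj' _.
    by rewrite (finj Cj' Cj) // fj' fj.
  have [clx|nclx] := pselect (closure j.2 x).
    have jdx := clj _ clx.
    have g1 := tube_germ Tj Ti Xx jdx idx; have g2 := tube_germ Ti Tj Xx idx jdx.
    by apply: filterS2 g1 g2 => z h1 h2; split=> // _; split.
  have nb : nbhs x (~` closure j.2).
    by apply: nbhs_open => //; apply: closed_openC; exact: closed_closure.
  by apply: filterS nb => z nz; split=> // _ jz; apply: nz; exact: subset_closure.
have near2 N : \forall z \near x, forall j, C j -> (f j < N)%N -> (f j < f i)%N -> consistent x i j z.
  elim: N => [|N IH]; first by apply: nearW => z j _; rewrite ltn0.
  apply: filterS2 IH (near1 N) => z h1 h2 j Cj; rewrite ltnS leq_eqVlt => /orP[/eqP fj|fj] jlt.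
    exact: h2.
  exact: h1.
have : nbhs x [set z | forall j, C j -> (f j < f i)%N -> consistent x i j z].
  by apply: filterS (near2 (f i)) => z h j Cj jlt; exact: h.
rewrite nbhsE => -[U [oU Ux] UP].
have [A [oA Ax AU rA]] := tube_ray Ti Xx idx (openI oU oi) (conj Ux ix).
exists i, A; split=> //.
- by move=> z /AU [].
- by move=> j Cj jlt z /AU [Uz _]; exact: UP.
Qed.

Definition tube_nbhd : set M := [set z | exists x i A, good x i A /\ A z].

Definition tube_union : set M :=
  [set z | exists x i A, [/\ good x i A, A z & plaque_set i.1 z]].

Lemma tube_nbhd_open : open tube_nbhd.
Proof.
rewrite openE => z [x [i [A [G Az]]]]; have [_ [oA _] _ _ _] := G.
by apply: filterS (nbhs_open oA Az) => w Aw; exists x, i, A.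
Qed.

Lemma tube_union_local x i A z : good x i A -> A z -> tube_union z -> plaque_set i.1 z.
Proof.
move=> [Ci _ Ai _ gi] Az [x' [i' [A' [[Ci' _ Ai' _ gi'] A'z Pz]]]].
have [lt|lt|e] := ltngtP (f i') (f i).
- have [h1 h2] := gi i' Ci' lt z Az.
  have [clx|nclx] := pselect (closure i'.2 x); first exact/(h1 clx).
  by exfalso; apply: (h2 nclx); exact: Ai'.
- have [h1 h2] := gi' i Ci lt z A'z.
  have [clx|nclx] := pselect (closure i.2 x'); first exact/(h1 clx).
  by exfalso; apply: (h2 nclx); exact: Ai.
- by rewrite (finj Ci Ci' (esym e)).
Qed.

Lemma good_dom x i A z : good x i A -> A z -> cdom (pchart i.1) z.
Proof. by move=> [Ci _ Ai _ _] Az; apply: cover_dom Ci _; exact: Ai. Qed.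

Lemma good_tube x i A : good x i A -> is_tube pi i.1.
Proof. by move=> [Ci _ _ _ _]; have [] := Cadm Ci. Qed.

Lemma support_tube_union : support_set X `<=` tube_union.
Proof.
move=> x Xx; have [i [A G]] := good_exists Xx; have [_ [_ Ax] _ _ _] := G.
exists x, i, A; split=> //.
exact: tube_sub (good_tube G) (good_dom G Ax) Xx.
Qed.

Lemma tube_union_absorbing : absorbing pi tube_nbhd tube_union.
Proof.
split=> [v [x [i [A [G Av]]]] nv|L y cL _ [x [i [A [G Ay Qy]]]]].
  have nQ : ~ plaque_set i.1 v by move=> Qv; apply: nv; exists x, i, A.
  have [_ [oA _] _ _ _] := G.
  apply: filterS2 (plaque_set_closed (good_dom G Av) nQ) (nbhs_open oA Av) => z nz Az Pz.
  by apply: nz; exact: tube_union_local G Az Pz.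
have [W [F [dl [Ah [wQ _ _ PQ _]]]]] := good_tube G.
have [_ [oA _] _ _ _] := G.
have n1 := poisson_plaque_local wQ PQ cL Qy.
have n2 : \forall z \near y, A (incl z).
  by apply: (@incl_continuous R n M L y); exact: nbhs_open.
by apply: filterS2 n1 n2 => z Qz Az; exists x, i, A.
Qed.

(** The ray clause of a good set is used with the whole neighbourhood as [V], whose leaves may be
    longer than those of the good set. *)
Lemma saturation_tube_union : saturation pi tube_nbhd (support_set X) = tube_union.
Proof.
apply/seteqP; split=> [z [L [[iL _] [w [Lw Xw]] Lz]]|z [x [i [A [G Az Qz]]]]].
  by apply: (absorbing_sub tube_union_absorbing iL Lw _ Lz); exact: support_tube_union.
have [_ _ _ rA _] := G; have [q [Xq Aq rq]] := rA z Az Qz.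
have AV : A `<=` tube_nbhd by move=> w Aw; exists x, i, A.
have [k [g [hq lg g0 g1]]] := rq _ AV.
have [S [sS Sq aS]] := leaf_through tube_nbhd_open (AV _ Aq) hq.
exists S; split=> //; first by exists q.
by rewrite -g1; apply: (aS _ g 0) => //; [exact: connected_line|rewrite g0].
Qed.

Lemma restrict_plaque m (Q : plaque M m) (A : set M) : plaque_wf Q -> open A ->
  (forall z, plaque_set Q z -> bivec pi (pchart Q) z *m pcut Q = 0) ->
  exists Q' : plaque M m, [/\ plaque_wf Q', plaque_set Q' = plaque_set Q `&` A &
    forall z, plaque_set Q' z -> (bivec pi (pchart Q') z <= pdir Q')%MS].
Proof.
move=> [aQ EA] oA PQ; have [c [ac cdE cmE _]] := restrict_chart aQ oA.
have e : plaque_set (Plaque c (pbase Q) (pdir Q) (pcoord Q)) = plaque_set Q `&` A.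
  apply/seteqP; split=> z.
    by move=> [/= cz h]; move: cz; rewrite cdE => -[cz Az]; split=> //; split=> //; rewrite -cmE.
  by move=> [[cz h] Az]; split; rewrite /= ?cdE ?cmE.
exists (Plaque c (pbase Q) (pdir Q) (pcoord Q)); split=> //.
rewrite e => z [Qz Az]; have [cz _] := Qz => /=.
have c'z : cdom c z by rewrite cdE.
rewrite (bivec_change pi aQ ac cz c'z) (Jt_refl aQ cz cmE) trmx1 mul1mx mulmx1.
have := PQ z Qz; rewrite mulmxBr mulmx1 => /eqP; rewrite subr_eq0 => /eqP ->.
by rewrite mulmxA submxMl.
Qed.

(** Within a good set the union is a single plaque. Plaques cut down to good sets therefore overlap
    in relatively open sets, and open sets of the glued manifold are locally traced by open sets of
    [M], which gives embeddedness. *)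
Theorem tube_union_submanifold : exists S : submanifold M,
  [/\ support_set S = tube_union, embedded S & poisson_submanifold pi S].
Proof.
pose T := {a : index * set M | exists x, good x a.1 a.2}.
have oT (a : T) : open (sval a).2 by have [x [_ [oA _] _ _ _]] := svalP a.
have [C2 cC2 C2P] := lindelof (@points_second_countable R n M) oT.
have /choice [g gP] : forall a : T, exists Q : plaque M (sdim X + r), [/\ plaque_wf Q,
    plaque_set Q = tube_union `&` (sval a).2 &
    forall z, plaque_set Q z -> (bivec pi (pchart Q) z <= pdir Q)%MS].
  move=> [[i A] /= [x G]]; have [_ [oA _] _ _ _] := G.
  have [W [F [dl [Ah [wQ _ _ PQ _]]]]] := good_tube G.
  have [Q [wQ' QE QP]] := restrict_plaque wQ oA PQ.
  exists Q; split=> //; rewrite QE; apply/seteqP; split=> z [h1 h2]; split=> //.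
    by exists x, i, A.
  exact: tube_union_local G h2 h1.
have [|||S gS] := @glue_plaques R n M _ (g @` C2).
- exact: sub_countable (card_image_le _ _) _.
- by move=> _ [a _ <-]; have [] := gP a.
- move=> _ _ z [a _ <-] [b _ <-]; have [_ -> _] := gP a; have [_ -> _] := gP b => -[Pz az] [_ bz].
  by exists (sval b).2; split=> // w [[Pw _] bw].
have [dS sS oS _ tS] := gS.
have sE : support_set S = tube_union.
  rewrite sS; apply/seteqP; split=> z.
    by move=> [_ [a _ <-]]; have [_ -> _] := gP a => -[].
  move=> Pz; have [x [i [A [G Az _]]]] := Pz.
  have [b C2b bz] := C2P (exist _ (i, A) (ex_intro _ x G)) z Az.
  by exists (g b); [exists b|have [_ -> _] := gP b].
have cov (y : S) : exists2 b, C2 b & plaque_set (g b) (incl y).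
  have : support_set S (incl y) by exists y.
  by rewrite sS => -[_ [b C2b <-] Qy]; exists b.
exists S; split=> //.
- move=> U oU; exists (\bigcup_(O in [set O : set M | open O /\
      forall z : S, O (incl z) -> U z]) O).
    by apply: bigcup_open => O [].
  apply/seteqP; split=> y; last by move=> [A [_ AU] Ay]; exact: AU.
  move=> Uy; have [b C2b Qy] := cov y.
  have Db : (g @` C2) (g b) by exists b.
  have [A [oA Ay AU]] := oS U oU y (g b) Uy Db Qy.
  have [_ QE _] := gP b; rewrite QE in Qy; have [_ by_] := Qy.
  exists (A `&` (sval b).2) => //; split; first exact: openI.
  move=> z [Az bz]; apply: AU => //; rewrite QE; split=> //.
  by rewrite -sE; exists z.
- move=> y d c hd [ac cy]; have [b C2b Qy] := cov y.
  have [wQ _ QP] := gP b; have [aQ _] := wQ; have [Qd _] := Qy.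
  have Db : (g @` C2) (g b) by exists b.
  rewrite (tangent_change hd (conj aQ Qd) (conj ac cy)).
  rewrite (bivec_eqmx pi aQ ac Qd cy); apply: submxMr.
  by rewrite (tS y d (g b) hd Db Qy); exact: QP.
Qed.

End Globalisation.

Theorem theoremA (R : realType) (n : nat) (M : manifold R n)
    (pi : poisson M) (X : submanifold M) :
  embedded X -> coregular pi X ->
  exists V : set M,
    [/\ open V, support_set X `<=` V &
        exists P : submanifold M,
          [/\ support_set P = saturation pi V (support_set X),
              embedded P & poisson_submanifold pi P]].
Proof.
move=> eX [r cX]; have [C [f [Cadm finj Ccover]]] := countable_cover eX cX.
exists (tube_nbhd pi C f); split.
- exact: tube_nbhd_open.
- move=> x /(support_tube_union Cadm finj Ccover) [x' [i [A [G Ax _]]]].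
  by exists x', i, A.
have [P [sP eP pP]] := tube_union_submanifold Cadm finj.
by exists P; rewrite (saturation_tube_union Cadm finj Ccover).
Qed.
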